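(* Let $k$ be a commutative ring, $H$ a dual quasi-bialgebra over $k$ with reassociator $\phi$, $A$ an associative $k$-algebra, $B$ an $H$-comodule quasi-algebra (i.e. an algebra in the monoidal category $\mathcal{M}^H$ of right $H$-comodules), and let $(A,B,\Sigma,\Sigma',\mu,\eta)$ be an adjoint pair in the bicategory $\mathrm{Bim}(\mathcal{M}^H)$, with $\Sigma\in{}_B\mathcal{M}^H_A$, $\Sigma'\in{}_A\mathcal{M}^H_B$, $\mu:\Sigma'\otimes_B\Sigma\to A$, $\eta:B\to\Sigma\otimes_A\Sigma'$; write $\eta(1_B)=e_i\otimes_Af_i$ (summation understood). Then $\Sigma'\otimes_B\Sigma$ is an $A$-coring, with counit $\mu$ and comultiplication $\Delta$ defined for all $y\otimes_Bx\in\Sigma'\otimes_B\Sigma$ by $$\begin{aligned}\Delta(y\otimes_Bx)&=(y_{[0]}\otimes_Be_{i[0]})\otimes_A(f_{i[0]}\otimes_Bx_{[0]})\,\phi(y_{[1]}\cdot e_{i[1]},f_{i[1]},x_{[1]})\,\phi^{-1}(y_{[2]},e_{i[2]},f_{i[2]})\\&=(y_{[0]}\otimes_Be_{i[0]})\otimes_A(f_{i[0]}\otimes_Bx_{[0]})\,\phi^{-1}(y_{[1]},e_{i[1]},f_{i[1]}\cdot x_{[1]})\,\phi(e_{i[2]},f_{i[2]},x_{[2]}).\end{aligned}$$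
   Context: $\otimes=\otimes_k$. A dual quasi-bialgebra is $(H,\Delta,\varepsilon,\mu_H,\eta_H,\phi)$ where $(H,\Delta,\varepsilon)$ is a coassociative counital $k$-coalgebra ($\Delta(a)=a_{(1)}\otimes a_{(2)}$), the product $\mu_H:H\otimes H\to H$, $a\otimes b\mapsto a\cdot b$, and unit $\eta_H:k\to H$ are coalgebra maps with $1$ a unit for the product, and $\phi:H\otimes H\otimes H\to k$ is convolution invertible with inverse $\phi^{-1}$, such that for all $a,b,c,d\in H$ $$\phi(b_{(1)},c_{(1)},d_{(1)})\phi(a_{(1)},b_{(2)}\cdot c_{(2)},d_{(2)})\phi(a_{(2)},b_{(3)},c_{(3)})=\phi(a_{(1)},b_{(1)},c_{(1)}\cdot d_{(1)})\phi(a_{(2)}\cdot b_{(2)},c_{(2)},d_{(2)}),$$ $$\phi(a,1,b)=\varepsilon(a)\varepsilon(b),\qquad a_{(1)}\cdot(b_{(1)}\cdot c_{(1)})\,\phi(a_{(2)},b_{(2)},c_{(2)})=\phi(a_{(1)},b_{(1)},c_{(1)})\,(a_{(2)}\cdot b_{(2)})\cdot c_{(2)}.$$ $\mathcal{M}^H$ is the category of right comodules over the coalgebra $H$, with coactions written $m\mapsto m_{[0]}\otimes m_{[1]}$ (and iterated $m_{[0]}\otimes m_{[1]}\otimes m_{[2]}$). It is monoidal with tensor product $\otimes$ (coaction $m\otimes n\mapsto m_{[0]}\otimes n_{[0]}\otimes m_{[1]}\cdot n_{[1]}$), unit $k$ with coaction $\eta_H$, and associativity constraint $$\Phi_{M,N,P}:(M\otimes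 N)\otimes P\to M\otimes(N\otimes P),\quad (m\otimes n)\otimes p\mapsto m_{[0]}\otimes(n_{[0]}\otimes p_{[0]})\,\phi(m_{[1]},n_{[1]},p_{[1]}).$$ $\mathrm{Bim}(\mathcal{M}^H)$ is the bicategory whose 0-cells are algebras in $\mathcal{M}^H$, whose 1-cells are bimodules in $\mathcal{M}^H$ over these algebras (the $R$-$S$-bimodules form ${}_R\mathcal{M}^H_S$), and whose 2-cells are bilinear maps in $\mathcal{M}^H$; 1-cells compose by the tensor product $\otimes_R$ over the middle algebra, formed as a coequalizer in $\mathcal{M}^H$. That $(A,B,\Sigma,\Sigma',\mu,\eta)$ is an adjoint pair in $\mathrm{Bim}(\mathcal{M}^H)$ means: $\Sigma\in{}_B\mathcal{M}^H_A$, $\Sigma'\in{}_A\mathcal{M}^H_B$, $\eta$ is a morphism in ${}_B\mathcal{M}^H_B$, $\mu$ is a morphism in ${}_A\mathcal{M}^H_A$, and, with $\eta(1_B)=e_i\otimes_Af_i$, for all $x\in\Sigma$, $y\in\Sigma'$ $$x=e_{i[0]}\,\mu(f_{i[0]}\otimes_Bx_{[0]})\,\phi(e_{i[1]},f_{i[1]},x_{[1]}),\qquad y=\mu(y_{[0]}\otimes_Be_{i[0]})f_{i[0]}\,\phi^{-1}(y_{[1]},e_{i[1]},f_{i[1]}).$$ An $A$-coring is a comonad on $A$ in the bicategory of $k$-algebras, bimodules and bimodule maps: an $A$-bimodule $C$ with $A$-bimodule maps $C\to C\otimes_AC$ (comultiplication) and $C\to A$ (counit) that are coassociative and counital.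
   Formalization: ''A-coring'' is read as a comonad on A in Bim(M^H): coassociativity of Δ holds up to the associativity constraint Φ of M^H, since plain coassociativity fails (e.g. H = k[Z/2], φ(a,b,c) = (-1)^{abc}, A = B = k); A carries the trivial coaction. *)

(* Defs.v *)
From HB Require Import structures.
From mathcomp Require Import all_boot all_algebra.
From mathcomp Require Import boolp.

Set Implicit Arguments.
Unset Strict Implicit.
Unset Printing Implicit Defensive.

Import GRing.Theory.
Local Open Scope ring_scope.
Local Open Scope quotient_scope.

(** * Linear algebra over a commutative ring *)

Definition bilin (k : comPzRingType) (M N P : lmodType k) (f : M -> N -> P) :=
  (forall n, linear (f^~ n)) /\ (forall m, linear (f m)).

Definition trilin (k : comPzRingType) (M N P Q : lmodType k)
    (f : M -> N -> P -> Q) :=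
  [/\ forall n p, linear (fun m => f m n p),
      forall m p, linear (fun n => f m n p) & forall m n, linear (f m n)].

(** ** The tensor product over [k]

  An element of the tensor product is a class of formal sums of pairs (m, n);
  two formal sums are identified when every bilinear map takes the same value
  on them.  [tens_ind], [tlift_linear], [tlift_pure] below are the universal
  property. *)

Section Tensor.
Variables (k : comPzRingType) (M N : lmodType k).

Definition fsum (P : lmodType k) (f : M -> N -> P) (s : seq (M * N)) : P :=
  \sum_(p <- s) f p.1 p.2.

Definition tens_rel (s t : seq (M * N)) : bool :=
  `[< forall (P : lmodType k) (f : M -> N -> P), bilin f -> fsum f s = fsum f t >].

Lemma tens_relP s t : reflect
  (forall (P : lmodType k) (f : M -> N -> P), bilin f -> fsum f s = fsum f t)
  (tens_rel s t).
Proof. exact: asboolP. Qed.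

Lemma tens_rel_refl : reflexive tens_rel.
Proof. by move=> s; apply/tens_relP. Qed.

Lemma tens_rel_sym : symmetric tens_rel.
Proof.
by move=> s t; apply/tens_relP/tens_relP => h P f /h.
Qed.

Lemma tens_rel_trans : transitive tens_rel.
Proof.
move=> s t u /tens_relP h1 /tens_relP h2; apply/tens_relP => P f bf.
by rewrite h1 // h2.
Qed.

Canonical tens_equiv :=
  EquivRel tens_rel tens_rel_refl tens_rel_sym tens_rel_trans.

Definition tens := {eq_quot tens_rel}.
HB.instance Definition _ := Choice.on tens.
HB.instance Definition _ := EqQuotient.on tens.

Definition pure (m : M) (n : N) : tens := \pi_tens [:: (m, n)].

Definition tlift (P : lmodType k) (f : M -> N -> P) (t : tens) : P :=
  fsum f (repr t).

Lemma tens_eqP s t : \pi_tens s = \pi_tens t <->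
  forall (P : lmodType k) (f : M -> N -> P), bilin f -> fsum f s = fsum f t.
Proof.
split; last by move=> h; apply/eqmodP/tens_relP.
by move/eqmodP/tens_relP.
Qed.

Lemma tlift_pi (P : lmodType k) (f : M -> N -> P) s :
  bilin f -> tlift f (\pi_tens s) = fsum f s.
Proof.
move=> bf; rewrite /tlift.
by have /tens_eqP/(_ P f bf) := reprK (\pi_tens s).
Qed.

Lemma tlift_pure (P : lmodType k) (f : M -> N -> P) m n :
  bilin f -> tlift f (pure m n) = f m n.
Proof. by move=> bf; rewrite tlift_pi // /fsum big_seq1. Qed.

Definition tadd (x y : tens) : tens := \pi_tens (repr x ++ repr y).
Definition tscale (a : k) (x : tens) : tens :=
  \pi_tens [seq (a *: p.1, p.2) | p <- repr x].
Definition tzero : tens := \pi_tens [::].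
Definition topp (x : tens) : tens := tscale (-1) x.

Lemma bilinZl (P : lmodType k) (f : M -> N -> P) a m n :
  bilin f -> f (a *: m) n = a *: f m n.
Proof.
move=> [/(_ n) lf _].
have f0 : f 0 n = 0.
  have := lf 1 0 0; rewrite !scale1r addr0 => /eqP.
  by rewrite -subr_eq subrr => /eqP <-.
by have := lf a m 0; rewrite !addr0 f0 addr0.
Qed.

Lemma bilinDl (P : lmodType k) (f : M -> N -> P) m m' n :
  bilin f -> f (m + m') n = f m n + f m' n.
Proof. by move=> [/(_ n)/(_ 1 m m')]; rewrite !scale1r. Qed.

Lemma bilinZr (P : lmodType k) (f : M -> N -> P) a m n :
  bilin f -> f m (a *: n) = a *: f m n.
Proof.
move=> [_ /(_ m) lf].
have f0 : f m 0 = 0.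
  have := lf 1 0 0; rewrite !scale1r addr0 => /eqP.
  by rewrite -subr_eq subrr => /eqP <-.
by have := lf a n 0; rewrite !addr0 f0 addr0.
Qed.

Lemma bilinDr (P : lmodType k) (f : M -> N -> P) m n n' :
  bilin f -> f m (n + n') = f m n + f m n'.
Proof. by move=> [_ /(_ m)/(_ 1 n n')]; rewrite !scale1r. Qed.

Lemma fsum_scale (P : lmodType k) (f : M -> N -> P) a s :
  bilin f -> fsum f [seq (a *: p.1, p.2) | p <- s] = a *: fsum f s.
Proof.
move=> bf; rewrite /fsum big_map scaler_sumr; apply: eq_bigr => p _ /=.
exact: bilinZl.
Qed.

Lemma tliftD (P : lmodType k) (f : M -> N -> P) x y :
  bilin f -> tlift f (tadd x y) = tlift f x + tlift f y.
Proof. by move=> bf; rewrite tlift_pi // /fsum big_cat. Qed.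

Lemma tliftZ (P : lmodType k) (f : M -> N -> P) a x :
  bilin f -> tlift f (tscale a x) = a *: tlift f x.
Proof. by move=> bf; rewrite tlift_pi // fsum_scale. Qed.

Lemma tlift0 (P : lmodType k) (f : M -> N -> P) :
  bilin f -> tlift f tzero = 0.
Proof. by move=> bf; rewrite tlift_pi // /fsum big_nil. Qed.

Lemma tens_sepP (x y : tens) :
  (forall (P : lmodType k) (f : M -> N -> P), bilin f -> tlift f x = tlift f y) ->
  x = y.
Proof. by move=> h; rewrite -[x]reprK -[y]reprK; apply/tens_eqP. Qed.

Lemma taddA : associative tadd.
Proof. by move=> x y z; apply: tens_sepP => P f bf; rewrite !tliftD // addrA. Qed.
Lemma taddC : commutative tadd.
Proof. by move=> x y; apply: tens_sepP => P f bf; rewrite !tliftD // addrC. Qed.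
Lemma tadd0 : left_id tzero tadd.
Proof. by move=> x; apply: tens_sepP => P f bf; rewrite tliftD // tlift0 // add0r. Qed.
Lemma taddN : left_inverse tzero topp tadd.
Proof.
move=> x; apply: tens_sepP => P f bf.
by rewrite tliftD // tliftZ // tlift0 // scaleN1r addNr.
Qed.

HB.instance Definition _ := GRing.isZmodule.Build tens taddA taddC tadd0 taddN.

Lemma tscaleA a b x : tscale a (tscale b x) = tscale (a * b) x.
Proof. by apply: tens_sepP => P f bf; rewrite !tliftZ // scalerA. Qed.
Lemma tscale1 : left_id 1 tscale.
Proof. by move=> x; apply: tens_sepP => P f bf; rewrite tliftZ // scale1r. Qed.
Lemma tscaleDr : right_distributive tscale +%R.
Proof.
move=> a x y; apply: tens_sepP => P f bf.
by rewrite tliftZ // !tliftD // !tliftZ // scalerDr.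
Qed.
Lemma tscaleDl x : {morph tscale^~ x : a b / a + b}.
Proof.
move=> a b; apply: tens_sepP => P f bf.
by rewrite tliftD // !tliftZ // scalerDl.
Qed.

HB.instance Definition _ :=
  GRing.Zmodule_isLmodule.Build k tens tscaleA tscale1 tscaleDr tscaleDl.

Lemma tlift_linear (P : lmodType k) (f : M -> N -> P) :
  bilin f -> linear (tlift f).
Proof. by move=> bf a x y; rewrite tliftD // tliftZ. Qed.

Lemma pure_bilin : bilin pure.
Proof.
split=> [n|m] a x y; apply: tens_sepP => P f bf; rewrite tliftD // tliftZ //.
  by rewrite !tlift_pure // bilinDl // bilinZl.
by rewrite !tlift_pure // bilinDr // bilinZr.
Qed.

Lemma tens_ind (t : tens) : t = tlift pure t.
Proof.
apply: tens_sepP => P f bf.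
have H s : tlift f (fsum pure s) = fsum f s.
  elim: s => [|p s IH]; first by rewrite /fsum !big_nil tlift0.
  by rewrite /fsum !big_cons tliftD // tlift_pure // -/(fsum pure s) IH.
by rewrite -[RHS]/(tlift f (fsum pure (repr t))) H.
Qed.

End Tensor.

Arguments pure {k M N} m n.
Arguments tens {k} (M N)%_type.

Notation "m ⊗ n" := (pure m n) (at level 38, right associativity) : ring_scope.
Notation "M ⊗ N" := (tens M N) (at level 38, right associativity) : type_scope.

(** [tlift] with the tensor first, so that it is elaborated first. *)
Definition sweedler (k : comPzRingType) (M N P : lmodType k) (t : M ⊗ N)
  (f : M -> N -> P) : P := tlift f t.

(** Sweedler notation: if [t] is the sum of the [a_i ⊗ b_i], then
  [\sw_(a, b <- t) E a b] is the sum of the [E a_i b_i], for [E] bilinear. *)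
Notation "'\sw_' ( a , b <- t ) E" := (sweedler t (fun a b => E))
  (at level 41, E at level 41, a binder, b binder, t at level 40,
   format "'[' \sw_ ( a ,  b  <-  t ) '/  '  E ']'") : ring_scope.
Notation "'\sw_' ( a , b , c <- t ) E" :=
  (sweedler t (fun a r => sweedler r (fun b c => E)))
  (at level 41, E at level 41, a binder, b binder, c binder, t at level 40,
   format "'[' \sw_ ( a ,  b ,  c  <-  t ) '/  '  E ']'") : ring_scope.

(** ** Quotient of a module by the submodule generated by a set [G] *)

Section Quotient.
Variables (k : comPzRingType) (V : lmodType k) (G : V -> Prop).

Definition is_submod (S : V -> Prop) :=
  S 0 /\ forall a x y, S x -> S y -> S (a *: x + y).

Definition span (x : V) : Prop :=
  forall S, is_submod S -> (forall g, G g -> S g) -> S x.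

Lemma span0 : span 0. Proof. by move=> S []. Qed.
Lemma spanZD a x y : span x -> span y -> span (a *: x + y).
Proof. by move=> hx hy S sS GS; apply: sS.2; [apply: hx|apply: hy]. Qed.
Lemma span_gen g : G g -> span g. Proof. by move=> Gg S _; apply. Qed.
Lemma spanD x y : span x -> span y -> span (x + y).
Proof. by rewrite -{2}[x]scale1r; apply: spanZD. Qed.
Lemma spanZ a x : span x -> span (a *: x).
Proof. by move=> hx; rewrite -[_ *: _]addr0; apply: spanZD span0. Qed.
Lemma spanN x : span x -> span (- x).
Proof. by rewrite -scaleN1r; apply: spanZ. Qed.

Definition quo_rel (x y : V) : bool := `[< span (x - y) >].

Lemma quo_rel_refl : reflexive quo_rel.
Proof. by move=> x; apply/asboolP; rewrite subrr; apply: span0. Qed.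
Lemma quo_rel_sym : symmetric quo_rel.
Proof. by move=> x y; apply/asboolP/asboolP => /spanN; rewrite opprB. Qed.
Lemma quo_rel_trans : transitive quo_rel.
Proof.
move=> y x z /asboolP h1 /asboolP h2; apply/asboolP.
by rewrite -(subrK y x) -addrA; apply: spanD.
Qed.

Canonical quo_equiv := EquivRel quo_rel quo_rel_refl quo_rel_sym quo_rel_trans.

Definition quo := {eq_quot quo_rel}.
HB.instance Definition _ := Choice.on quo.
HB.instance Definition _ := EqQuotient.on quo.

Definition qpi (x : V) : quo := \pi_quo x.
Definition qrepr (q : quo) : V := repr q.

Lemma qreprK q : qpi (qrepr q) = q. Proof. exact: reprK. Qed.

Lemma qpi_eqP x y : qpi x = qpi y <-> span (x - y).
Proof.
split; first by move/eqmodP/asboolP.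
by move=> h; apply/eqmodP/asboolP.
Qed.

Lemma qrepr_pi x : span (qrepr (qpi x) - x).
Proof. by apply/qpi_eqP; rewrite qreprK. Qed.

Definition qadd (p q : quo) : quo := qpi (qrepr p + qrepr q).
Definition qscale a (p : quo) : quo := qpi (a *: qrepr p).
Definition qopp (p : quo) : quo := qpi (- qrepr p).

Lemma qpiD x y : qpi (x + y) = qadd (qpi x) (qpi y).
Proof.
apply/qpi_eqP; rewrite opprD addrACA; apply: spanD; rewrite -opprB;
  exact: spanN (qrepr_pi _).
Qed.
Lemma qpiZ a x : qpi (a *: x) = qscale a (qpi x).
Proof.
apply/qpi_eqP; rewrite -scalerBr; apply: spanZ; rewrite -opprB.
exact: spanN (qrepr_pi _).
Qed.
Lemma qpiN x : qpi (- x) = qopp (qpi x).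
Proof. by apply/qpi_eqP; rewrite opprK addrC; apply: qrepr_pi. Qed.

Lemma quo_ind (P : quo -> Prop) : (forall x, P (qpi x)) -> forall q, P q.
Proof. by move=> h q; rewrite -(qreprK q). Qed.

Lemma qaddA : associative qadd.
Proof.
by elim/quo_ind=> x; elim/quo_ind=> y; elim/quo_ind=> z; rewrite -!qpiD addrA.
Qed.
Lemma qaddC : commutative qadd.
Proof. by elim/quo_ind=> x; elim/quo_ind=> y; rewrite -!qpiD addrC. Qed.
Lemma qadd0 : left_id (qpi 0) qadd.
Proof. by elim/quo_ind=> x; rewrite -qpiD add0r. Qed.
Lemma qaddN : left_inverse (qpi 0) qopp qadd.
Proof. by elim/quo_ind=> x; rewrite -qpiN -qpiD addNr. Qed.

HB.instance Definition _ := GRing.isZmodule.Build quo qaddA qaddC qadd0 qaddN.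

Lemma qscaleA a b p : qscale a (qscale b p) = qscale (a * b) p.
Proof. by elim/quo_ind: p => x; rewrite -!qpiZ scalerA. Qed.
Lemma qscale1 : left_id 1 qscale.
Proof. by elim/quo_ind=> x; rewrite -qpiZ scale1r. Qed.
Lemma qpi_add x y : qpi x + qpi y = qpi (x + y).
Proof. by rewrite qpiD. Qed.

Lemma qscaleDr : right_distributive qscale +%R.
Proof.
move=> a; elim/quo_ind=> x; elim/quo_ind=> y.
by rewrite qpi_add -!qpiZ qpi_add scalerDr.
Qed.
Lemma qscaleDl p : {morph qscale^~ p : a b / a + b}.
Proof.
by move=> a b; elim/quo_ind: p => x; rewrite -!qpiZ qpi_add scalerDl.
Qed.

HB.instance Definition _ :=
  GRing.Zmodule_isLmodule.Build k quo qscaleA qscale1 qscaleDr qscaleDl.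

Lemma qpi_linear : linear qpi.
Proof. by move=> a x y; rewrite qpiD qpiZ. Qed.

End Quotient.

(** * Dual quasi-bialgebras *)

Record coalgebra (k : comPzRingType) := Coalgebra {
  coalg_car :> lmodType k;
  comul : coalg_car -> coalg_car ⊗ coalg_car;
  counit : coalg_car -> k;
  comul_linear : linear comul;
  counit_linear : linear (counit : coalg_car -> k^o);
  comul_assoc : forall a,
    \sw_(a1, a2 <- comul a) \sw_(a11, a12 <- comul a1) a11 ⊗ a12 ⊗ a2 =
    \sw_(a1, a2 <- comul a) a1 ⊗ comul a2;
  counit_l : forall a, \sw_(a1, a2 <- comul a) counit a1 *: a2 = a;
  counit_r : forall a, \sw_(a1, a2 <- comul a) counit a2 *: a1 = a }.

(** [comul2 a] is a_(1) ⊗ a_(2) ⊗ a_(3). *)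
Definition comul2 (k : comPzRingType) (H : coalgebra k) (a : H) : H ⊗ H ⊗ H :=
  \sw_(a1, a2 <- comul a) a1 ⊗ comul a2.

Record dual_quasi_bialgebra (k : comPzRingType) := DualQuasiBialgebra {
  dqb_coalg :> coalgebra k;
  dqb_mul : dqb_coalg -> dqb_coalg -> dqb_coalg;
  dqb_one : dqb_coalg;
  reass : dqb_coalg -> dqb_coalg -> dqb_coalg -> k;
  reassV : dqb_coalg -> dqb_coalg -> dqb_coalg -> k;
  dqb_mul_bilin : bilin dqb_mul;
  dqb_mul1l : left_id dqb_one dqb_mul;
  dqb_mul1r : right_id dqb_one dqb_mul;
  dqb_comulM : forall a b, comul (dqb_mul a b) =
    \sw_(a1, a2 <- comul a) \sw_(b1, b2 <- comul b) dqb_mul a1 b1 ⊗ dqb_mul a2 b2;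
  dqb_counitM : forall a b, counit (dqb_mul a b) = counit a * counit b;
  dqb_comul1 : comul dqb_one = dqb_one ⊗ dqb_one;
  dqb_counit1 : counit dqb_one = 1;
  reass_trilin : trilin (reass : _ -> _ -> _ -> k^o);
  reassV_trilin : trilin (reassV : _ -> _ -> _ -> k^o);
  reassVr : forall a b c,
    \sw_(a1, a2 <- comul a) \sw_(b1, b2 <- comul b) \sw_(c1, c2 <- comul c)
      (reass a1 b1 c1 * reassV a2 b2 c2 : k^o) = counit a * counit b * counit c;
  reassVl : forall a b c,
    \sw_(a1, a2 <- comul a) \sw_(b1, b2 <- comul b) \sw_(c1, c2 <- comul c)
      (reassV a1 b1 c1 * reass a2 b2 c2 : k^o) = counit a * counit b * counit c;
  reass_cocycle : forall a b c d,
    \sw_(a1, a2 <- comul a) \sw_(b1, b2, b3 <- comul2 b)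
    \sw_(c1, c2, c3 <- comul2 c) \sw_(d1, d2 <- comul d)
      (reass b1 c1 d1 * reass a1 (dqb_mul b2 c2) d2 * reass a2 b3 c3 : k^o) =
    \sw_(a1, a2 <- comul a) \sw_(b1, b2 <- comul b)
    \sw_(c1, c2 <- comul c) \sw_(d1, d2 <- comul d)
      (reass a1 b1 (dqb_mul c1 d1) * reass (dqb_mul a2 b2) c2 d2 : k^o);
  reass_norm : forall a b, reass a dqb_one b = counit a * counit b;
  dqb_quasi_assoc : forall a b c,
    \sw_(a1, a2 <- comul a) \sw_(b1, b2 <- comul b) \sw_(c1, c2 <- comul c)
      reass a2 b2 c2 *: dqb_mul a1 (dqb_mul b1 c1) =
    \sw_(a1, a2 <- comul a) \sw_(b1, b2 <- comul b) \sw_(c1, c2 <- comul c)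
      reass a1 b1 c1 *: dqb_mul (dqb_mul a2 b2) c2 }.

Notation "a ∙ b" := (dqb_mul a b) (at level 37, left associativity) : ring_scope.
Notation φ := reass.
Notation φV := reassV.
Notation ε := counit.

(** * The bicategory Bim(M^H)

  The records [comod_data], [alg_data], [bimod_data] hold operations only; the
  axioms are the predicates [comodule], [comodule_algebra], [bimodule]. *)

Section Bim.
Variables (k : comPzRingType) (H : dual_quasi_bialgebra k).

Record comod_data := ComodData {
  comod_car :> lmodType k;
  coact : comod_car -> comod_car ⊗ H }.

(** [coact2 m] is m_[0] ⊗ m_[1] ⊗ m_[2]. *)
Definition coact2 (M : comod_data) (m : M) : M ⊗ H ⊗ H :=
  \sw_(m0, m1 <- coact m) m0 ⊗ comul m1.

Definition comodule (M : comod_data) : Prop :=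
  [/\ linear (@coact M),
      forall m : M, \sw_(m0, m1 <- coact m) \sw_(m00, m01 <- coact m0)
        m00 ⊗ m01 ⊗ m1 = coact2 m
    & forall m : M, \sw_(m0, m1 <- coact m) ε m1 *: m0 = m].

Definition colinear (M N : comod_data) (f : M -> N) : Prop :=
  linear f /\
  forall m, coact (f m) = \sw_(m0, m1 <- coact m) f m0 ⊗ m1.

(** The diagonal coaction on M ⊗ N. *)
Definition tens_comod (M N : comod_data) : comod_data :=
  @ComodData (tens M N) (fun t => \sw_(m, n <- t)
    \sw_(m0, m1 <- coact m) \sw_(n0, n1 <- coact n) (m0 ⊗ n0) ⊗ (m1 ∙ n1)).

Definition colinear2 (M N P : comod_data) (f : M -> N -> P) : Prop :=
  bilin f /\ @colinear (tens_comod M N) P (tlift f).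

Record alg_data := AlgData {
  alg_comod :> comod_data;
  amul : alg_comod -> alg_comod -> alg_comod;
  aone : alg_comod }.

Definition comodule_algebra (B : alg_data) : Prop :=
  [/\ comodule B, colinear2 (@amul B), coact (aone B) = aone B ⊗ dqb_one H,
      left_id (aone B) (@amul B) /\ right_id (aone B) (@amul B)
    & forall a b c : B, amul (amul a b) c =
        \sw_(a0, a1 <- coact a) \sw_(b0, b1 <- coact b) \sw_(c0, c1 <- coact c)
          φ a1 b1 c1 *: amul a0 (amul b0 c0)].

Record bimod_data (R S : alg_data) := BimodData {
  bimod_comod :> comod_data;
  lact : R -> bimod_comod -> bimod_comod;
  ract : bimod_comod -> S -> bimod_comod }.

Definition bimodule (R S : alg_data) (M : bimod_data R S) : Prop :=
  [/\ comodule M, colinear2 (@lact R S M) /\ colinear2 (@ract R S M),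
      (forall m : M, lact (aone R) m = m) /\ (forall m : M, ract m (aone S) = m)
    & [/\ forall (r r' : R) (m : M), lact (amul r r') m =
            \sw_(r0, r1 <- coact r) \sw_(s0, s1 <- coact r')
            \sw_(m0, m1 <- coact m) φ r1 s1 m1 *: lact r0 (lact s0 m0),
          forall (m : M) (s s' : S), ract (ract m s) s' =
            \sw_(m0, m1 <- coact m) \sw_(s0, s1 <- coact s)
            \sw_(t0, t1 <- coact s') φ m1 s1 t1 *: ract m0 (amul s0 t0)
        & forall (r : R) (m : M) (s : S), ract (lact r m) s =
            \sw_(r0, r1 <- coact r) \sw_(m0, m1 <- coact m)
            \sw_(s0, s1 <- coact s) φ r1 m1 s1 *: lact r0 (ract m0 s0)]].

(** 2-cells *)
Definition bimod_map (R S : alg_data) (M N : bimod_data R S) (f : M -> N) :=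
  [/\ colinear f, forall (r : R) (m : M), f (lact r m) = lact r (f m)
    & forall (m : M) (s : S), f (ract m s) = ract (f m) s].

(** identity 1-cells *)
Definition bim1 (R : alg_data) : bimod_data R R :=
  @BimodData R R R (@amul R) (@amul R).

(** ** Composition of 1-cells

  M ⊗_S N is the coequalizer of ract ⊗ N and (M ⊗ lact) ∘ Φ, from (M ⊗ S) ⊗ N
  to M ⊗ N.  Its coaction and actions are induced by those of M ⊗ N, computed
  on a representative in M ⊗ N; for bimodules over comodule algebras they do not
  depend on the representative. *)
Section Compose.
Variables (R S T : alg_data) (M : bimod_data R S) (N : bimod_data S T).

Definition balance (m : M) (s : S) (n : N) : M ⊗ N :=
  ract m s ⊗ n -
  \sw_(m0, m1 <- coact m) \sw_(s0, s1 <- coact s) \sw_(n0, n1 <- coact n)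
    φ m1 s1 n1 *: (m0 ⊗ lact s0 n0).

Definition bcomp_car : lmodType k :=
  quo (fun t : tens M N => exists m s n, t = balance m s n).

Definition btens (m : M) (n : N) : bcomp_car := qpi _ (m ⊗ n).

Definition blift (P : lmodType k) (f : M -> N -> P) (q : bcomp_car) : P :=
  \sw_(m, n <- qrepr q) f m n.

Definition bcomp_comod : comod_data :=
  @ComodData bcomp_car (blift (fun m n =>
    \sw_(m0, m1 <- coact m) \sw_(n0, n1 <- coact n) btens m0 n0 ⊗ (m1 ∙ n1))).

Definition bcomp_lact (r : R) : bcomp_comod -> bcomp_comod :=
  blift (fun m n =>
    \sw_(r0, r1 <- coact r) \sw_(m0, m1 <- coact m) \sw_(n0, n1 <- coact n)
      φV r1 m1 n1 *: btens (lact r0 m0) n0).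

Definition bcomp_ract (q : bcomp_comod) (t : T) : bcomp_comod :=
  blift (fun m n =>
    \sw_(m0, m1 <- coact m) \sw_(n0, n1 <- coact n) \sw_(t0, t1 <- coact t)
      φ m1 n1 t1 *: btens m0 (ract n0 t0)) q.

Definition bcomp : bimod_data R T := BimodData bcomp_lact bcomp_ract.

End Compose.

(** The associativity constraint, induced by Φ_{M,N,P}. *)
Definition bassoc (R S T U : alg_data)
    (M : bimod_data R S) (N : bimod_data S T) (P : bimod_data T U) :
    bcomp (bcomp M N) P -> bcomp M (bcomp N P) :=
  blift (fun (q : bcomp M N) (p : P) => blift (fun (m : M) (n : N) =>
    \sw_(m0, m1 <- coact m) \sw_(n0, n1 <- coact n) \sw_(p0, p1 <- coact p)
      φ m1 n1 p1 *: (btens m0 (btens n0 p0 : bcomp N P) : bcomp M (bcomp N P))) q).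

(** Horizontal composition of 2-cells *)
Definition bhcomp (R S T : alg_data) (M M' : bimod_data R S)
    (N N' : bimod_data S T) (f : M -> M') (g : N -> N') :
    bcomp M N -> bcomp M' N' :=
  blift (fun m n => btens (f m) (g n)).

(** Unit constraints *)
Definition blunit (R S : alg_data) (M : bimod_data R S) : bcomp (bim1 R) M -> M :=
  blift (fun (r : bim1 R) (m : M) => lact (r : R) m).
Definition brunit (R S : alg_data) (M : bimod_data R S) : bcomp M (bim1 S) -> M :=
  blift (fun (m : M) (s : bim1 S) => ract m (s : S)).

(** [comonad Delta e]: the 1-cell [C], with comultiplication [Delta] and counit
  [e], is a comonad on [R] in Bim(M^H).  Coassociativity is relative to the
  associativity constraint of M^H and not to the plain reassociation of tensors:
  for H = k[Z/2], φ(a,b,c) = (-1)^(abc), R = k, the comatrix coring of the regular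
  comodule is not coassociative in the plain sense. *)
Definition comonad (R : alg_data) (C : bimod_data R R)
    (Delta : C -> bcomp C C) (e : C -> bim1 R) : Prop :=
  [/\ bimodule C, bimod_map Delta, bimod_map e,
      forall c, bassoc (bhcomp Delta id (Delta c)) = bhcomp id Delta (Delta c)
    & (forall c, blunit (bhcomp e id (Delta c)) = c) /\
      (forall c, brunit (bhcomp id e (Delta c)) = c)].

(** [adjoint_pair mu eta e f]: (A, B, Σ, Σ', mu, eta) is an adjoint pair, and
  eta(1_B) is the sum of the e_i ⊗_A f_i. *)
Definition adjoint_pair (A B : alg_data)
    (Sigma : bimod_data B A) (Sigma' : bimod_data A B)
    (mu : bcomp Sigma' Sigma -> bim1 A) (eta : bim1 B -> bcomp Sigma Sigma')
    (n : nat) (e : 'I_n -> Sigma) (f : 'I_n -> Sigma') : Prop :=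
  [/\ bimodule Sigma /\ bimodule Sigma', bimod_map eta /\ bimod_map mu,
      eta (aone B) = \sum_(i < n) btens (e i) (f i),
      forall x : Sigma, x = \sum_(i < n)
        \sw_(e0, e1 <- coact (e i)) \sw_(f0, f1 <- coact (f i))
        \sw_(x0, x1 <- coact x) φ e1 f1 x1 *: ract e0 (mu (btens f0 x0))
    & forall y : Sigma', y = \sum_(i < n)
        \sw_(y0, y1 <- coact y) \sw_(e0, e1 <- coact (e i))
        \sw_(f0, f1 <- coact (f i)) φV y1 e1 f1 *: lact (mu (btens y0 e0)) f0].

End Bim.

(** Associative unital k-algebras.  (The library's [algType] excludes the zero
  algebra.) *)
Record kalgebra (k : comPzRingType) := KAlgebra {
  kalg_car :> lmodType k;
  kmul : kalg_car -> kalg_car -> kalg_car;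
  kone : kalg_car;
  kmul_bilin : bilin kmul;
  kmulA : associative kmul;
  kmul1l : left_id kone kmul;
  kmul1r : right_id kone kmul }.

(** An associative algebra is an algebra in M^H for the trivial coaction. *)
Definition triv_alg (k : comPzRingType) (H : dual_quasi_bialgebra k)
    (A : kalgebra k) : alg_data H :=
  @AlgData k H (@ComodData k H A (fun a => a ⊗ dqb_one H)) (@kmul k A) (kone A).

(* Main.v *)
(** A coaction of a coalgebra on a module V turns linear forms into operators on
  V, and composition of operators is convolution of forms.  For commuting
  H-coactions ρ, σ, τ on V let Φ[ρ,σ,τ] be the operator given by φ.  The axioms of
  φ become: the pentagon for four commuting coactions; Φ[ρ,σ,τ] carries the
  product coaction (ρσ)τ to ρ(στ); and Φ[ρ,σ,τ] is the identity as soon as one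
  of the three coactions is trivial.

  As A coacts trivially, the coactions of e and f on Σ ⊗_A Σ' descend separately,
  while η(1) is coinvariant only for their product ef.  The comultiplication is
  y ⊗ x ↦ Φ[ye,f,x] Φ⁻¹[y,e,f] (y ⊗ η(1) ⊗ x) followed by a regrouping of the
  factors.  Equality of the two formulas, compatibility with the relations of
  Σ' ⊗_B Σ, and coassociativity are all obtained by applying the pentagon and
  replacing the product ef by the trivial coaction, by naturality of Φ along the
  insertion of η(1). *)
From HB Require Import structures.
From mathcomp Require Import all_boot all_algebra.
From mathcomp Require Import boolp.
Require Import Defs.

Set Implicit Arguments.
Unset Strict Implicit.
Unset Printing Implicit Defensive.

Import GRing.Theory.
Local Open Scope ring_scope.

(** * Linear maps and Sweedler sums *)

(** The obstacle is that coinvariance of η(1) says nothing about a single e_i or f_i. Hence e ⊗_A f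
    is kept as one element E of N = Σ ⊗_A Σ', and the calculations take place in tensor products
    over k such as Σ' ⊗ N ⊗ Σ, where all legs commute and the operators are defined. The relations
    over B hold only up to Φ; they enter at the very end, through maps that regroup the factors. Of
    the unit normalizations only φ(a, 1, b) = ε(a)ε(b) is an axiom. The two outer ones are obtained
    for operators and read back on forms by means of the regular coactions on H ⊗ H. The counit laws
    explain why both formulas matter. The first puts the product ye, the second the product fx, into
    an argument of the operator applied last; μ makes that product trivial, so this operator
    disappears, and what remains is one of the two dual basis identities. The left law therefore
    rests on the first formula and the right law on the second. *)

Section LinearMaps.
Variable k : comPzRingType.
Implicit Types U V W P Q R : lmodType k.

Lemma lin_id U : linear (fun x : U => x).
Proof. by []. Qed.

Lemma lin_comp U V W (g : V -> W) (f : U -> V) :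
  linear g -> linear f -> linear (fun x => g (f x)).
Proof. by move=> lg lf a x y; rewrite lf lg. Qed.

Lemma linD U V (f : U -> V) x y : linear f -> f (x + y) = f x + f y.
Proof. by move=> /(_ 1 x y); rewrite !scale1r. Qed.

Lemma lin0 U V (f : U -> V) : linear f -> f 0 = 0.
Proof.
move=> lf; apply: (addIr (f 0)).
by rewrite add0r -linD // addr0.
Qed.

Lemma linZ U V (f : U -> V) a x : linear f -> f (a *: x) = a *: f x.
Proof. by move=> lf; have := lf a x 0; rewrite !addr0 lin0 // addr0. Qed.

Lemma lin_sum U V (f : U -> V) (I : Type) (r : seq I) (F : I -> U) :
  linear f -> f (\sum_(i <- r) F i) = \sum_(i <- r) f (F i).
Proof.
move=> lf; elim: r => [|i r IH]; first by rewrite !big_nil lin0.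
by rewrite !big_cons linD // IH.
Qed.

Lemma lin_suml U V (I : Type) (r : seq I) (F : I -> U -> V) :
  (forall i, linear (F i)) -> linear (fun x => \sum_(i <- r) F i x).
Proof.
move=> lF a x y; rewrite scaler_sumr -big_split; apply: eq_bigr => i _.
exact: lF.
Qed.

(** The definition with explicit abstractions, the shape on which [lin] recurses. *)
Lemma bilinP U V P (f : U -> V -> P) :
  (forall v, linear (fun u => f u v)) -> (forall u, linear (fun v => f u v)) ->
  bilin f.
Proof. by []. Qed.

Lemma trilinP U V W P (f : U -> V -> W -> P) :
  (forall v w, linear (fun u => f u v w)) ->
  (forall u w, linear (fun v => f u v w)) ->
  (forall u v, linear (fun w => f u v w)) -> trilin f.
Proof. by []. Qed.

Lemma lin_bil U V P Q (f : U -> V -> P) v (u : Q -> U) :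
  bilin f -> linear u -> linear (fun x => f (u x) v).
Proof. by move=> [lf _] lu a x y; rewrite lu; exact: lf. Qed.

Lemma lin_bir U V P Q (f : U -> V -> P) u (v : Q -> V) :
  bilin f -> linear v -> linear (fun x => f u (v x)).
Proof. by move=> [_ lf] lv a x y; rewrite lv; exact: lf. Qed.

Lemma lin_bir1 U V P (f : U -> V -> P) u : bilin f -> linear (f u).
Proof. by case. Qed.

Lemma lin_tri1 U V W P Q (f : U -> V -> W -> P) v w (u : Q -> U) :
  trilin f -> linear u -> linear (fun x => f (u x) v w).
Proof. by move=> [lf _ _] lu a x y; rewrite lu; exact: lf. Qed.

Lemma lin_tri2 U V W P Q (f : U -> V -> W -> P) u w (v : Q -> V) :
  trilin f -> linear v -> linear (fun x => f u (v x) w).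
Proof. by move=> [_ lf _] lv a x y; rewrite lv; exact: lf. Qed.

Lemma lin_tri3 U V W P Q (f : U -> V -> W -> P) u v (w : Q -> W) :
  trilin f -> linear w -> linear (fun x => f u v (w x)).
Proof. by move=> [_ _ lf] lw a x y; rewrite lw; exact: lf. Qed.

Lemma trilin_bilin U V W P (f : U -> V -> W -> P) u : trilin f -> bilin (f u).
Proof. by case=> _ f2 f3; split=> [w|v]; [exact: f2|exact: f3]. Qed.

Lemma lin_scaler U V c (f : U -> V) :
  linear f -> linear (fun x => c *: f x).
Proof. by move=> lf a x y; rewrite lf scalerDr !scalerA mulrC. Qed.

Lemma lin_scalel U V (v : V) (f : U -> k) :
  linear (f : U -> k^o) -> linear (fun x => f x *: v).
Proof. by move=> lf a x y; rewrite lf scalerDl scalerA. Qed.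

Lemma lin_mulr U c (f : U -> k) :
  linear (f : U -> k^o) -> linear ((fun x => c * f x) : U -> k^o).
Proof. by move=> lf a x y; rewrite lf mulrDr /= mulrCA. Qed.

Lemma lin_mull U c (f : U -> k) :
  linear (f : U -> k^o) -> linear ((fun x => f x * c) : U -> k^o).
Proof. by move=> lf a x y; rewrite lf mulrDl /= /GRing.scale /= mulrA. Qed.

Lemma lin_swl U V W P (t : U -> V ⊗ W) (F : V -> W -> P) :
  linear t -> bilin F -> linear (fun x => sweedler (t x) F).
Proof. by move=> lt bF a x y; rewrite lt; apply: tlift_linear. Qed.

(** The sum runs over a representative of [t] that is independent of [x], so linearity of each
    summand suffices. *)
Lemma lin_swr U V W P (t : V ⊗ W) (F : U -> V -> W -> P) :
  (forall v w, linear (fun x => F x v w)) -> linear (fun x => sweedler t (F x)).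
Proof. by move=> lF; apply: lin_suml => p; apply: lF. Qed.

End LinearMaps.

Create HintDb lin.

(* A wrapper that no hypothesis unifies with: [auto] would compare the goal with
   all of them up to conversion. *)
Variant lin_goal (P : Prop) : Prop := LinGoal of P.

Lemma lin_goalP (P : Prop) : lin_goal P -> P.
Proof. by case. Qed.

#[global] Hint Extern 1 (lin_goal (bilin (@pure _ _ _))) =>
  exact (LinGoal (@pure_bilin _ _ _)) : lin.
#[global] Hint Extern 1 (lin_goal (bilin (@dqb_mul _ _))) =>
  exact (LinGoal (@dqb_mul_bilin _ _)) : lin.
#[global] Hint Extern 1 (lin_goal (trilin (@reass _ _))) =>
  exact (LinGoal (@reass_trilin _ _)) : lin.
#[global] Hint Extern 1 (lin_goal (trilin (@reassV _ _))) =>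
  exact (LinGoal (@reassV_trilin _ _)) : lin.
#[global] Hint Extern 1 (lin_goal (GRing.linear_for _ (@comul _ ?C))) =>
  exact (LinGoal (@comul_linear _ C)) : lin.
#[global] Hint Extern 1 (lin_goal (GRing.linear_for _ (@counit _ ?C))) =>
  exact (LinGoal (@counit_linear _ C)) : lin.

(** Hypotheses are matched syntactically by [constr_eq]; matching up to conversion would unfold the
    coactions. *)
Ltac lin_atom :=
  try match goal with
  | |- GRing.linear_for ?s (fun x => ?f x) => change (GRing.linear_for s f)
  end;
  first
  [ match goal with
    | h : GRing.linear_for _ ?f |- GRing.linear_for _ ?g => constr_eq f g; exact h
    | h : bilin ?f |- bilin ?g => constr_eq f g; exact h
    | h : trilin ?f |- trilin ?g => constr_eq f g; exact h
    end
  | apply lin_goalP; solve [auto 1 with lin nocore] ].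

(* Proves [linear], [bilin] and [trilin] goals by structural decomposition; the
   atoms are taken from the context and from the hint database [lin]. *)
Ltac lin :=
  intros; cbv beta;
  first
  [ lin_atom
  | match goal with
    | |- bilin (fun _ => _) => apply: bilinP => ?; cbv beta; lin
    | |- bilin (?f ?u) => apply: (@trilin_bilin _ _ _ _ _ _ u); lin_atom
    | |- trilin (fun _ => _) => apply: trilinP => ? ?; cbv beta; lin
    | |- linear (fun x => x) => exact: lin_id
    | |- linear (fun x => sweedler (@?t x) ?F) =>
        apply: (@lin_swl _ _ _ _ _ t); lin
    | |- linear (fun x => sweedler ?t (@?F x)) =>
        apply: (@lin_swr _ _ _ _ _ t) => ? ?; lin
    | |- linear (fun x => ?c *: (@?f x)) => apply: (@lin_scaler _ _ _ c f); lin
    | |- linear (fun x => (@?f x) *: ?v) => apply: (@lin_scalel _ _ _ v f); lin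
    | |- linear (fun x => ?c * (@?f x)) => apply: (@lin_mulr _ _ c f); lin
    | |- linear (fun x => (@?f x) * ?c) => apply: (@lin_mull _ _ c f); lin
    | |- linear (fun x => ?f (@?u x) ?v ?w) =>
        apply: (@lin_tri1 _ _ _ _ _ _ _ v w u); lin
    | |- linear (fun x => ?f ?u (@?v x) ?w) =>
        apply: (@lin_tri2 _ _ _ _ _ _ _ u w v); lin
    | |- linear (fun x => ?f ?u ?v (@?w x)) =>
        apply: (@lin_tri3 _ _ _ _ _ _ _ u v w); lin
    | |- linear (fun x => ?f (@?u x) ?v) =>
        apply: (@lin_bil _ _ _ _ _ _ v u); lin
    | |- linear (fun x => ?f ?u (@?v x)) =>
        apply: (@lin_bir _ _ _ _ _ _ u v); lin
    | |- linear (fun x => ?f (@?u x)) =>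
        apply: (@lin_comp _ _ _ _ _ u); [first [lin_atom | eassumption] | lin]
    | |- linear (?f ?u) => apply: (@lin_bir1 _ _ _ _ _ u); lin_atom
    end
  | match goal with
    | |- GRing.linear_for _ _ => solve [eauto 2]
    | h : forall _, trilin _ |- trilin _ => exact: h
    end ].

Section Sweedler.
Variable k : comPzRingType.
Implicit Types U V W P Q R : lmodType k.

Lemma sw_pure U V P (F : U -> V -> P) u v : bilin F -> sweedler (u ⊗ v) F = F u v.
Proof. exact: tlift_pure. Qed.

(** A Sweedler sum is a finite sum over a chosen representative of [t], so additivity of [g] moves
    it inside. For the same reason Sweedler sums can be exchanged freely ([exch_sw]). *)
Lemma lin_sw U V P Q (g : P -> Q) (t : U ⊗ V) (F : U -> V -> P) :
  linear g -> g (sweedler t F) = sweedler t (fun u v => g (F u v)).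
Proof. by move=> lg; rewrite /sweedler /tlift /fsum lin_sum. Qed.

Lemma sw_sw U V P Q R (t : U ⊗ V) (G : U -> V -> P ⊗ Q) (F : P -> Q -> R) :
  bilin F ->
  sweedler (sweedler t G) F = sweedler t (fun u v => sweedler (G u v) F).
Proof. by move=> bF; rewrite (lin_sw (g := fun s => sweedler s F)) //; lin. Qed.

Lemma sw_id U V (t : U ⊗ V) : sweedler t pure = t.
Proof. by rewrite {2}[t]tens_ind. Qed.

Lemma eq_sw U V P (t : U ⊗ V) (F G : U -> V -> P) :
  (forall u v, F u v = G u v) -> sweedler t F = sweedler t G.
Proof. by move=> FG; apply: eq_bigr => p _; apply: FG. Qed.

Lemma exch_sw U V U' V' P (s : U ⊗ V) (t : U' ⊗ V') (F : U -> V -> U' -> V' -> P) :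
  sweedler s (fun a b => sweedler t (fun c d => F a b c d)) =
  sweedler t (fun c d => sweedler s (fun a b => F a b c d)).
Proof. exact: exchange_big. Qed.

Lemma tens_ext U V P (f g : U ⊗ V -> P) : linear f -> linear g ->
  (forall u v, f (u ⊗ v) = g (u ⊗ v)) -> forall t, f t = g t.
Proof.
move=> lf lg fg t; rewrite -(sw_id t) !lin_sw //.
by apply: eq_sw => u v.
Qed.

Lemma tens3_ext P U V W (f g : U ⊗ V ⊗ W -> P) : linear f -> linear g ->
  (forall u v w, f (u ⊗ v ⊗ w) = g (u ⊗ v ⊗ w)) -> forall t, f t = g t.
Proof.
move=> lf lg fg; apply: tens_ext => // u.
by apply: tens_ext => [||v w]; [lin|lin|].
Qed.

Lemma sw_scale U V P (t : U ⊗ V) (c : k) (F : U -> V -> P) :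
  sweedler t (fun u v => c *: F u v) = c *: sweedler t F.
Proof. by rewrite -(lin_sw (g := fun x => c *: x)) //; lin. Qed.

Lemma sw_scalel U V P (t : U ⊗ V) (p : P) (F : U -> V -> k) :
  sweedler t (fun u v => F u v *: p) = sweedler t (F : U -> V -> k^o) *: p.
Proof. by rewrite -(lin_sw (g := fun x : k^o => x *: p)) //; lin. Qed.

End Sweedler.

Section Reverse.
Variables (k : comPzRingType) (U1 V1 U2 V2 U3 V3 P : lmodType k).
Variables (s : U1 ⊗ V1) (t : U2 ⊗ V2) (r : U3 ⊗ V3).

(** The operators introduced below sum over their last leg outermost, whereas the explicit formulas
    list the legs from left to right; reversal passes between the two. *)
Lemma rev_sw3 (F : U1 -> V1 -> U2 -> V2 -> U3 -> V3 -> P) :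
  \sw_(a, a' <- s) \sw_(b, b' <- t) \sw_(c, c' <- r) F a a' b b' c c' =
  \sw_(c, c' <- r) \sw_(b, b' <- t) \sw_(a, a' <- s) F a a' b b' c c'.
Proof.
rewrite exch_sw [RHS]exch_sw; apply: eq_sw => b b'; exact: exch_sw.
Qed.

Lemma rev_sw4 (U4 V4 : lmodType k) (q : U4 ⊗ V4)
    (F : U1 -> V1 -> U2 -> V2 -> U3 -> V3 -> U4 -> V4 -> P) :
  \sw_(a, a' <- s) \sw_(b, b' <- t) \sw_(c, c' <- r) \sw_(d, d' <- q)
    F a a' b b' c c' d d' =
  \sw_(d, d' <- q) \sw_(c, c' <- r) \sw_(b, b' <- t) \sw_(a, a' <- s)
    F a a' b b' c c' d d'.
Proof.
transitivity (\sw_(a, a' <- s) \sw_(d, d' <- q) \sw_(b, b' <- t) \sw_(c, c' <- r)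
    F a a' b b' c c' d d').
  apply: eq_sw => a a'; rewrite [RHS]exch_sw; apply: eq_sw => b b'; exact: exch_sw.
rewrite exch_sw; apply: eq_sw => d d'; exact: rev_sw3.
Qed.

End Reverse.

Section TensorCoalgebra.
Variables (k : comPzRingType) (C D : coalgebra k).

(** Coassociativity paired with a trilinear map, the form in which it rewrites inside a Sweedler
    expression. *)
Lemma comul_sw (P : lmodType k) (E : C -> C -> C -> P) (c : C) : trilin E ->
  \sw_(c1, c2 <- comul c) \sw_(c11, c12 <- comul c1) E c11 c12 c2 =
  \sw_(c1, c2 <- comul c) \sw_(c21, c22 <- comul c2) E c1 c21 c22.
Proof.
move=> tE.
have := congr1 (fun t => sweedler t (fun a s => sweedler s (E a))) (comul_assoc c).
have lE : bilin (fun a s => sweedler s (E a)) by lin.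
rewrite !sw_sw // => H.
transitivity (\sw_(u, v <- comul c) \sw_(a, s <- \sw_(a11, a12 <- comul u)
   a11 ⊗ a12 ⊗ v) sweedler s (E a)).
  apply: eq_sw => u v; rewrite sw_sw //; apply: eq_sw => a b.
  by rewrite sw_pure // sw_pure //; lin.
by rewrite H; apply: eq_sw => u v; rewrite sw_pure.
Qed.

(** With a coalgebra structure on C ⊗ D, several commuting coactions become one coaction of a larger
    coalgebra, and an identity between products of values of φ becomes one between convolutions. *)
Definition tcomul (t : C ⊗ D) : (C ⊗ D) ⊗ (C ⊗ D) :=
  \sw_(c, d <- t) \sw_(c1, c2 <- comul c) \sw_(d1, d2 <- comul d)
    (c1 ⊗ d1) ⊗ (c2 ⊗ d2).
Definition tcounit (t : C ⊗ D) : k := \sw_(c, d <- t) (counit c * counit d : k^o).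

Lemma tcomul_linear : linear tcomul.
Proof. by rewrite /tcomul; lin. Qed.
Lemma tcounit_linear : linear (tcounit : C ⊗ D -> k^o).
Proof. by rewrite /tcounit; lin. Qed.

Lemma tcomul_pure c d : tcomul (c ⊗ d) =
  \sw_(c1, c2 <- comul c) \sw_(d1, d2 <- comul d) (c1 ⊗ d1) ⊗ (c2 ⊗ d2).
Proof. by rewrite /tcomul sw_pure //; lin. Qed.

Lemma tcounit_pure c d : tcounit (c ⊗ d) = counit c * counit d.
Proof. by rewrite /tcounit sw_pure //; lin. Qed.

Lemma sw_tcomul (P : lmodType k) (F : C ⊗ D -> C ⊗ D -> P) c d : bilin F ->
  sweedler (tcomul (c ⊗ d)) F =
  \sw_(c1, c2 <- comul c) \sw_(d1, d2 <- comul d) F (c1 ⊗ d1) (c2 ⊗ d2).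
Proof.
move=> bF; rewrite tcomul_pure sw_sw //; apply: eq_sw => c1 c2.
by rewrite sw_sw //; apply: eq_sw => d1 d2; rewrite sw_pure.
Qed.

Lemma sw_counitl (P : lmodType k) (f : C -> P) c : linear f ->
  \sw_(c1, c2 <- comul c) counit c1 *: f c2 = f c.
Proof.
move=> lf; rewrite -[in RHS](counit_l c) lin_sw //.
by apply: eq_sw => u v; rewrite linZ.
Qed.

Lemma sw_counitr (P : lmodType k) (f : C -> P) c : linear f ->
  \sw_(c1, c2 <- comul c) counit c2 *: f c1 = f c.
Proof.
move=> lf; rewrite -[in RHS](counit_r c) lin_sw //.
by apply: eq_sw => u v; rewrite linZ.
Qed.

End TensorCoalgebra.

Section TensorCoalgebraAxioms.
Variables (k : comPzRingType) (C D : coalgebra k).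
#[local] Hint Extern 1 (lin_goal (GRing.linear_for _ (@tcomul _ ?C ?D))) =>
  apply: LinGoal; exact: (@tcomul_linear _ C D) : lin.
#[local] Hint Extern 1 (lin_goal (GRing.linear_for _ (@tcounit _ ?C ?D))) =>
  apply: LinGoal; exact: (@tcounit_linear _ C D) : lin.

Lemma tcomul_assoc (t : C ⊗ D) :
  \sw_(a1, a2 <- tcomul t) \sw_(a11, a12 <- tcomul a1) a11 ⊗ a12 ⊗ a2 =
  \sw_(a1, a2 <- tcomul t) a1 ⊗ tcomul a2.
Proof.
move: t; apply: tens_ext => [||c d]; [lin|lin|].
rewrite !sw_tcomul; [|lin|lin].
transitivity (\sw_(c1, c2 <- comul c) \sw_(c11, c12 <- comul c1)
  \sw_(d1, d2 <- comul d) \sw_(d11, d12 <- comul d1)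
  (c11 ⊗ d11) ⊗ (c12 ⊗ d12) ⊗ (c2 ⊗ d2)).
  apply: eq_sw => c1 c2; rewrite exch_sw; apply: eq_sw => d1 d2.
  by rewrite sw_tcomul //; lin.
transitivity (\sw_(c1, c2 <- comul c) \sw_(c11, c12 <- comul c2)
  \sw_(d1, d2 <- comul d) \sw_(d11, d12 <- comul d2)
  (c1 ⊗ d1) ⊗ (c11 ⊗ d11) ⊗ (c12 ⊗ d12)).
  rewrite comul_sw; last by lin.
  by apply: eq_sw => c1 c2; apply: eq_sw => c11 c12; rewrite comul_sw //; lin.
apply: eq_sw => c1 c2; rewrite exch_sw; apply: eq_sw => d1 d2.
rewrite tcomul_pure (lin_sw (g := pure _)); last by lin.
by apply: eq_sw => *; rewrite (lin_sw (g := pure _)) //; lin.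
Qed.

Lemma tcounit_l (t : C ⊗ D) : \sw_(a1, a2 <- tcomul t) tcounit a1 *: a2 = t.
Proof.
move: t; apply: tens_ext => [||c d]; [lin|lin|].
rewrite sw_tcomul; last by lin.
rewrite -[in RHS](counit_l c) -[in RHS](counit_l d) (lin_sw (g := fun x => x ⊗ _)).
  apply: eq_sw => c1 c2; rewrite lin_sw; last by lin.
  apply: eq_sw => d1 d2.
  by rewrite tcounit_pure !(bilinZl, bilinZr) ?scalerA //; exact: pure_bilin.
by lin.
Qed.

Lemma tcounit_r (t : C ⊗ D) : \sw_(a1, a2 <- tcomul t) tcounit a2 *: a1 = t.
Proof.
move: t; apply: tens_ext => [||c d]; [lin|lin|].
rewrite sw_tcomul; last by lin.
rewrite -[in RHS](counit_r c) -[in RHS](counit_r d) (lin_sw (g := fun x => x ⊗ _)).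
  apply: eq_sw => c1 c2; rewrite lin_sw; last by lin.
  apply: eq_sw => d1 d2.
  by rewrite tcounit_pure !(bilinZl, bilinZr) ?scalerA //; exact: pure_bilin.
by lin.
Qed.

Definition tcoalg : coalgebra k :=
  Coalgebra (@tcomul_linear k C D) (@tcounit_linear k C D)
    tcomul_assoc tcounit_l tcounit_r.

End TensorCoalgebraAxioms.

Section TensorCoalgebraTheory.
Variables (k : comPzRingType) (C D : coalgebra k).

Lemma sw_comul_tcoalg (P : lmodType k) (F : tcoalg C D -> tcoalg C D -> P) c d :
  bilin F ->
  sweedler (@comul k (tcoalg C D) (c ⊗ d)) F =
  \sw_(c1, c2 <- comul c) \sw_(d1, d2 <- comul d) F (c1 ⊗ d1) (c2 ⊗ d2).
Proof. exact: sw_tcomul. Qed.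

Lemma counit_tcoalg c d : @counit k (tcoalg C D) (c ⊗ d) = counit c * counit d.
Proof. exact: tcounit_pure. Qed.

End TensorCoalgebraTheory.

(** * Coactions and the operators they induce *)

Section Coactions.
Variable k : comPzRingType.
Implicit Types (U V W P : lmodType k) (C D : coalgebra k).

Definition coaction V C (δ : V -> V ⊗ C) : Prop :=
  [/\ linear δ,
      forall v, \sw_(v0, c <- δ v) \sw_(v00, c' <- δ v0) v00 ⊗ c' ⊗ c =
                \sw_(v0, c <- δ v) v0 ⊗ comul c
    & forall v, \sw_(v0, c <- δ v) counit c *: v0 = v].

Definition commuting V C D (δ : V -> V ⊗ C) (γ : V -> V ⊗ D) : Prop :=
  forall v, \sw_(v0, d <- γ v) \sw_(v00, c <- δ v0) v00 ⊗ c ⊗ d =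
            \sw_(v0, c <- δ v) \sw_(v00, d <- γ v0) v00 ⊗ c ⊗ d.

Definition intertwines V W C (g : V -> W) (δ : V -> V ⊗ C) (δ' : W -> W ⊗ C) :=
  linear g /\ forall v, δ' (g v) = \sw_(v0, c <- δ v) g v0 ⊗ c.

Definition push V C D (p : C -> D) (δ : V -> V ⊗ C) (v : V) : V ⊗ D :=
  \sw_(v0, c <- δ v) v0 ⊗ p c.

Definition act V C (θ : C -> k) (δ : V -> V ⊗ C) (v : V) : V :=
  \sw_(v0, c <- δ v) θ c *: v0.

Definition join V C D (δ : V -> V ⊗ C) (γ : V -> V ⊗ D) (v : V) :
    V ⊗ tcoalg C D :=
  \sw_(v0, d <- γ v) \sw_(v00, c <- δ v0) v00 ⊗ (c ⊗ d).

Definition convolution C (θ θ' : C -> k) (c : C) : k :=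
  \sw_(c1, c2 <- comul c) (θ c1 * θ' c2 : k^o).

Definition coalgebra_map C D (p : C -> D) : Prop :=
  [/\ linear p,
      forall c, comul (p c) = \sw_(c1, c2 <- comul c) p c1 ⊗ p c2
    & forall c, counit (p c) = counit c].

Lemma coaction_linear V C (δ : V -> V ⊗ C) : coaction δ -> linear δ.
Proof. by case. Qed.

Lemma intertwines_linear V W C (g : V -> W) (δ : V -> V ⊗ C) (δ' : W -> W ⊗ C) :
  intertwines g δ δ' -> linear g.
Proof. by case. Qed.

Lemma coalgebra_map_linear C D (p : C -> D) : coalgebra_map p -> linear p.
Proof. by case. Qed.

Lemma join_linear V C D (δ : V -> V ⊗ C) (γ : V -> V ⊗ D) :
  linear δ -> linear γ -> linear (join δ γ).
Proof. by move=> lδ lγ; rewrite /join; lin. Qed.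

Lemma push_linear V C D (p : C -> D) (δ : V -> V ⊗ C) :
  linear p -> linear δ -> linear (push p δ).
Proof. by move=> lp lδ; rewrite /push; lin. Qed.

End Coactions.

#[global] Hint Extern 2 (lin_goal (GRing.linear_for _ ?d)) =>
  match goal with h : coaction ?d' |- _ => constr_eq d d'; exact (LinGoal (coaction_linear h)) end : lin.
#[global] Hint Extern 2 (lin_goal (GRing.linear_for _ ?g)) =>
  match goal with h : intertwines ?g' _ _ |- _ => constr_eq g g'; exact (LinGoal (intertwines_linear h)) end : lin.
#[global] Hint Extern 2 (lin_goal (GRing.linear_for _ ?p)) =>
  match goal with h : coalgebra_map ?p' |- _ => constr_eq p p'; exact (LinGoal (coalgebra_map_linear h)) end : lin.
#[global] Hint Extern 3 (lin_goal (GRing.linear_for _ (join _ _))) =>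
  apply: LinGoal; apply: join_linear; lin : lin.
#[global] Hint Extern 3 (lin_goal (GRing.linear_for _ (push _ _))) =>
  apply: LinGoal; apply: push_linear; lin : lin.

Section CoactionTheory.
Variable k : comPzRingType.
Implicit Types (U V W P : lmodType k) (C D : coalgebra k).

Lemma convolution_linear C (θ θ' : C -> k) :
  linear (θ : C -> k^o) -> linear (θ' : C -> k^o) ->
  linear (convolution θ θ' : C -> k^o).
Proof. by move=> lθ lθ'; rewrite /convolution; lin. Qed.

Section OneCoaction.
Variables (V : lmodType k) (C : coalgebra k) (δ : V -> V ⊗ C).
Hypothesis hδ : coaction δ.

Lemma coact_sw P (E : V -> C -> C -> P) v : trilin E ->
  \sw_(v0, c <- δ v) \sw_(v00, c' <- δ v0) E v00 c' c =
  \sw_(v0, c <- δ v) \sw_(c1, c2 <- comul c) E v0 c1 c2.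
Proof.
move=> tE; have [_ hA _] := hδ.
have lE : bilin (fun a s => sweedler s (E a)) by lin.
have := congr1 (fun t => sweedler t (fun a s => sweedler s (E a))) (hA v).
rewrite !sw_sw // => H.
transitivity (\sw_(u, c <- δ v) \sw_(a, s <- \sw_(a, c' <- δ u) a ⊗ c' ⊗ c)
   sweedler s (E a)).
  apply: eq_sw => u c; rewrite sw_sw //; apply: eq_sw => a b.
  by rewrite sw_pure // sw_pure //; lin.
by rewrite H; apply: eq_sw => a c; rewrite sw_pure.
Qed.

Lemma coact_counit v : \sw_(v0, c <- δ v) counit c *: v0 = v.
Proof. by have [_ _ ->] := hδ. Qed.

Lemma coact_counit_sw P (f : V -> P) v : linear f ->
  \sw_(v0, c <- δ v) counit c *: f v0 = f v.
Proof.
move=> lf; rewrite -[in RHS](coact_counit v) lin_sw //.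
by apply: eq_sw => *; rewrite linZ.
Qed.

Lemma act_linear (θ : C -> k) : linear (θ : C -> k^o) -> linear (act θ δ).
Proof. by move=> lθ; rewrite /act; lin. Qed.

(** The operator applied first reads the outer leg, which coassociativity turns into the second
    component of [comul]; this fixes the order of the factors in the convolution. *)
Lemma act_act (θ θ' : C -> k) v :
  linear (θ : C -> k^o) -> linear (θ' : C -> k^o) ->
  act θ δ (act θ' δ v) = act (convolution θ θ') δ v.
Proof.
move=> lθ lθ'; rewrite {2}/act lin_sw; last exact: act_linear.
transitivity (\sw_(v0, c <- δ v) \sw_(v00, c' <- δ v0) (θ c' * θ' c) *: v00).
  apply: eq_sw => v0 c; rewrite linZ; last exact: act_linear.
  by rewrite -sw_scale; apply: eq_sw => *; rewrite scalerA mulrC.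
rewrite coact_sw; last by lin.
by apply: eq_sw => v0 c; rewrite sw_scalel.
Qed.

Lemma act_counit v : act (@counit k C) δ v = v.
Proof. exact: coact_counit. Qed.

Lemma push_coaction D (p : C -> D) : coalgebra_map p -> coaction (push p δ).
Proof.
move=> hp; have [lp pM p1] := hp; rewrite /push; split=> [|v|v]; first by lin.
- rewrite !sw_sw; [|lin|lin].
  transitivity (\sw_(v0, c <- δ v) \sw_(v00, c' <- δ v0) v00 ⊗ p c' ⊗ p c).
    apply: eq_sw => v0 c; rewrite sw_pure; last by lin.
    by rewrite sw_sw; [apply: eq_sw => *; rewrite sw_pure //; lin | lin].
  rewrite coact_sw; last by lin.
  apply: eq_sw => v0 c; rewrite sw_pure; last by lin.
  by rewrite pM (lin_sw (g := pure v0)) //; lin.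
- rewrite sw_sw; last by lin.
  rewrite -[RHS]coact_counit; apply: eq_sw => v0 c.
  by rewrite sw_pure ?p1 //; lin.
Qed.

End OneCoaction.

Lemma sw_push V C D (p : C -> D) (δ : V -> V ⊗ C) P (F : V -> D -> P) v :
  bilin F -> sweedler (push p δ v) F = \sw_(v0, c <- δ v) F v0 (p c).
Proof.
by move=> bF; rewrite /push sw_sw //; apply: eq_sw => *; rewrite sw_pure.
Qed.

Lemma sw_join V C D (δ : V -> V ⊗ C) (γ : V -> V ⊗ D) P
    (F : V -> tcoalg C D -> P) v : bilin F ->
  sweedler (join δ γ v) F =
  \sw_(v0, d <- γ v) \sw_(v00, c <- δ v0) F v00 (c ⊗ d).
Proof.
move=> bF; rewrite /join sw_sw //; apply: eq_sw => v0 d.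
by rewrite sw_sw //; apply: eq_sw => *; rewrite sw_pure.
Qed.

Lemma commuting_sw V C D (δ : V -> V ⊗ C) (γ : V -> V ⊗ D) P
    (E : V -> C -> D -> P) v : commuting δ γ -> trilin E ->
  \sw_(v0, d <- γ v) \sw_(v00, c <- δ v0) E v00 c d =
  \sw_(v0, c <- δ v) \sw_(v00, d <- γ v0) E v00 c d.
Proof.
move=> cδγ tE.
have lE : bilin (fun a s => sweedler s (E a)) by lin.
have := congr1 (fun t => sweedler t (fun a s => sweedler s (E a))) (cδγ v).
rewrite !sw_sw // => H.
transitivity (\sw_(u, d <- γ v) \sw_(a, s <- \sw_(a, c <- δ u) a ⊗ c ⊗ d)
   sweedler s (E a)).
  apply: eq_sw => u c; rewrite sw_sw //; apply: eq_sw => a b.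
  by rewrite sw_pure // sw_pure //; lin.
rewrite H; apply: eq_sw => u c; rewrite sw_sw //; apply: eq_sw => a b.
by rewrite sw_pure // sw_pure //; lin.
Qed.

Lemma commuting_sym V C D (δ : V -> V ⊗ C) (γ : V -> V ⊗ D) :
  commuting δ γ -> commuting γ δ.
Proof. by move=> h v; rewrite (commuting_sw v h) //; lin. Qed.

Lemma commuting_push V C C' D (p : C -> C') (δ : V -> V ⊗ C) (γ : V -> V ⊗ D) :
  linear p -> coaction δ -> coaction γ -> commuting δ γ ->
  commuting (push p δ) γ.
Proof.
move=> lp hδ hγ h v; rewrite sw_push; last by lin.
rewrite -(commuting_sw _ (E := fun v c d => v ⊗ p c ⊗ d) h); last by lin.
by apply: eq_sw => v0 c; rewrite sw_push //; lin.
Qed.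

Lemma commuting_join V C C' D (δ : V -> V ⊗ C) (δ' : V -> V ⊗ C')
    (γ : V -> V ⊗ D) :
  coaction δ -> coaction δ' -> coaction γ -> commuting δ γ -> commuting δ' γ ->
  commuting (join δ δ') γ.
Proof.
move=> hδ hδ' hγ h h' v; rewrite sw_join; last by lin.
transitivity (\sw_(v0, d <- γ v) \sw_(v1, c' <- δ' v0) \sw_(v2, c <- δ v1)
  v2 ⊗ (c ⊗ c') ⊗ d).
  by apply: eq_sw => v0 d; rewrite sw_join //; lin.
rewrite (commuting_sw _ (E := fun v1 c' d => \sw_(v2, c <- δ v1)
  v2 ⊗ (c ⊗ c') ⊗ d) h'); last by lin.
by apply: eq_sw => v0 c'; rewrite (commuting_sw _ (E := fun v c d =>
  v ⊗ (c ⊗ c') ⊗ d) h) //; lin.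
Qed.

Lemma join_coaction V C D (δ : V -> V ⊗ C) (γ : V -> V ⊗ D) :
  coaction δ -> coaction γ -> commuting δ γ -> coaction (join δ γ).
Proof.
move=> hδ hγ h; split=> [|v|v]; first by rewrite /join; lin.
- rewrite !sw_join; [|lin|lin].
  transitivity (\sw_(v0, d <- γ v) \sw_(v1, d' <- γ v0) \sw_(v2, c <- δ v1)
     \sw_(v3, c' <- δ v2) v3 ⊗ ((c' ⊗ d' : tcoalg C D) ⊗ (c ⊗ d : tcoalg C D))).
    apply: eq_sw => v0 d.
    rewrite (commuting_sw _ (E := fun v c d' => \sw_(v3, c' <- δ v)
      v3 ⊗ (c' ⊗ d' : tcoalg C D) ⊗ (c ⊗ d : tcoalg C D)) h); last by lin.
    by apply: eq_sw => v1 c; rewrite sw_join //; lin.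
  rewrite (coact_sw hγ (E := fun v1 d' d => \sw_(v2, c <- δ v1)
     \sw_(v3, c' <- δ v2) v3 ⊗ (c' ⊗ d' : tcoalg C D) ⊗ (c ⊗ d : tcoalg C D)));
    last by lin.
  apply: eq_sw => v0 d.
  transitivity (\sw_(d1, d2 <- comul d) \sw_(v1, c <- δ v0)
    \sw_(c1, c2 <- comul c) v1 ⊗ (c1 ⊗ d1 : tcoalg C D) ⊗ (c2 ⊗ d2 : tcoalg C D)).
    by apply: eq_sw => d1 d2; rewrite (coact_sw hδ (E := fun v c' c =>
      v ⊗ (c' ⊗ d1 : tcoalg C D) ⊗ (c ⊗ d2 : tcoalg C D))) //; lin.
  rewrite exch_sw; apply: eq_sw => v1 c.
  rewrite /= tcomul_pure (lin_sw (g := pure v1)); last by lin.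
  rewrite exch_sw; apply: eq_sw => c1 c2.
  by rewrite (lin_sw (g := pure v1)) //; lin.
- rewrite sw_join; last by lin.
  rewrite -[RHS](coact_counit hγ); apply: eq_sw => v0 d.
  rewrite -[in RHS](coact_counit hδ v0) -sw_scale; apply: eq_sw => v1 c.
  by rewrite /= tcounit_pure scalerA mulrC.
Qed.

(** The last hypothesis says that [p] convolved with θ equals θ convolved with [q]. For θ = φ and
    [p], [q] the two bracketings of a triple product, it is the quasi-associativity of H. *)
Lemma act_intertwines V C D (p q : C -> D) (θ : C -> k) (δ : V -> V ⊗ C) :
  coaction δ -> linear p -> linear q -> linear (θ : C -> k^o) ->
  (forall c, \sw_(c1, c2 <- comul c) θ c2 *: p c1 =
             \sw_(c1, c2 <- comul c) θ c1 *: q c2) ->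
  intertwines (act θ δ) (push q δ) (push p δ).
Proof.
move=> hδ lp lq lθ pq; split; first exact: act_linear.
move=> v; rewrite {1}/act lin_sw; last by lin.
transitivity (\sw_(v0, c <- δ v) \sw_(v00, c' <- δ v0) θ c *: (v00 ⊗ p c')).
  by apply: eq_sw => v0 c; rewrite linZ ?sw_scale //; lin.
rewrite (coact_sw hδ); last by lin.
rewrite sw_push; last by rewrite /act; lin.
transitivity (\sw_(v0, c <- δ v) \sw_(v00, c' <- δ v0) θ c' *: (v00 ⊗ q c)).
  rewrite (coact_sw hδ); last by lin.
  apply: eq_sw => v0 c.
  have := congr1 (fun x => v0 ⊗ x) (pq c).
  rewrite /= !(lin_sw (g := pure v0)); [|lin|lin] => H.
  transitivity (\sw_(c1, c2 <- comul c) v0 ⊗ (θ c2 *: p c1)).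
    by apply: eq_sw => *; rewrite (linZ (f := pure v0)) //; lin.
  by rewrite H; apply: eq_sw => *; rewrite (linZ (f := pure v0)) //; lin.
apply: eq_sw => v0 c; rewrite /act (lin_sw (g := fun x => x ⊗ _)); last by lin.
by apply: eq_sw => *; rewrite (linZ (f := fun x => x ⊗ _)) //; lin.
Qed.

Lemma act_intertwines_commuting V C D (θ : C -> k) (δ : V -> V ⊗ C)
    (γ : V -> V ⊗ D) :
  coaction δ -> coaction γ -> linear (θ : C -> k^o) -> commuting δ γ ->
  intertwines (act θ δ) γ γ.
Proof.
move=> hδ hγ lθ h; split=> [|v]; first exact: act_linear.
rewrite {1}/act lin_sw; last by lin.
transitivity (\sw_(v0, c <- δ v) \sw_(v00, d <- γ v0) θ c *: (v00 ⊗ d)).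
  by apply: eq_sw => v0 c; rewrite linZ ?sw_scale ?sw_id //; lin.
rewrite -(commuting_sw _ (E := fun v00 c d => θ c *: (v00 ⊗ d)) h); last by lin.
apply: eq_sw => v0 c; rewrite /act (lin_sw (g := fun x => x ⊗ _)); last by lin.
by apply: eq_sw => *; rewrite (linZ (f := fun x => x ⊗ _)) //; lin.
Qed.

Section Intertwiners.
Variables (V W : lmodType k) (C D : coalgebra k) (g : V -> W).
Variables (δ : V -> V ⊗ C) (δ' : W -> W ⊗ C) (γ : V -> V ⊗ D) (γ' : W -> W ⊗ D).
Hypothesis gδ : intertwines g δ δ'.

Lemma sw_intertwines P (F : W -> C -> P) v : bilin F ->
  sweedler (δ' (g v)) F = \sw_(v0, c <- δ v) F (g v0) c.
Proof.
move=> bF; have [_ ->] := gδ; rewrite sw_sw //.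
by apply: eq_sw => *; rewrite sw_pure.
Qed.

Lemma intertwines_push (E : coalgebra k) (p : C -> E) :
  linear p -> intertwines g (push p δ) (push p δ').
Proof.
move=> lp; split=> [|v]; first by lin.
by rewrite {1}/push sw_intertwines ?sw_push //; lin.
Qed.

Lemma intertwines_join : linear δ' ->
  intertwines g γ γ' -> intertwines g (join δ γ) (join δ' γ').
Proof.
move=> lδ' gγ; split=> [|v]; first by lin.
have [lg eγ] := gγ.
rewrite {1}/join eγ sw_sw; last by lin.
rewrite sw_join; last by lin.
apply: eq_sw => v0 d; rewrite sw_pure; last by lin.
by rewrite sw_intertwines //; lin.
Qed.

Lemma intertwines_act (θ : C -> k) v : linear (θ : C -> k^o) ->
  g (act θ δ v) = act θ δ' (g v).
Proof.
move=> lθ; have [lg _] := gδ.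
rewrite {1}/act lin_sw // /act sw_intertwines; last by lin.
by apply: eq_sw => *; rewrite linZ.
Qed.

End Intertwiners.

Lemma intertwines_comp U V W C (g : U -> V) (h : V -> W) (δ : U -> U ⊗ C)
    (δ' : V -> V ⊗ C) (δ'' : W -> W ⊗ C) :
  intertwines g δ δ' -> intertwines h δ' δ'' -> intertwines (fun u => h (g u)) δ δ''.
Proof.
move=> hg hh; have [_ eh] := hh; split=> [|u]; first by lin.
by rewrite eh (sw_intertwines hg) //; lin.
Qed.

Section Surjection.
Variables (V W : lmodType k) (C D : coalgebra k) (g : V -> W).
Variables (δ : V -> V ⊗ C) (δ' : W -> W ⊗ C) (γ : V -> V ⊗ D) (γ' : W -> W ⊗ D).
Hypotheses (gδ : intertwines g δ δ') (lδ' : linear δ').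
Hypothesis g_surj : forall w, exists v, g v = w.

(** Coaction axioms pass to quotients. This is how the coactions on balanced tensor products are
    obtained from those on M ⊗ N. *)
Lemma coaction_surj : coaction δ -> coaction δ'.
Proof.
move=> hδ; split=> // w; have [v <-] := g_surj w.
- rewrite !(sw_intertwines gδ); [|lin|lin].
  transitivity (\sw_(v0, c <- δ v) \sw_(v00, c' <- δ v0) g v00 ⊗ c' ⊗ c).
    by apply: eq_sw => *; rewrite (sw_intertwines gδ) //; lin.
  rewrite (coact_sw hδ); last by lin.
  apply: eq_sw => v0 c; rewrite -[in RHS](sw_id (comul c)).
  by rewrite (lin_sw (g := pure _)) //; lin.
- rewrite (sw_intertwines gδ); last by lin.
  by rewrite (coact_counit_sw hδ) //; lin.
Qed.

Lemma commuting_surj : linear γ' -> intertwines g γ γ' -> linear δ -> linear γ ->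
  commuting δ γ -> commuting δ' γ'.
Proof.
move=> lγ' gγ lδ lγ h w; have [v <-] := g_surj w.
rewrite !(sw_intertwines gδ, sw_intertwines gγ); [|lin|lin].
transitivity (\sw_(v0, d <- γ v) \sw_(v00, c <- δ v0) g v00 ⊗ c ⊗ d).
  by apply: eq_sw => *; rewrite (sw_intertwines gδ) //; lin.
rewrite (commuting_sw _ h (E := fun v c d => g v ⊗ c ⊗ d)); last by lin.
by apply: eq_sw => *; rewrite (sw_intertwines gγ) //; lin.
Qed.

End Surjection.

End CoactionTheory.

(** * Reassociators acting through commuting coactions *)

Create HintDb coact.

Section Reassociators.
Variables (k : comPzRingType) (H : dual_quasi_bialgebra k).
Implicit Types V W P : lmodType k.

Definition mulH : tcoalg H H -> H := fun t => \sw_(a, b <- t) a ∙ b.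

Lemma mulH_pure a b : mulH (a ⊗ b) = a ∙ b.
Proof. by rewrite /mulH sw_pure //; lin. Qed.

Lemma mulH_linear : linear mulH.
Proof. by rewrite /mulH; lin. Qed.
#[local] Hint Extern 1 (lin_goal (GRing.linear_for _ mulH)) =>
  apply: LinGoal; exact: mulH_linear : lin.

Lemma mulH_coalgebra_map : coalgebra_map mulH.
Proof.
split; first by lin.
  apply: tens_ext => [||a b]; [lin|lin|].
  rewrite mulH_pure dqb_comulM /= sw_tcomul; last by lin.
  by apply: eq_sw => *; apply: eq_sw => *; rewrite !mulH_pure.
move=> t; apply: (tens_ext (P := k^o) (f := fun t => counit (mulH t)) (g := @tcounit k H H)).
- by lin.
- exact: tcounit_linear.
by move=> a b; rewrite mulH_pure dqb_counitM tcounit_pure.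
Qed.

(** For the two legs of M ⊗ N this is the diagonal coaction. *)
Definition cprod V (ρ σ : V -> V ⊗ H) : V -> V ⊗ H := push mulH (join ρ σ).
Definition triv V (v : V) : V ⊗ H := v ⊗ dqb_one H.

Definition tri (α : H -> H -> H -> k) (t : tcoalg H (tcoalg H H)) : k :=
  \sw_(a, r <- t) \sw_(b, c <- r) (α a b c : k^o).

(* The operator v ↦ α(v_ρ, v_σ, v_τ) v_0; for the diagonal coactions of a
   tensor product it is the associativity constraint. *)
Definition reop V (α : H -> H -> H -> k) (ρ σ τ : V -> V ⊗ H) : V -> V :=
  act (tri α) (join ρ (join σ τ)).

Definition trilinear_form (α : H -> H -> H -> k) : Prop :=
  trilin (α : H -> H -> H -> k^o).

#[local] Hint Extern 1 (lin_goal (trilin ?a)) =>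
  match goal with h : trilinear_form ?b |- _ => constr_eq a b; exact (LinGoal h) end : lin.

Lemma tri_linear α : trilinear_form α -> linear (tri α : _ -> k^o).
Proof. by rewrite /tri => ?; lin. Qed.

Lemma tri_pure α a b c : trilinear_form α -> tri α (a ⊗ (b ⊗ c)) = α a b c.
Proof.
move=> hα; rewrite /tri sw_pure; last by lin.
by rewrite sw_pure //; lin.
Qed.

Lemma triv_linear V : linear (@triv V).
Proof. by rewrite /triv; lin. Qed.
#[local] Hint Extern 1 (lin_goal (GRing.linear_for _ (@triv ?V))) =>
  apply: LinGoal; exact: (@triv_linear V) : lin.
#[local] Hint Extern 1 (lin_goal (GRing.linear_for _ (tri _))) =>
  apply: LinGoal; apply: tri_linear; assumption : lin.

Lemma cprod_linear V (ρ σ : V -> V ⊗ H) : linear ρ -> linear σ -> linear (cprod ρ σ).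
Proof. by move=> lρ lσ; rewrite /cprod; lin. Qed.
#[local] Hint Extern 3 (lin_goal (GRing.linear_for _ (cprod _ _))) =>
  apply: LinGoal; apply: cprod_linear; lin : lin.

Lemma sw_cprod V (ρ σ : V -> V ⊗ H) P (F : V -> H -> P) v : bilin F ->
  sweedler (cprod ρ σ v) F =
  \sw_(v0, b <- σ v) \sw_(v1, a <- ρ v0) F v1 (a ∙ b).
Proof.
move=> bF; rewrite /cprod sw_push // sw_join; last by lin.
by apply: eq_sw => *; apply: eq_sw => *; rewrite mulH_pure.
Qed.

Lemma cprod_sw V (ρ σ : V -> V ⊗ H) v :
  cprod ρ σ v = \sw_(v0, b <- σ v) \sw_(v1, a <- ρ v0) v1 ⊗ (a ∙ b).
Proof. by rewrite -[LHS]sw_id sw_cprod //; lin. Qed.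

Lemma sw_triv V P (F : V -> H -> P) v : bilin F ->
  sweedler (triv v) F = F v (dqb_one H).
Proof. exact: sw_pure. Qed.

Lemma reop_sw V α (ρ σ τ : V -> V ⊗ H) v : trilinear_form α ->
  linear ρ -> linear σ -> linear τ ->
  reop α ρ σ τ v = \sw_(v0, c <- τ v) \sw_(v1, b <- σ v0) \sw_(v2, a <- ρ v1)
    α a b c *: v2.
Proof.
move=> hα lρ lσ lτ; rewrite /reop /act sw_join; last by lin.
rewrite sw_join; last by lin.
by do 3!apply: eq_sw => *; rewrite tri_pure.
Qed.

Lemma lin_reop V P (L : V -> P) α (ρ σ τ : V -> V ⊗ H) v : trilinear_form α ->
  linear ρ -> linear σ -> linear τ -> linear L ->
  L (reop α ρ σ τ v) = \sw_(v0, c <- τ v) \sw_(v1, b <- σ v0) \sw_(v2, a <- ρ v1)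
    α a b c *: L v2.
Proof.
move=> hα lρ lσ lτ lL; rewrite reop_sw // (lin_sw _ _ lL); apply: eq_sw => *.
rewrite (lin_sw _ _ lL); apply: eq_sw => *.
by rewrite (lin_sw _ _ lL); apply: eq_sw => *; rewrite (linZ _ _ lL).
Qed.

Lemma reop_linear V α (ρ σ τ : V -> V ⊗ H) : trilinear_form α ->
  linear ρ -> linear σ -> linear τ -> linear (reop α ρ σ τ).
Proof. by move=> *; rewrite /reop /act; lin. Qed.

Lemma triv_coaction V : coaction (@triv V).
Proof.
split=> [|v|v]; first by lin.
- by rewrite !sw_triv ?dqb_comul1 //; lin.
- by rewrite sw_triv ?dqb_counit1 ?scale1r //; lin.
Qed.

Lemma commuting_triv V (ρ : V -> V ⊗ H) : linear ρ -> commuting ρ (@triv V).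
Proof.
move=> lρ v; rewrite sw_triv; last by lin.
by apply: eq_sw => *; rewrite sw_triv //; lin.
Qed.

Lemma triv_commuting V (ρ : V -> V ⊗ H) : linear ρ -> commuting (@triv V) ρ.
Proof. by move=> lρ; apply/commuting_sym/commuting_triv. Qed.

Lemma cprod_triv V (ρ : V -> V ⊗ H) : linear ρ -> cprod ρ (@triv V) = ρ.
Proof.
move=> lρ; apply: funext => v; rewrite cprod_sw sw_triv; last by lin.
by rewrite -[RHS]sw_id; apply: eq_sw => *; rewrite dqb_mul1r.
Qed.

Lemma triv_cprod V (ρ : V -> V ⊗ H) : linear ρ -> cprod (@triv V) ρ = ρ.
Proof.
move=> lρ; apply: funext => v; rewrite cprod_sw -[RHS]sw_id.
by apply: eq_sw => *; rewrite sw_triv ?dqb_mul1l //; lin.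
Qed.

Lemma cprod_coaction V (ρ σ : V -> V ⊗ H) :
  coaction ρ -> coaction σ -> commuting ρ σ -> coaction (cprod ρ σ).
Proof.
move=> hρ hσ h; apply: push_coaction; first exact: join_coaction.
exact: mulH_coalgebra_map.
Qed.

Lemma commuting_cprodl V (ρ σ τ : V -> V ⊗ H) :
  coaction ρ -> coaction σ -> coaction τ -> commuting ρ σ ->
  commuting ρ τ -> commuting σ τ -> commuting (cprod ρ σ) τ.
Proof.
move=> hρ hσ hτ h h1 h2; apply: commuting_push => //; first by lin.
  exact: join_coaction.
exact: commuting_join.
Qed.

Lemma commuting_cprodr V (ρ σ τ : V -> V ⊗ H) :
  coaction ρ -> coaction σ -> coaction τ -> commuting ρ σ ->
  commuting τ ρ -> commuting τ σ -> commuting τ (cprod ρ σ).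
Proof.
move=> hρ hσ hτ h h1 h2; apply/commuting_sym/commuting_cprodl => //;
  exact: commuting_sym.
Qed.

Lemma intertwines_cprod V W (g : V -> W) (ρ σ : V -> V ⊗ H) (ρ' σ' : W -> W ⊗ H) :
  linear ρ' ->
  intertwines g ρ ρ' -> intertwines g σ σ' ->
  intertwines g (cprod ρ σ) (cprod ρ' σ').
Proof.
move=> lρ' h1 h2; apply: intertwines_push; last by lin.
exact: intertwines_join.
Qed.

(* A coaction that is trivial on the image of [g] may be multiplied to any leg:
   this is how e ⊗_A f, which is coinvariant for the product of its two legs, is
   inserted. *)
Lemma intertwines_cprod_triv V W (g : V -> W) (ρ : V -> V ⊗ H) (ρ' τ : W -> W ⊗ H) :
  linear ρ -> linear ρ' ->
  intertwines g ρ ρ' -> intertwines g (@triv V) τ ->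
  intertwines g ρ (cprod ρ' τ).
Proof.
by move=> lρ lρ' h1 h2; rewrite -[X in intertwines g X](cprod_triv lρ); apply: intertwines_cprod.
Qed.

(** Naturality of the constraint. Applied with [g] another reassociator, it lets two operators pass
    each other, at the price of rebracketing a product of legs; applied with [g] the insertion of E,
    it trades the product ef for the trivial coaction. *)
Lemma reop_natural V W (g : V -> W) α (ρ σ τ : V -> V ⊗ H) (ρ' σ' τ' : W -> W ⊗ H) v :
  trilinear_form α -> linear ρ' -> linear σ' ->
  intertwines g ρ ρ' -> intertwines g σ σ' -> intertwines g τ τ' ->
  g (reop α ρ σ τ v) = reop α ρ' σ' τ' (g v).
Proof.
move=> hα lρ lσ h1 h2 h3; rewrite /reop; apply: intertwines_act; last by lin.
by apply: intertwines_join => //; apply: intertwines_join.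
Qed.

Section Legs.
Variables (V : lmodType k) (ρ σ τ : V -> V ⊗ H).
Hypotheses (hρ : coaction ρ) (hσ : coaction σ) (hτ : coaction τ).
Hypotheses (hρσ : commuting ρ σ) (hρτ : commuting ρ τ) (hστ : commuting σ τ).

Lemma join3_coaction : coaction (join ρ (join σ τ)).
Proof.
apply: join_coaction => //; first exact: join_coaction.
by apply/commuting_sym/commuting_join => //; apply: commuting_sym.
Qed.

Lemma reop_intertwines_commuting α (γ : V -> V ⊗ H) : trilinear_form α ->
  coaction γ -> commuting ρ γ -> commuting σ γ -> commuting τ γ ->
  intertwines (reop α ρ σ τ) γ γ.
Proof.
move=> hα hγ h1 h2 h3; apply: act_intertwines_commuting => //.
- exact: join3_coaction.
- by lin.
apply: commuting_join => //; first exact: join_coaction.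
exact: commuting_join.
Qed.

(** Stated for arbitrary forms so that it yields both inverse laws, [reopK] and [reopVK]. *)
Lemma reop_convolution_unit α β v : trilinear_form α -> trilinear_form β ->
  (forall a b c, \sw_(a1, a2 <- comul a) \sw_(b1, b2 <- comul b)
    \sw_(c1, c2 <- comul c) (α a1 b1 c1 * β a2 b2 c2 : k^o) =
    counit a * counit b * counit c) ->
  reop α ρ σ τ (reop β ρ σ τ v) = v.
Proof.
move=> hα hβ αβ; rewrite /reop act_act; [|exact: join3_coaction|lin|lin].
rewrite -[RHS](act_counit join3_coaction); congr act; apply: funext.
apply: (tens_ext (P := k^o)); [rewrite /convolution; lin|lin|].
move=> a; apply: (tens_ext (P := k^o)).
- by rewrite /convolution; lin.
- by lin.
move=> b c; rewrite /convolution sw_comul_tcoalg; last by lin.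
rewrite !counit_tcoalg mulrA -αβ; apply: eq_sw => a1 a2.
rewrite sw_comul_tcoalg; last by lin.
by do 2!apply: eq_sw => *; rewrite !tri_pure.
Qed.

End Legs.

End Reassociators.

#[global] Hint Extern 1 (lin_goal (GRing.linear_for _ mulH)) =>
  apply: LinGoal; exact: mulH_linear : lin.
#[global] Hint Extern 1 (lin_goal (GRing.linear_for _ (@triv _ _ ?V))) =>
  apply: LinGoal; exact: triv_linear : lin.
#[global] Hint Extern 1 (lin_goal (GRing.linear_for _ (tri _))) =>
  apply: LinGoal; apply: tri_linear; done : lin.
#[global] Hint Extern 3 (lin_goal (GRing.linear_for _ (cprod _ _))) =>
  apply: LinGoal; apply: cprod_linear; lin : lin.

#[global] Hint Resolve triv_coaction cprod_coaction commuting_triv triv_commuting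
  commuting_cprodl commuting_cprodr coaction_linear : coact.

Ltac coact := solve [eauto 14 with coact].

(** * Pentagon, inverses and unit laws for the operators given by φ *)

Section Pentagon.
Variables (k : comPzRingType) (H : dual_quasi_bialgebra k).
Implicit Types V W P : lmodType k.

Lemma reassP : trilinear_form (@reass k H).
Proof. exact: reass_trilin. Qed.
Lemma reassVP : trilinear_form (@reassV k H).
Proof. exact: reassV_trilin. Qed.
Hint Resolve reassP reassVP : core.

Local Notation H4 := (tcoalg H (tcoalg H (tcoalg H H))).

Lemma tens4_ext P (f g : H4 -> P) : linear f -> linear g ->
  (forall a b c d, f (a ⊗ (b ⊗ (c ⊗ d))) = g (a ⊗ (b ⊗ (c ⊗ d)))) ->
  forall t, f t = g t.
Proof.
move=> lf lg fg; apply: tens_ext => // a; apply: tens_ext => [||b]; [lin|lin|].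
by apply: tens_ext => [||c d]; [lin|lin|].
Qed.

Lemma convolution4 (θ θ' : H4 -> k) a b c d :
  linear (θ : H4 -> k^o) -> linear (θ' : H4 -> k^o) ->
  convolution θ θ' (a ⊗ (b ⊗ (c ⊗ d))) =
  \sw_(a1, a2 <- comul a) \sw_(b1, b2 <- comul b)
  \sw_(c1, c2 <- comul c) \sw_(d1, d2 <- comul d)
    (θ (a1 ⊗ (b1 ⊗ (c1 ⊗ d1))) * θ' (a2 ⊗ (b2 ⊗ (c2 ⊗ d2))) : k^o).
Proof.
move=> lθ lθ'; rewrite /convolution sw_comul_tcoalg; last by lin.
apply: (eq_sw (P := k^o)) => a1 a2; rewrite sw_comul_tcoalg; last by lin.
by apply: eq_sw => b1 b2; rewrite sw_comul_tcoalg //; lin.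
Qed.

Definition quad (α : H -> H -> H -> H -> k) (t : H4) : k :=
  \sw_(a, r <- t) \sw_(b, s <- r) \sw_(c, d <- s) (α a b c d : k^o).

Definition quadrilinear_form (α : H -> H -> H -> H -> k) : Prop :=
  (forall a, trilin (α a : H -> H -> H -> k^o)) /\
  (forall b c d, linear (fun a => α a b c d : k^o)).

Lemma quad_linear α : quadrilinear_form α -> linear (quad α : H4 -> k^o).
Proof. by move=> [h1 h2]; rewrite /quad; lin. Qed.

Lemma quad_pure α a b c d : quadrilinear_form α ->
  quad α (a ⊗ (b ⊗ (c ⊗ d))) = α a b c d.
Proof.
move=> [h1 h2]; rewrite /quad sw_pure; last by lin.
by rewrite sw_pure ?sw_pure //; lin.
Qed.

Lemma act_quad V (a b c d : V -> V ⊗ H) α v : quadrilinear_form α ->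
  linear a -> linear b -> linear c -> linear d ->
  act (quad α) (join a (join b (join c d))) v =
  \sw_(v1, d1 <- d v) \sw_(v2, c1 <- c v1) \sw_(v3, b1 <- b v2)
  \sw_(v4, a1 <- a v3) α a1 b1 c1 d1 *: v4.
Proof.
move=> hα la lb lc ld.
have lq := quad_linear hα.
rewrite /act sw_join; last by lin.
rewrite sw_join; last by lin.
rewrite sw_join; last by lin.
by do 4!apply: eq_sw => *; rewrite quad_pure.
Qed.

(* Both sides are the action of a linear form on H ⊗ H ⊗ H ⊗ H, and the
   3-cocycle condition on φ says that these two forms are equal. *)
Lemma pentagon V (a b c d : V -> V ⊗ H) v :
  coaction a -> coaction b -> coaction c -> coaction d ->
  commuting a b -> commuting a c -> commuting a d ->
  commuting b c -> commuting b d -> commuting c d ->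
  reop (@reass k H) b c d (reop (@reass k H) a (cprod b c) d
    (reop (@reass k H) a b c v)) =
  reop (@reass k H) a b (cprod c d) (reop (@reass k H) (cprod a b) c d v).
Proof.
move=> ha hb hc hd hab hac had hbc hbd hcd.
set J := join a (join b (join c d)).
have hJ : coaction J.
  apply: join_coaction => //; first exact: join3_coaction.
  apply/commuting_sym/commuting_join => //; first exact: join_coaction.
  - exact: commuting_sym.
  - by apply: commuting_join => //; apply: commuting_sym.
(* The forms on H ⊗ H ⊗ H ⊗ H behind the five operators of the identity; a leg that an operator does
   not involve contributes a counit. *)
pose q1 (a b c d : H) : k := counit a * @reass k H b c d.
pose q2 (a b c d : H) : k := @reass k H a (b ∙ c) d.
pose q3 (a b c d : H) : k := @reass k H a b c * counit d.
pose q4 (a b c d : H) : k := @reass k H a b (c ∙ d).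
pose q5 (a b c d : H) : k := @reass k H (a ∙ b) c d.
have h1 : quadrilinear_form q1 by split; rewrite /q1; lin.
have h2 : quadrilinear_form q2 by split; rewrite /q2; lin.
have h3 : quadrilinear_form q3 by split; rewrite /q3; lin.
have h4 : quadrilinear_form q4 by split; rewrite /q4; lin.
have h5 : quadrilinear_form q5 by split; rewrite /q5; lin.
have l1 := quad_linear h1; have l2 := quad_linear h2; have l3 := quad_linear h3.
have l4 := quad_linear h4; have l5 := quad_linear h5.
have e1 w : reop (@reass k H) b c d w = act (quad q1) J w.
  rewrite act_quad ?reop_sw //; [|lin..].
  do 3!apply: eq_sw => ? ?.
  rewrite -(coact_counit_sw ha _ (f := fun x => _ *: x)); last by lin.
  by apply: eq_sw => *; rewrite scalerA.
have e2 w : reop (@reass k H) a (cprod b c) d w = act (quad q2) J w.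
  rewrite act_quad ?reop_sw //; [|lin..].
  by apply: eq_sw => *; rewrite sw_cprod //; lin.
have e3 w : reop (@reass k H) a b c w = act (quad q3) J w.
  rewrite act_quad //; [|lin..].
  rewrite -[LHS](coact_counit_sw hd (f := reop _ a b c)); last by apply: reop_linear => //; lin.
  apply: eq_sw => *; rewrite reop_sw //; [|lin..].
  rewrite -sw_scale; apply: eq_sw => *.
  rewrite -sw_scale; apply: eq_sw => *.
  by rewrite -sw_scale; apply: eq_sw => *; rewrite scalerA mulrC.
have e4 w : reop (@reass k H) a b (cprod c d) w = act (quad q4) J w.
  rewrite act_quad ?reop_sw //; [|lin..].
  by rewrite sw_cprod //; lin.
have e5 w : reop (@reass k H) (cprod a b) c d w = act (quad q5) J w.
  rewrite act_quad ?reop_sw //; [|lin..].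
  by do 2!apply: eq_sw => *; rewrite sw_cprod //; lin.
have l23 := convolution_linear l2 l3.
have l123 := convolution_linear l1 l23; have l45 := convolution_linear l4 l5.
rewrite e3 e2 e1 e5 e4 (act_act hJ _ l2 l3) (act_act hJ _ l1 l23) (act_act hJ _ l4 l5).
congr act; apply: funext; apply: (tens4_ext l123 l45) => {v} x y z w.
(* The left side of the cocycle condition as a function of the first argument. It is isolated
   because [q1] multiplies it by ε of the first component of that argument, which [sw_counitl] then
   absorbs. *)
pose G (x : H) : k^o :=
  \sw_(y1, y2 <- comul y) \sw_(z1, z2 <- comul z) \sw_(w1, w2 <- comul w)
  \sw_(x1, x2 <- comul x) \sw_(y3, y4 <- comul y2) \sw_(z3, z4 <- comul z2)
  (@reass k H y1 z1 w1 * @reass k H x1 (y3 ∙ z3) w2 * @reass k H x2 y4 z4 : k^o).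
have lG : linear G by rewrite /G; lin.
rewrite !convolution4 //.
transitivity (\sw_(x1, x2 <- comul x) counit x1 *: G x2 : k^o).
  apply: (eq_sw (P := k^o)) => x1 x2; rewrite /G -sw_scale; apply: eq_sw => y1 y2.
  rewrite -sw_scale; apply: eq_sw => z1 z2; rewrite -sw_scale; apply: eq_sw => w1 w2.
  rewrite convolution4 // quad_pure // /q1 /GRing.scale /= -mulrA.
  congr (_ * _); rewrite -[LHS](sw_scale _ (_ : k)) /=; apply: eq_sw => x3 x4.
  rewrite -sw_scale; apply: eq_sw => y3 y4; rewrite -sw_scale; apply: eq_sw => z3 z4.
  (* The counit here comes from [q3], which ignores the fourth leg. *)
  transitivity (\sw_(w3, w4 <- comul w2) counit w4 *:
      (@reass k H y1 z1 w1 * @reass k H x3 (y3 ∙ z3) w3 * @reass k H x4 y4 z4 : k^o)).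
    rewrite -sw_scale; apply: eq_sw => w3 w4; rewrite !quad_pure // /q2 /q3 /GRing.scale /=.
    by rewrite [RHS]mulrC !mulrA.
  apply: (sw_counitr (P := k^o) (f := fun w => @reass k H y1 z1 w1 *
    @reass k H x3 (y3 ∙ z3) w * @reass k H x4 y4 z4) w2); lin.
rewrite (sw_counitl x lG).
transitivity (\sw_(a1, a2 <- comul x) \sw_(b1, b2 <- comul y)
    \sw_(c1, c2 <- comul z) \sw_(d1, d2 <- comul w)
      (@reass k H a1 b1 (c1 ∙ d1) * @reass k H (a2 ∙ b2) c2 d2 : k^o)); last first.
  by do 4!apply: (eq_sw (P := k^o)) => ? ?; rewrite !quad_pure.
(* Both sides now have the same summands; it remains to reorder the sums, with the middle arguments
   split twice. *)
rewrite -reass_cocycle /G /comul2.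
rewrite [RHS]exch_sw [RHS]sw_sw; last by lin.
apply: eq_sw => y1 y2; rewrite sw_pure; last by lin.
transitivity (\sw_(z1, z2 <- comul z) \sw_(x1, x2 <- comul x)
  \sw_(y3, y4 <- comul y2) \sw_(z3, z4 <- comul z2) \sw_(w1, w2 <- comul w)
  (@reass k H y1 z1 w1 * @reass k H x1 (y3 ∙ z3) w2 * @reass k H x2 y4 z4 : k^o)).
  apply: eq_sw => z1 z2; rewrite exch_sw; apply: eq_sw => x1 x2.
  by rewrite exch_sw; apply: eq_sw => y3 y4; rewrite exch_sw.
rewrite [LHS]exch_sw; apply: eq_sw => x1 x2.
rewrite [LHS]exch_sw; apply: eq_sw => y3 y4.
rewrite [RHS]sw_sw; last by lin.
by apply: eq_sw => z1 z2; rewrite sw_pure //; lin.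
Qed.

Section Three.
Variables (V : lmodType k) (a b c : V -> V ⊗ H).
Hypotheses (ha : coaction a) (hb : coaction b) (hc : coaction c).
Hypotheses (hab : commuting a b) (hac : commuting a c) (hbc : commuting b c).

Lemma reopK v : reop (@reassV k H) a b c (reop (@reass k H) a b c v) = v.
Proof. apply: reop_convolution_unit => //; exact: reassVl. Qed.

Lemma reopVK v : reop (@reass k H) a b c (reop (@reassV k H) a b c v) = v.
Proof. apply: reop_convolution_unit => //; exact: reassVr. Qed.

Let t1 (t : tcoalg H (tcoalg H H)) : H := \sw_(x, r <- t) \sw_(y, z <- r) x ∙ (y ∙ z).
Let t2 (t : tcoalg H (tcoalg H H)) : H := \sw_(x, r <- t) \sw_(y, z <- r) (x ∙ y) ∙ z.

(** Both bracketings of the product coaction are pushes of the same join, along the two triple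
    products [t2] and [t1], so [act_intertwines] reduces the claim to [dqb_quasi_assoc]. *)
Lemma reop_assoc :
  intertwines (reop (@reass k H) a b c) (cprod (cprod a b) c) (cprod a (cprod b c)).
Proof.
have l1 : linear t1 by rewrite /t1; lin.
have l2 : linear t2 by rewrite /t2; lin.
have p1 x y z : t1 (x ⊗ (y ⊗ z)) = x ∙ (y ∙ z).
  by rewrite /t1 sw_pure ?sw_pure //; lin.
have p2 x y z : t2 (x ⊗ (y ⊗ z)) = (x ∙ y) ∙ z.
  by rewrite /t2 sw_pure ?sw_pure //; lin.
have -> : cprod (cprod a b) c = push t2 (join a (join b c)).
  apply: funext => v; rewrite cprod_sw /push sw_join; last by lin.
  rewrite sw_join; last by lin.
  apply: eq_sw => v0 z; rewrite sw_cprod; last by lin.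
  by do 2!apply: eq_sw => *; rewrite p2.
have -> : cprod a (cprod b c) = push t1 (join a (join b c)).
  apply: funext => v; rewrite cprod_sw sw_cprod; last by lin.
  rewrite /push sw_join; last by lin.
  rewrite sw_join; last by lin.
  by do 3!apply: eq_sw => *; rewrite p1.
apply: act_intertwines => //; [exact: join3_coaction|by lin|].
apply: tens_ext => [||x]; [lin|lin|].
apply: tens_ext => [||y z]; [lin|lin|].
rewrite !sw_comul_tcoalg; [|lin|lin].
transitivity (\sw_(x1, x2 <- comul x) \sw_(y1, y2 <- comul y)
  \sw_(z1, z2 <- comul z) @reass k H x2 y2 z2 *: (x1 ∙ (y1 ∙ z1))).
  apply: eq_sw => x1 x2; rewrite sw_comul_tcoalg; last by lin.
  by do 2!apply: eq_sw => *; rewrite tri_pure // p1.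
rewrite dqb_quasi_assoc; apply: eq_sw => x1 x2; rewrite sw_comul_tcoalg; last by lin.
by do 2!apply: eq_sw => *; rewrite tri_pure // p2.
Qed.

(** The inverse of an intertwiner intertwines backwards: write [v] as Φ Φ⁻¹ v and use
    [reop_assoc]. *)
Lemma reopV_assoc :
  intertwines (reop (@reassV k H) a b c) (cprod a (cprod b c)) (cprod (cprod a b) c).
Proof.
have lR := reop_linear reassP (coaction_linear ha) (coaction_linear hb) (coaction_linear hc).
have lV := reop_linear reassVP (coaction_linear ha) (coaction_linear hb) (coaction_linear hc).
split=> // v.
rewrite -[X in cprod a (cprod b c) X](reopVK v) (sw_intertwines reop_assoc); last by lin.
by rewrite -[LHS]sw_id; apply: eq_sw => *; rewrite reopK.
Qed.

Lemma reop_mid1 v : reop (@reass k H) a (@triv k H V) c v = v.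
Proof.
rewrite reop_sw //; [|lin..].
rewrite -[RHS](coact_counit hc); apply: eq_sw => v0 z.
rewrite sw_triv; last by lin.
rewrite -[in RHS](coact_counit ha v0) -sw_scale; apply: eq_sw => v1 x.
by rewrite reass_norm scalerA mulrC.
Qed.

End Three.

(* The cocycle condition at (a, b, 1, 1) makes v ↦ φ(a, b, 1) idempotent, and it
   is invertible. *)
Lemma reop_right1 V (a b : V -> V ⊗ H) v : coaction a -> coaction b -> commuting a b ->
  reop (@reass k H) a b (@triv k H V) v = v.
Proof.
move=> ha hb hab; have la := coaction_linear ha; have lb := coaction_linear hb.
have := @pentagon V a b (@triv k H V) (@triv k H V) v.
rewrite !cprod_triv //; last exact: triv_linear.
have ht := @triv_coaction k H V.
rewrite !reop_mid1 //; try coact.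
move=> h.
have := congr1 (reop (@reassV k H) a b (@triv k H V)) (h _ _ _ _ _ _ _ _ _ _).
by rewrite !reopK //; coact.
Qed.

(** The pentagon at (1, 1, b, c) makes this operator idempotent, the factors with a trivial middle
    leg being identities; an invertible idempotent is the identity. *)
Lemma reop_left1 V (b c : V -> V ⊗ H) v : coaction b -> coaction c -> commuting b c ->
  reop (@reass k H) (@triv k H V) b c v = v.
Proof.
move=> hb hc hbc; have lb := coaction_linear hb; have lc := coaction_linear hc.
have ht := @triv_coaction k H V.
have lbc := coaction_linear (cprod_coaction hb hc hbc).
have := @pentagon V (@triv k H V) (@triv k H V) b c v.
rewrite !triv_cprod //; last exact: triv_linear.
rewrite !reop_mid1 //; try coact.
move=> h.
have := congr1 (reop (@reassV k H) (@triv k H V) b c) (h _ _ _ _ _ _ _ _ _ _).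
by rewrite !reopK //; coact.
Qed.

End Pentagon.

#[global] Hint Resolve reassP reassVP : core.

(** * The coactions of a plain tensor product through one of its factors *)

Section Legs.
Variables (k : comPzRingType) (H : coalgebra k) (M N : lmodType k).
Implicit Types (P : lmodType k).

Definition legl (ρ : M -> M ⊗ H) (t : M ⊗ N) : (M ⊗ N) ⊗ H :=
  \sw_(m, n <- t) \sw_(m0, h <- ρ m) (m0 ⊗ n) ⊗ h.
Definition legr (σ : N -> N ⊗ H) (t : M ⊗ N) : (M ⊗ N) ⊗ H :=
  \sw_(m, n <- t) \sw_(n0, h <- σ n) (m ⊗ n0) ⊗ h.

Lemma legl_linear ρ : linear ρ -> linear (legl ρ).
Proof. by move=> lρ; rewrite /legl; lin. Qed.
Lemma legr_linear σ : linear σ -> linear (legr σ).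
Proof. by move=> lρ; rewrite /legr; lin. Qed.
Hint Extern 3 (lin_goal (GRing.linear_for _ (legl _))) =>
  apply: LinGoal; apply: legl_linear; lin : lin.
Hint Extern 3 (lin_goal (GRing.linear_for _ (legr _))) =>
  apply: LinGoal; apply: legr_linear; lin : lin.

Lemma sw_legl ρ P (F : M ⊗ N -> H -> P) m n : linear ρ -> bilin F ->
  sweedler (legl ρ (m ⊗ n)) F = \sw_(m0, h <- ρ m) F (m0 ⊗ n) h.
Proof.
move=> lρ bF; rewrite /legl sw_pure; last by lin.
by rewrite sw_sw //; apply: eq_sw => *; rewrite sw_pure.
Qed.

Lemma sw_legr σ P (F : M ⊗ N -> H -> P) m n : linear σ -> bilin F ->
  sweedler (legr σ (m ⊗ n)) F = \sw_(n0, h <- σ n) F (m ⊗ n0) h.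
Proof.
move=> lσ bF; rewrite /legr sw_pure; last by lin.
by rewrite sw_sw //; apply: eq_sw => *; rewrite sw_pure.
Qed.

Lemma legl_pure ρ m n : linear ρ ->
  legl ρ (m ⊗ n) = \sw_(m0, h <- ρ m) (m0 ⊗ n) ⊗ h.
Proof. by move=> lρ; rewrite -[LHS]sw_id sw_legl //; lin. Qed.

Lemma legr_pure σ m n : linear σ ->
  legr σ (m ⊗ n) = \sw_(n0, h <- σ n) (m ⊗ n0) ⊗ h.
Proof. by move=> lσ; rewrite -[LHS]sw_id sw_legr //; lin. Qed.

Lemma legl_coaction ρ : coaction ρ -> coaction (legl ρ).
Proof.
move=> hρ; split=> [||t]; first by lin.
- apply: tens_ext => [||m n]; [lin|lin|].
  rewrite !sw_legl; [|lin..].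
  transitivity (\sw_(m0, h <- ρ m) \sw_(m1, h' <- ρ m0) (m1 ⊗ n) ⊗ h' ⊗ h).
    by apply: eq_sw => *; rewrite sw_legl //; lin.
  rewrite (coact_sw hρ); last by lin.
  apply: eq_sw => m0 h; rewrite -[in RHS](sw_id (comul h)).
  by rewrite (lin_sw (g := pure _)) //; lin.
- move: t; apply: tens_ext => [||m n]; [lin|lin|].
  rewrite sw_legl; [|lin..].
  by rewrite (coact_counit_sw hρ (f := fun m => m ⊗ n)) //; lin.
Qed.

Lemma legr_coaction σ : coaction σ -> coaction (legr σ).
Proof.
move=> hσ; split=> [||t]; first by lin.
- apply: tens_ext => [||m n]; [lin|lin|].
  rewrite !sw_legr; [|lin..].
  transitivity (\sw_(n0, h <- σ n) \sw_(n1, h' <- σ n0) (m ⊗ n1) ⊗ h' ⊗ h).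
    by apply: eq_sw => *; rewrite sw_legr //; lin.
  rewrite (coact_sw hσ); last by lin.
  apply: eq_sw => n0 h; rewrite -[in RHS](sw_id (comul h)).
  by rewrite (lin_sw (g := pure _)) //; lin.
- move: t; apply: tens_ext => [||m n]; [lin|lin|].
  rewrite sw_legr; [|lin..].
  by rewrite (coact_counit_sw hσ (f := fun n => m ⊗ n)) //; lin.
Qed.

Lemma legll_commuting ρ ρ' : linear ρ -> linear ρ' ->
  commuting ρ ρ' -> commuting (legl ρ) (legl ρ').
Proof.
move=> hρ hρ' h; apply: tens_ext => [||m n]; [lin|lin|].
rewrite !sw_legl; [|lin..].
transitivity (\sw_(m0, a <- ρ' m) \sw_(m1, b <- ρ m0) (m1 ⊗ n) ⊗ b ⊗ a).
  by apply: eq_sw => *; rewrite sw_legl //; lin.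
rewrite (commuting_sw _ h (E := fun m b a => (m ⊗ n) ⊗ b ⊗ a)); last by lin.
by apply: eq_sw => *; rewrite sw_legl //; lin.
Qed.

Lemma legrr_commuting σ σ' : linear σ -> linear σ' ->
  commuting σ σ' -> commuting (legr σ) (legr σ').
Proof.
move=> hσ hσ' h; apply: tens_ext => [||m n]; [lin|lin|].
rewrite !sw_legr; [|lin..].
transitivity (\sw_(n0, a <- σ' n) \sw_(n1, b <- σ n0) (m ⊗ n1) ⊗ b ⊗ a).
  by apply: eq_sw => *; rewrite sw_legr //; lin.
rewrite (commuting_sw _ h (E := fun n b a => (m ⊗ n) ⊗ b ⊗ a)); last by lin.
by apply: eq_sw => *; rewrite sw_legr //; lin.
Qed.

Lemma leglr_commuting ρ σ : linear ρ -> linear σ ->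
  commuting (legl ρ) (legr σ).
Proof.
move=> hρ hσ; apply: tens_ext => [||m n]; [lin|lin|].
rewrite sw_legr ?sw_legl; [|lin..].
transitivity (\sw_(n0, a <- σ n) \sw_(m0, b <- ρ m) (m0 ⊗ n0) ⊗ b ⊗ a).
  by apply: eq_sw => *; rewrite sw_legl //; lin.
by rewrite exch_sw; apply: eq_sw => *; rewrite sw_legr //; lin.
Qed.

Lemma legrl_commuting ρ σ : linear ρ -> linear σ ->
  commuting (legr σ) (legl ρ).
Proof. by move=> *; apply/commuting_sym/leglr_commuting. Qed.

End Legs.

#[global] Hint Extern 3 (lin_goal (GRing.linear_for _ (legl _))) =>
  apply: LinGoal; apply: legl_linear; lin : lin.
#[global] Hint Extern 3 (lin_goal (GRing.linear_for _ (legr _))) =>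
  apply: LinGoal; apply: legr_linear; lin : lin.
#[global] Hint Resolve legl_coaction legr_coaction legll_commuting legrr_commuting
  leglr_commuting legrl_commuting : coact.

(** * Values of φ and φ⁻¹ with 1 as an outer argument *)

Section Normalization.
Variables (k : comPzRingType) (H : dual_quasi_bialgebra k).

Lemma comul_coaction : coaction (@comul k H).
Proof. by split; [exact: comul_linear|exact: comul_assoc|exact: counit_r]. Qed.

Let a : H ⊗ H -> (H ⊗ H) ⊗ H := legl (@comul k H).
Let b : H ⊗ H -> (H ⊗ H) ⊗ H := legr (@comul k H).

Let ha : coaction a. Proof. exact: legl_coaction comul_coaction. Qed.
Let hb : coaction b. Proof. exact: legr_coaction comul_coaction. Qed.
Let hab : commuting a b. Proof. by apply: leglr_commuting; lin. Qed.

(** Recovers a form from the operator that it induces on H ⊗ H: apply ε ⊗ ε to the hypothesis. *)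
Let counits x y (E : H -> H -> k) :
  (forall x y, \sw_(x1, x2 <- comul x) \sw_(y1, y2 <- comul y) E x2 y2 *: (x1 ⊗ y1) = x ⊗ y) ->
  bilin (E : H -> H -> k^o) ->
  E x y = counit x * counit y.
Proof.
move=> h bE; have le := @tcounit_linear k H H.
rewrite -tcounit_pure -h (lin_sw (g := @tcounit k H H : _ -> k^o)) //.
rewrite -[LHS](sw_counitl (P := k^o) (f := fun x => E x y)); last by lin.
apply: (eq_sw (P := k^o)) => x1 x2.
rewrite -[E x2 y](sw_counitl (P := k^o) (f := fun y => E x2 y)); last by lin.
rewrite (lin_sw (g := @tcounit k H H : _ -> k^o)) // -(sw_scale (P := k^o)).
apply: (eq_sw (P := k^o)) => y1 y2; rewrite (linZ _ _ le) tcounit_pure.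
by rewrite /GRing.scale /= mulrA mulrC.
Qed.

(** The operator identity [reop_right1], taken for the regular coactions on the two factors of H ⊗
    H, determines the form itself. *)
Lemma reass_right1 x y : @reass k H x y (dqb_one H) = counit x * counit y.
Proof.
apply: (@counits x y (fun x y => @reass k H x y (dqb_one H))); last by lin.
move=> {}x {}y; rewrite -[RHS](reop_right1 _ ha hb hab) reop_sw //; [|lin..].
rewrite sw_triv; last by lin.
rewrite sw_legr; [|lin..].
rewrite exch_sw; apply: eq_sw => y1 y2; rewrite sw_legl //; lin.
Qed.

Lemma reass_left1 x y : @reass k H (dqb_one H) x y = counit x * counit y.
Proof.
apply: (@counits x y (fun x y => @reass k H (dqb_one H) x y)); last by lin.
move=> {}x {}y; rewrite -[RHS](reop_left1 _ ha hb hab) reop_sw //; [|lin..].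
rewrite sw_legr; [|lin..].
rewrite exch_sw; apply: eq_sw => y1 y2; rewrite sw_legl //; [|lin..].
by apply: eq_sw => *; rewrite sw_triv //; lin.
Qed.

(** Evaluate φ * φ⁻¹ = ε at 1: the factor φ(1, -, -) is a pair of counits, so the convolution is
    φ⁻¹(1, x, y) itself. *)
Lemma reassV_left1 x y : @reassV k H (dqb_one H) x y = counit x * counit y.
Proof.
have := @reassVr k H (dqb_one H) x y.
rewrite dqb_counit1 mul1r dqb_comul1 sw_pure; last by lin.
move=> <-; rewrite -[LHS](sw_counitl (P := k^o) (f := fun x => @reassV k H (dqb_one H) x y)); last by lin.
apply: (eq_sw (P := k^o)) => x1 x2.
rewrite -[@reassV _ _ _ x2 y](sw_counitl (P := k^o) (f := fun y => @reassV k H (dqb_one H) x2 y)); last by lin.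
rewrite -(sw_scale (P := k^o)); apply: (eq_sw (P := k^o)) => y1 y2.
by rewrite reass_left1 /GRing.scale /= mulrA.
Qed.

Lemma reassV_right1 x y : @reassV k H x y (dqb_one H) = counit x * counit y.
Proof.
have := @reassVr k H x y (dqb_one H).
rewrite dqb_counit1 mulr1 => <-.
rewrite -[LHS](sw_counitl (P := k^o) (f := fun x => @reassV k H x y (dqb_one H))); last by lin.
apply: (eq_sw (P := k^o)) => x1 x2.
rewrite -[@reassV _ _ x2 y _](sw_counitl (P := k^o) (f := fun y => @reassV k H x2 y (dqb_one H))); last by lin.
rewrite -(sw_scale (P := k^o)); apply: (eq_sw (P := k^o)) => y1 y2.
rewrite dqb_comul1 sw_pure; last by lin.
by rewrite reass_right1 /GRing.scale /= mulrA.
Qed.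

End Normalization.

(** * Composition of bimodules *)

Section Bimodule.
Variables (k : comPzRingType) (H : dual_quasi_bialgebra k).
Implicit Types (P : lmodType k) (R S : alg_data H).

Lemma bimodule_coaction R S (M : bimod_data R S) : bimodule M -> coaction (@coact k H M).
Proof. by case. Qed.

Lemma lact_bilin R S (M : bimod_data R S) : bimodule M -> bilin (@lact k H R S M).
Proof. by case=> _ [[]]. Qed.

Lemma ract_bilin R S (M : bimod_data R S) : bimodule M -> bilin (@ract k H R S M).
Proof. by case=> _ [_ []]. Qed.

Lemma coact_linear R S (M : bimod_data R S) : bimodule M -> linear (@coact k H M).
Proof. by move/bimodule_coaction/coaction_linear. Qed.

Lemma sw_colinear2 (M N Q : comod_data H) (f : M -> N -> Q) P (F : Q -> H -> P) m n :
  linear (@coact k H M) -> linear (@coact k H N) -> colinear2 f -> bilin F ->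
  sweedler (coact (f m n)) F =
  \sw_(m0, m1 <- coact m) \sw_(n0, n1 <- coact n) F (f m0 n0) (m1 ∙ n1).
Proof.
move=> lM lN [bf [lf cf]] bF.
rewrite -(tlift_pure m n bf) cf sw_sw // /= sw_pure; last by lin.
rewrite sw_sw; last by lin.
apply: eq_sw => m0 m1; rewrite sw_sw; last by lin.
by apply: eq_sw => n0 n1; rewrite !sw_pure ?tlift_pure //; lin.
Qed.

End Bimodule.

#[global] Hint Extern 2 (lin_goal (GRing.linear_for _ (@coact _ _ _))) =>
  apply: LinGoal; match goal with h : bimodule _ |- _ => exact (coact_linear h) end : lin.
#[global] Hint Extern 2 (lin_goal (bilin (@lact _ _ _ _ _))) =>
  apply: LinGoal; match goal with h : bimodule _ |- _ => exact (lact_bilin h) end : lin.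
#[global] Hint Extern 2 (lin_goal (bilin (@ract _ _ _ _ _))) =>
  apply: LinGoal; match goal with h : bimodule _ |- _ => exact (ract_bilin h) end : lin.
#[global] Hint Extern 2 (coaction (@coact _ _ _)) =>
  match goal with h : bimodule _ |- _ => exact (bimodule_coaction h) end : coact.

Section Bcomp.
Variables (k : comPzRingType) (H : dual_quasi_bialgebra k).
Implicit Types (P : lmodType k).

Section Compose.
Variables (R S T : alg_data H) (M : bimod_data R S) (N : bimod_data S T).

Definition balanced P (f : M -> N -> P) : Prop :=
  bilin f /\ forall m s n, f (ract m s) n =
    \sw_(m0, m1 <- coact m) \sw_(s0, s1 <- coact s) \sw_(n0, n1 <- coact n)
      @reass k H m1 s1 n1 *: f m0 (lact s0 n0).

Lemma tlift_span P (f : M -> N -> P) t : balanced f ->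
  span (fun t : tens M N => exists m s n, t = balance m s n) t -> tlift f t = 0.
Proof.
move=> [bf fb]; have lf := tlift_linear bf.
move=> /(_ (fun t => tlift f t = 0)); apply.
  split=> [|a x y hx hy]; first exact: (lin0 lf).
  by rewrite lf hx hy scaler0 addr0.
move=> _ [m [s [n ->]]]; rewrite /balance (linD _ _ lf) -scaleN1r (linZ _ _ lf).
rewrite tlift_pure // fb !(lin_sw _ _ lf) scaleN1r; apply/eqP; rewrite subr_eq0; apply/eqP.
apply: eq_sw => m0 m1; rewrite (lin_sw _ _ lf); apply: eq_sw => s0 s1.
rewrite (lin_sw _ _ lf); apply: eq_sw => n0 n1.
by rewrite (linZ _ _ lf) tlift_pure.
Qed.

(** [blift] evaluates at a chosen representative; another choice differs from it by an element of
    the span of the relations, which a balanced map kills. *)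
Lemma blift_qpi P (f : M -> N -> P) t : balanced f -> blift f (qpi _ t) = tlift f t.
Proof.
move=> hf; have [bf _] := hf; have lf := tlift_linear bf.
apply/eqP; rewrite -subr_eq0; apply/eqP.
rewrite /blift /sweedler -[- tlift f t]scaleN1r -(linZ _ _ lf) -(linD _ _ lf) scaleN1r.
by apply: (tlift_span hf); exact: qrepr_pi.
Qed.

Lemma blift_btens P (f : M -> N -> P) m n : balanced f -> blift f (btens m n) = f m n.
Proof. by move=> hf; rewrite blift_qpi // tlift_pure //; case: hf. Qed.

Lemma qpi_bcomp_linear : linear (fun t : tens M N => qpi _ t : bcomp M N).
Proof. exact: qpi_linear. Qed.

Lemma blift_linear P (f : M -> N -> P) : balanced f -> linear (blift f).
Proof.
move=> hf a; elim/quo_ind=> x; elim/quo_ind=> y.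
have [bf _] := hf; have lf := tlift_linear bf.
by rewrite -qpi_linear !blift_qpi // lf.
Qed.

Lemma btens_bilin : bilin (fun (m : M) (n : N) => btens m n : bcomp M N).
Proof.
have l := qpi_bcomp_linear.
by rewrite /btens; lin.
Qed.

#[local] Hint Extern 1 (lin_goal (bilin (@btens _ _ _ _ _ _ _))) =>
  exact (LinGoal btens_bilin) : lin.

Lemma bcomp_ext P (f g : bcomp M N -> P) : linear f -> linear g ->
  (forall m n, f (btens m n) = g (btens m n)) -> forall q, f q = g q.
Proof.
move=> lf lg fg; elim/quo_ind=> t; have l := qpi_bcomp_linear.
apply: (tens_ext (f := fun t => f (qpi _ t)) (g := fun t => g (qpi _ t))); [lin|lin|].
exact: fg.
Qed.

Lemma btens_ract m s n : (btens (ract m s) n : bcomp M N) =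
  \sw_(m0, m1 <- coact m) \sw_(s0, s1 <- coact s) \sw_(n0, n1 <- coact n)
      @reass k H m1 s1 n1 *: (btens m0 (lact s0 n0) : bcomp M N).
Proof.
have l := qpi_bcomp_linear; apply/eqP; rewrite -subr_eq0; apply/eqP.
transitivity (qpi (fun t : tens M N => exists m s n, t = balance m s n) (balance m s n)).
  rewrite /balance (linD _ _ l) -[- sweedler _ _]scaleN1r (linZ _ _ l) scaleN1r.
  congr (_ - _); rewrite (lin_sw _ _ l); apply: eq_sw => m0 m1.
  rewrite (lin_sw _ _ l); apply: eq_sw => s0 s1; rewrite (lin_sw _ _ l); apply: eq_sw => n0 n1.
  by rewrite (linZ _ _ l).
rewrite -(lin0 l); apply/qpi_eqP; rewrite subr0; apply: span_gen.
by exists m, s, n.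
Qed.

Lemma btens_balanced P (g : bcomp M N -> P) : linear g ->
  balanced (fun m n => g (btens m n)).
Proof.
move=> lg; split=> [|m s n]; first by lin.
rewrite btens_ract (lin_sw _ _ lg); apply: eq_sw => *.
rewrite (lin_sw _ _ lg); apply: eq_sw => *.
by rewrite (lin_sw _ _ lg); apply: eq_sw => *; rewrite (linZ _ _ lg).
Qed.

Lemma qpi_surj (q : bcomp M N) : exists t : M ⊗ N, qpi _ t = q.
Proof. by exists (qrepr q); exact: qreprK. Qed.

Hypotheses (hM : bimodule M) (hN : bimodule N) (hS : linear (@coact k H S)).

(** [mid_ract] and [mid_lact] have one and the same source, bracketed to the right. The constraint
    between the two bracketings thereby becomes an operator on a single module. *)
Definition mid_ract (t : M ⊗ S ⊗ N) : M ⊗ N :=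
  \sw_(m, r <- t) \sw_(s, n <- r) ract m s ⊗ n.
Definition mid_lact (t : M ⊗ S ⊗ N) : M ⊗ N :=
  \sw_(m, r <- t) \sw_(s, n <- r) m ⊗ lact s n.

Local Notation lM := (legl (@coact k H M)).
Local Notation lS := (legr (legl (@coact k H S))).
Local Notation lN := (legr (legr (@coact k H N))).

Lemma mid_ract_linear : linear mid_ract.
Proof. by rewrite /mid_ract; lin. Qed.
Lemma mid_lact_linear : linear mid_lact.
Proof. by rewrite /mid_lact; lin. Qed.
Lemma mid_ract_pure m s n : mid_ract (m ⊗ s ⊗ n) = ract m s ⊗ n.
Proof. by rewrite /mid_ract sw_pure ?sw_pure //; lin. Qed.
Lemma mid_lact_pure m s n : mid_lact (m ⊗ s ⊗ n) = m ⊗ lact s n.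
Proof. by rewrite /mid_lact sw_pure ?sw_pure //; lin. Qed.

Lemma mid_ract_intertwines_l : intertwines mid_ract (cprod lM lS) lM.
Proof.
have l1 := mid_ract_linear; split=> //; apply: tens3_ext => [||m s n]; [lin|lin|].
rewrite mid_ract_pure legl_pure; last by lin.
have [_ [_ cr] _ _] := hM.
rewrite (sw_colinear2 _ _ _ _ cr); [|lin..].
rewrite sw_cprod; last by lin.
rewrite sw_legr; [|lin..].
rewrite sw_legl; [|lin..].
rewrite exch_sw; apply: eq_sw => s0 s1; rewrite sw_legl; [|lin..].
by apply: eq_sw => *; rewrite mid_ract_pure.
Qed.

Lemma mid_ract_intertwines_r : intertwines mid_ract lN (legr (@coact k H N)).
Proof.
have l1 := mid_ract_linear; split=> //; apply: tens3_ext => [||m s n]; [lin|lin|].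
rewrite mid_ract_pure legr_pure; last by lin.
rewrite sw_legr; [|lin..].
rewrite sw_legr; [|lin..].
by apply: eq_sw => *; rewrite mid_ract_pure.
Qed.

Lemma mid_lact_intertwines_l : intertwines mid_lact lM (legl (@coact k H M)).
Proof.
have l1 := mid_lact_linear; split=> //; apply: tens3_ext => [||m s n]; [lin|lin|].
rewrite mid_lact_pure legl_pure; last by lin.
rewrite sw_legl; [|lin..].
by apply: eq_sw => *; rewrite mid_lact_pure.
Qed.

Lemma mid_lact_intertwines_r : intertwines mid_lact (cprod lS lN) (legr (@coact k H N)).
Proof.
have l1 := mid_lact_linear; split=> //; apply: tens3_ext => [||m s n]; [lin|lin|].
rewrite mid_lact_pure legr_pure; last by lin.
have [_ [cl _] _ _] := hN.
rewrite (sw_colinear2 _ _ _ _ cl); [|lin..].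
rewrite sw_cprod; last by lin.
rewrite sw_legr; [|lin..].
rewrite sw_legr; [|lin..].
rewrite exch_sw; apply: eq_sw => n0 n1; rewrite sw_legr; [|lin..].
rewrite sw_legl; [|lin..].
by apply: eq_sw => *; rewrite mid_lact_pure.
Qed.

Lemma mid_lact_reop m s n : mid_lact (reop (@reass k H) lM lS lN (m ⊗ s ⊗ n)) =
  \sw_(m0, m1 <- coact m) \sw_(s0, s1 <- coact s) \sw_(n0, n1 <- coact n)
      @reass k H m1 s1 n1 *: (m0 ⊗ lact s0 n0).
Proof.
have l1 := mid_lact_linear.
rewrite reop_sw //; [|lin..].
rewrite sw_legr; [|lin..].
rewrite sw_legr; [|lin..].
rewrite (lin_sw _ _ l1) [RHS]exch_sw.
transitivity (\sw_(n0, n1 <- coact n) \sw_(s0, s1 <- coact s) \sw_(m0, m1 <- coact m)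
  @reass k H m1 s1 n1 *: (m0 ⊗ lact s0 n0)).
  apply: eq_sw => n0 n1; rewrite sw_legr; [|lin..].
  rewrite sw_legl; [|lin..].
  rewrite (lin_sw _ _ l1); apply: eq_sw => s0 s1; rewrite sw_legl; [|lin..].
  by rewrite (lin_sw _ _ l1); apply: eq_sw => *; rewrite (linZ _ _ l1) mid_lact_pure.
by rewrite exch_sw; apply: eq_sw => *; rewrite exch_sw.
Qed.

(** The coequalizer condition as an identity between operators, to which naturality and the pentagon
    apply without expanding Sweedler sums. *)
Lemma balancedP P (g : M ⊗ N -> P) : linear g ->
  balanced (fun m n => g (m ⊗ n)) <->
  forall t, g (mid_ract t) = g (mid_lact (reop (@reass k H) lM lS lN t)).
Proof.
move=> lg; have l1 := mid_ract_linear; have l2 := mid_lact_linear.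
have e m s n : g (mid_lact (reop (@reass k H) lM lS lN (m ⊗ s ⊗ n))) =
  \sw_(m0, m1 <- coact m) \sw_(s0, s1 <- coact s) \sw_(n0, n1 <- coact n)
      @reass k H m1 s1 n1 *: g (m0 ⊗ lact s0 n0).
  rewrite mid_lact_reop (lin_sw _ _ lg); apply: eq_sw => *; rewrite (lin_sw _ _ lg).
  by apply: eq_sw => *; rewrite (lin_sw _ _ lg); apply: eq_sw => *; rewrite (linZ _ _ lg).
split=> [[_ h]|h]; last first.
  split=> [|m s n]; first by lin.
  by rewrite -e -h mid_ract_pure.
have lr : linear (reop (@reass k H) lM lS lN) by apply: reop_linear => //; lin.
apply: tens3_ext => [||m s n]; [lin|lin|].
by rewrite e mid_ract_pure h.
Qed.

Lemma qpi_balanced (t : M ⊗ S ⊗ N) :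
  qpi _ (mid_ract t) = qpi _ (mid_lact (reop (@reass k H) lM lS lN t)) :> bcomp M N.
Proof.
have l := qpi_bcomp_linear.
by apply/(balancedP l): t; apply: (btens_balanced (g := id)).
Qed.

End Compose.

Section Coaction.
Variables (R S T : alg_data H) (M : bimod_data R S) (N : bimod_data S T).
Hypotheses (hM : bimodule M) (hN : bimodule N) (hS : comodule S).

Let hS' : coaction (@coact k H S). Proof. exact: hS. Qed.
Let lS' : linear (@coact k H S). Proof. exact: coaction_linear hS'. Qed.

Local Notation rM := (legl (@coact k H M)).
Local Notation rN := (legr (@coact k H N)).
Local Notation lM := (legl (@coact k H M)).
Local Notation lS := (legr (legl (@coact k H S))).
Local Notation lN := (legr (legr (@coact k H N))).

(** [mid_ract] is colinear for the bracketing (MS)N and [mid_lact] for M(SN), and Φ carries one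
    product coaction to the other. *)
Lemma bcomp_coact_balanced : balanced (fun (m : M) (n : N) =>
  \sw_(m0, m1 <- coact m) \sw_(n0, n1 <- coact n)
    (btens m0 n0 : bcomp M N) ⊗ (m1 ∙ n1)).
Proof.
have l := @qpi_bcomp_linear _ _ _ M N.
have l1 : linear (@mid_ract _ _ _ M N) by exact: mid_ract_linear.
have l2 : linear (@mid_lact _ _ _ M N) by exact: mid_lact_linear.
pose g (t : M ⊗ N) : bcomp M N ⊗ H := \sw_(t0, h <- cprod rM rN t) (qpi _ t0) ⊗ h.
have lg : linear g by rewrite /g; lin.
have -> : (fun m n => \sw_(m0, m1 <- coact m) \sw_(n0, n1 <- coact n)
    (btens m0 n0 : bcomp M N) ⊗ (m1 ∙ n1)) = (fun m n => g (m ⊗ n)).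
  apply: funext => m'; apply: funext => n'.
  rewrite /g sw_cprod; last by lin.
  rewrite sw_legr; [|lin..].
  rewrite exch_sw; apply: eq_sw => *; rewrite sw_legl //; lin.
apply/(balancedP hM hN lS' lg) => t.
have i1 : intertwines (@mid_ract _ _ _ M N) (cprod (cprod lM lS) lN) (cprod rM rN).
  apply: intertwines_cprod; [by lin|exact: mid_ract_intertwines_l|exact: mid_ract_intertwines_r].
have i2 : intertwines (@mid_lact _ _ _ M N) (cprod lM (cprod lS lN)) (cprod rM rN).
  apply: intertwines_cprod; [by lin|exact: mid_lact_intertwines_l|exact: mid_lact_intertwines_r].
have i3 := @reop_assoc k H _ lM lS lN.
rewrite /g (sw_intertwines i1); last by lin.
rewrite (sw_intertwines i2); last by lin.
rewrite (sw_intertwines (i3 _ _ _ _ _ _)); [|coact..|lin].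
by apply: eq_sw => *; rewrite qpi_balanced.
Qed.

Lemma bcomp_coact_btens (m : M) (n : N) :
  coact (btens m n : bcomp M N) =
  \sw_(m0, m1 <- coact m) \sw_(n0, n1 <- coact n)
    (btens m0 n0 : bcomp M N) ⊗ (m1 ∙ n1).
Proof.
exact: blift_btens bcomp_coact_balanced.
Qed.

Lemma bcomp_coact_linear : linear (@coact k H (bcomp M N)).
Proof. exact: blift_linear bcomp_coact_balanced. Qed.

Lemma qpi_intertwines :
  intertwines (fun t : M ⊗ N => qpi _ t : bcomp M N) (cprod rM rN)
    (@coact k H (bcomp M N)).
Proof.
have l := @qpi_bcomp_linear _ _ _ M N; have l' := bcomp_coact_linear.
split=> //; apply: tens_ext => [||m n]; [lin|lin|].
rewrite [LHS]bcomp_coact_btens sw_cprod; last by lin.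
rewrite sw_legr; [|lin..].
by rewrite exch_sw; apply: eq_sw => *; rewrite sw_legl //; lin.
Qed.

Lemma bcomp_coaction : coaction (@coact k H (bcomp M N)).
Proof.
have l' := bcomp_coact_linear.
apply: (coaction_surj qpi_intertwines l'); first exact: qpi_surj.
by coact.
Qed.

End Coaction.

End Bcomp.

#[global] Hint Extern 1 (lin_goal (bilin (@btens _ _ _ _ _ ?M ?N))) =>
  exact (LinGoal (btens_bilin M N)) : lin.

#[global] Hint Extern 1 (lin_goal (bilin (@kmul _ ?A))) =>
  exact (LinGoal (@kmul_bilin _ A)) : lin.

#[global] Hint Extern 1 (lin_goal (bilin (@amul _ _ (@triv_alg _ _ ?A)))) =>
  exact (LinGoal (@kmul_bilin _ A)) : lin.

(** * Bimodules over an algebra with trivial coaction *)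

Section TrivialAlgebra.
Variables (k : comPzRingType) (H : dual_quasi_bialgebra k) (A : kalgebra k).
Implicit Types (P : lmodType k) (R S T : alg_data H).
Local Notation A' := (triv_alg H A).

Lemma triv_comodule : comodule A'.
Proof. exact: (@triv_coaction k H A). Qed.

Lemma sw_coactA P (F : A -> H -> P) (a : A') : bilin F ->
  sweedler (coact a) F = F a (dqb_one H).
Proof. exact: sw_pure. Qed.

Lemma coact_ractA R (M : bimod_data R A') P (F : M -> H -> P) (m : M) (a : A') :
  bimodule M -> bilin F ->
  sweedler (coact (ract m a)) F = \sw_(m0, m1 <- coact m) F (ract m0 a) m1.
Proof.
move=> hM bF; have [_ [_ cr] _ _] := hM.
rewrite (sw_colinear2 _ _ _ _ cr); [|lin|exact: triv_linear|lin].
apply: eq_sw => m0 m1; rewrite sw_coactA; last by lin.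
by rewrite dqb_mul1r.
Qed.

Lemma coact_lactA S (M : bimod_data A' S) P (F : M -> H -> P) (m : M) (a : A') :
  bimodule M -> bilin F ->
  sweedler (coact (lact a m)) F = \sw_(m0, m1 <- coact m) F (lact a m0) m1.
Proof.
move=> hM bF; have [_ [cl _] _ _] := hM.
rewrite (sw_colinear2 _ _ _ _ cl); [|exact: triv_linear|lin|lin].
rewrite sw_coactA; last by lin.
by apply: eq_sw => m0 m1; rewrite dqb_mul1l.
Qed.

(** The leg of [a] is 1, so φ reduces to counits and the actions commute strictly. The neighbouring
    lemmas follow the same pattern. *)
Lemma lact_ractA R (M : bimod_data R A') (r : R) (m : M) (a : A') : comodule R -> bimodule M ->
  ract (lact r m) a = lact r (ract m a).
Proof.
move=> hR hM; have [_ _ _ [_ _ ->]] := hM.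
have hR' : coaction (@coact k H R) := hR; have hM' := bimodule_coaction hM.
have lR := coaction_linear hR'.
rewrite -[RHS](coact_counit_sw hR' (f := fun r => lact r (ract m a))); last by lin.
apply: eq_sw => r0 r1.
rewrite -[in RHS](coact_counit_sw hM' (f := fun m => lact r0 (ract m a))); last by lin.
rewrite -sw_scale; apply: eq_sw => m0 m1.
by rewrite sw_coactA ?reass_right1 ?scalerA //; lin.
Qed.

Lemma ract_lactA S (M : bimod_data A' S) (a : A') (m : M) (s : S) : comodule S -> bimodule M ->
  ract (lact a m) s = lact a (ract m s).
Proof.
move=> hS hM; have [_ _ _ [_ _ ->]] := hM.
have hS' : coaction (@coact k H S) := hS; have hM' := bimodule_coaction hM.
have lS := coaction_linear hS'.
rewrite sw_coactA; last by lin.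
rewrite -[RHS](coact_counit_sw hM' (f := fun m => lact a (ract m s))); last by lin.
apply: eq_sw => m0 m1.
rewrite -[in RHS](coact_counit_sw hS' (f := fun s => lact a (ract m0 s))); last by lin.
rewrite -sw_scale; apply: eq_sw => s0 s1.
by rewrite reass_left1 scalerA.
Qed.

Lemma ractMA R (M : bimod_data R A') (m : M) (a a' : A) : bimodule M ->
  ract (ract m (a : A')) (a' : A') = ract m (kmul a a' : A').
Proof.
move=> hM; have [_ _ _ [_ -> _]] := hM; have hM' := bimodule_coaction hM.
rewrite -[RHS](coact_counit_sw hM' (f := fun m => ract m (kmul a a' : A'))); last by lin.
have bA := @kmul_bilin k A.
apply: eq_sw => m0 m1; rewrite sw_coactA; last by rewrite /=; lin.
by rewrite sw_coactA ?reass_norm ?dqb_counit1 ?mulr1 //=; lin.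
Qed.

Lemma lactMA S (M : bimod_data A' S) (m : M) (a a' : A) : bimodule M ->
  lact (kmul a a' : A') m = lact (a : A') (lact (a' : A') m).
Proof.
move=> hM; have [_ _ _ [h _ _]] := hM; have hM' := bimodule_coaction hM.
rewrite (h (a : A')).
rewrite -[RHS](coact_counit_sw hM' (f := fun m => lact (a : A') (lact (a' : A') m))); last by lin.
rewrite sw_coactA; last by lin.
rewrite sw_coactA; last by lin.
by apply: eq_sw => m0 m1; rewrite reass_left1 dqb_counit1 mul1r.
Qed.

Section MiddleTrivial.
Variables (R T : alg_data H) (M : bimod_data R A') (N : bimod_data A' T).
Hypotheses (hM : bimodule M) (hN : bimodule N).

(** The middle argument of φ is 1, so the relations of the coequalizer are those of the usual tensor
    product over A. *)
Lemma balancedA P (f : M -> N -> P) : bilin f ->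
  (forall m (a : A') n, f (ract m a) n = f m (lact a n)) -> balanced f.
Proof.
move=> bf fA; split=> // m a n; rewrite fA.
have hM' := bimodule_coaction hM; have hN' := bimodule_coaction hN.
rewrite -[LHS](coact_counit_sw hM' (f := fun m => f m (lact a n))); last by lin.
apply: eq_sw => m0 m1; rewrite sw_coactA; last by lin.
rewrite -[in LHS](coact_counit_sw hN' (f := fun n => f m0 (lact a n))); last by lin.
by rewrite -sw_scale; apply: eq_sw => *; rewrite scalerA reass_norm.
Qed.

Lemma btens_ractA (m : M) (a : A') (n : N) :
  (btens (ract m a) n : bcomp M N) = btens m (lact a n).
Proof.
rewrite btens_ract.
have hM' := bimodule_coaction hM; have hN' := bimodule_coaction hN.
rewrite -[RHS](coact_counit_sw hM' (f := fun m => btens m (lact a n))); last by lin.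
apply: eq_sw => m0 m1; rewrite sw_coactA; last by lin.
rewrite -[in RHS](coact_counit_sw hN' (f := fun n => btens m0 (lact a n))); last by lin.
by rewrite -sw_scale; apply: eq_sw => *; rewrite scalerA reass_norm.
Qed.

End MiddleTrivial.

Section LeftTrivial.
Variables (S T : alg_data H) (M : bimod_data A' S) (N : bimod_data S T).
Hypotheses (hM : bimodule M) (hN : bimodule N) (hS : comodule S).

Lemma lactA_balanced (a : A') :
  balanced (fun (m : M) (n : N) => btens (lact a m) n : bcomp M N).
Proof.
have hS' : coaction (@coact k H S) := hS; have lS := coaction_linear hS'.
split=> [|m s n]; first by lin.
rewrite -ract_lactA // btens_ract coact_lactA //; lin.
Qed.

Let lactE (a : A') : (@lact k H A' T (bcomp M N) a) =
  blift (fun (m : M) (n : N) => btens (lact a m) n : bcomp M N).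
Proof.
congr blift; apply: funext => m; apply: funext => n.
rewrite sw_coactA; last by lin.
have hM' := bimodule_coaction hM; have hN' := bimodule_coaction hN.
rewrite -[RHS](coact_counit_sw hM' (f := fun m => btens (lact a m) n)); last by lin.
apply: eq_sw => m0 m1.
rewrite -[in RHS](coact_counit_sw hN' (f := fun n => btens (lact a m0) n)); last by lin.
by rewrite -sw_scale; apply: eq_sw => *; rewrite reassV_left1 scalerA.
Qed.

Lemma lactA_btens (a : A') (m : M) (n : N) :
  lact a (btens m n : bcomp M N) = btens (lact a m) n.
Proof. by rewrite lactE (blift_btens _ _ (lactA_balanced a)). Qed.

Lemma lactA_bilin : bilin (@lact k H A' T (bcomp M N)).
Proof.
apply: bilinP => [q|a]; last by rewrite lactE; apply: blift_linear; apply: lactA_balanced.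
(* Linearity in [a] is seen on the fixed representative of [q], term by term. *)
have -> : (fun a : A' => lact a q) =
    (fun a : A' => \sw_(m, n <- qrepr q) (btens (lact a m) n : bcomp M N)).
  by apply: funext => a; rewrite lactE.
by lin.
Qed.

End LeftTrivial.

Section RightTrivial.
Variables (R S : alg_data H) (M : bimod_data R S) (N : bimod_data S A').
Hypotheses (hM : bimodule M) (hN : bimodule N) (hS : comodule S).

Lemma ractA_balanced (a : A') :
  balanced (fun (m : M) (n : N) => btens m (ract n a) : bcomp M N).
Proof.
have hS' : coaction (@coact k H S) := hS; have lS := coaction_linear hS'.
split=> [|m s n]; first by lin.
rewrite btens_ract; apply: eq_sw => m0 m1; apply: eq_sw => s0 s1.
rewrite coact_ractA //; last by lin.
by apply: eq_sw => n0 n1; rewrite lact_ractA.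
Qed.

Let ractE (a : A') : (fun q => @ract k H R A' (bcomp M N) q a) =
  blift (fun (m : M) (n : N) => btens m (ract n a) : bcomp M N).
Proof.
apply: funext => q; congr blift; apply: funext => m; apply: funext => n.
have hM' := bimodule_coaction hM; have hN' := bimodule_coaction hN.
rewrite -[RHS](coact_counit_sw hM' (f := fun m => btens m (ract n a))); last by lin.
apply: eq_sw => m0 m1.
rewrite -[in RHS](coact_counit_sw hN' (f := fun n => btens m0 (ract n a))); last by lin.
rewrite -sw_scale; apply: eq_sw => n0 n1; rewrite sw_coactA; last by lin.
by rewrite reass_right1 scalerA.
Qed.

Lemma ractA_btens (a : A') (m : M) (n : N) :
  ract (btens m n : bcomp M N) a = btens m (ract n a).
Proof.
by have /(congr1 (fun f => f (btens m n : bcomp M N))) /= -> := ractE a;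
  rewrite (blift_btens _ _ (ractA_balanced a)).
Qed.

Lemma ractA_bilin : bilin (@ract k H R A' (bcomp M N)).
Proof.
apply: bilinP => [a|q]; first by rewrite ractE; apply: blift_linear; apply: ractA_balanced.
have -> : (fun a : A' => ract q a) =
    (fun a : A' => \sw_(m, n <- qrepr q) (btens m (ract n a) : bcomp M N)).
  by apply: funext => a; have /(congr1 (fun f => f q)) /= -> := ractE a.
by lin.
Qed.

End RightTrivial.

End TrivialAlgebra.

Section TrivialBimodules.
Variables (k : comPzRingType) (H : dual_quasi_bialgebra k) (A : kalgebra k).
Implicit Types (P : lmodType k) (R S T : alg_data H).
Local Notation A' := (triv_alg H A).

Lemma colinear2_intro (M N Q : comod_data H) (f : M -> N -> Q) :
  linear (@coact k H M) -> linear (@coact k H N) -> linear (@coact k H Q) -> bilin f ->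
  (forall m n, coact (f m n) =
    \sw_(m0, m1 <- coact m) \sw_(n0, n1 <- coact n) f m0 n0 ⊗ (m1 ∙ n1)) ->
  colinear2 f.
Proof.
move=> lM lN lQ bf h; split=> //; have lf := tlift_linear bf; split=> //.
have lt : linear (@coact k H (tens_comod M N)) by rewrite /=; lin.
apply: tens_ext => [||m n]; [lin|lin|].
rewrite tlift_pure // h /= sw_pure; last by lin.
rewrite sw_sw; last by lin.
apply: eq_sw => m0 m1; rewrite sw_sw; last by lin.
by apply: eq_sw => n0 n1; rewrite sw_pure ?tlift_pure //; lin.
Qed.

(** The middle algebra may coact nontrivially, so this covers both C = Σ' ⊗_B Σ and C ⊗_A C. The
    actions sit on the outer factors and every φ has a unit among its arguments. *)
Lemma bimodule_bcompA S (M : bimod_data A' S) (N : bimod_data S A') :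
  comodule S -> bimodule M -> bimodule N -> bimodule (bcomp M N).
Proof.
move=> hS hM hN.
have hC := bcomp_coaction hM hN hS; have lC := coaction_linear hC.
have bl := lactA_bilin hM hN hS; have br := ractA_bilin hM hN hS.
have lA : linear (@coact k H A') by exact: triv_linear.
have [_ _ [M1 _] _] := hM; have [_ _ [_ N1] _] := hN.
have lactC (a : A') (c : bcomp M N) :
    coact (lact a c) = \sw_(c0, c1 <- coact c) lact a c0 ⊗ c1.
  move: c; apply: bcomp_ext => [||m n]; [lin|lin|].
  rewrite (lactA_btens hM hN hS) !(bcomp_coact_btens hM hN hS).
  rewrite coact_lactA //; last by lin.
  rewrite sw_sw; last by lin.
  apply: eq_sw => m0 m1; rewrite sw_sw; last by lin.
  by apply: eq_sw => n0 n1; rewrite sw_pure ?(lactA_btens hM hN hS) //; lin.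
have ractC (a : A') (c : bcomp M N) :
    coact (ract c a) = \sw_(c0, c1 <- coact c) ract c0 a ⊗ c1.
  move: c; apply: bcomp_ext => [||m n]; [lin|lin|].
  rewrite (ractA_btens hM hN hS) !(bcomp_coact_btens hM hN hS).
  rewrite sw_sw; last by lin.
  apply: eq_sw => m0 m1; rewrite coact_ractA //; last by lin.
  rewrite sw_sw; last by lin.
  by apply: eq_sw => n0 n1; rewrite sw_pure ?(ractA_btens hM hN hS) //; lin.
split=> //.
- split; apply: colinear2_intro => //.
    move=> a c; rewrite sw_coactA; last by lin.
    by rewrite lactC; apply: eq_sw => *; rewrite dqb_mul1l.
  move=> c a; rewrite ractC; apply: eq_sw => c0 c1; rewrite sw_coactA; last by lin.
  by rewrite dqb_mul1r.
- split; apply: bcomp_ext => [||m n]; [lin|lin| |lin|lin|].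
    by rewrite (lactA_btens hM hN hS) M1.
  by rewrite (ractA_btens hM hN hS) N1.
- split.
  + move=> a a' c; rewrite sw_coactA; last by lin.
    rewrite sw_coactA; last by lin.
    transitivity (lact a (lact a' c)).
      move: c; apply: bcomp_ext => [||m n]; [lin|lin|].
      by rewrite !(lactA_btens hM hN hS) -(lactMA _ _ _ hM).
    rewrite -[LHS](coact_counit_sw hC (f := fun c => lact a (lact a' c))); last by lin.
    by apply: eq_sw => *; rewrite reass_left1 dqb_counit1 mul1r.
  + move=> c a a'; transitivity (ract c (kmul a a' : A')).
      move: c; apply: bcomp_ext => [||m n]; [lin|lin|].
      by rewrite !(ractA_btens hM hN hS) (ractMA _ _ _ hN).
    rewrite -[LHS](coact_counit_sw hC (f := fun c => ract c (kmul a a' : A'))); last by lin.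
    apply: eq_sw => c0 c1; rewrite sw_coactA; last by lin.
    by rewrite sw_coactA ?reass_norm ?dqb_counit1 ?mulr1 //; lin.
  + move=> a c a'; rewrite sw_coactA; last by lin.
    transitivity (lact a (ract c a')).
      move: c; apply: bcomp_ext => [||m n]; [lin|lin|].
      by rewrite !(ractA_btens hM hN hS, lactA_btens hM hN hS).
    rewrite -[LHS](coact_counit_sw hC (f := fun c => lact a (ract c a'))); last by lin.
    apply: eq_sw => c0 c1; rewrite sw_coactA; last by lin.
    by rewrite reass_left1 dqb_counit1 mulr1.
Qed.

Lemma bimodule_bim1A : bimodule (bim1 A').
Proof.
have bA := @kmul_bilin k A.
have lA : linear (@coact k H A') by exact: triv_linear.
have cA : colinear2 (@amul k H A').
  apply: colinear2_intro => // a b.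
  rewrite sw_coactA; last by rewrite /=; lin.
  by rewrite sw_coactA ?dqb_mul1r //=; lin.
split; [exact: triv_comodule|by []|by split; [exact: kmul1l|exact: kmul1r]|].
split=> a b c; do 3!(rewrite sw_coactA; last by rewrite /=; lin);
  by rewrite reass_norm dqb_counit1 mulr1 scale1r /= kmulA.
Qed.

Section SeparateLegs.
Variables (R T : alg_data H) (M : bimod_data R A') (N : bimod_data A' T).
Hypotheses (hM : bimodule M) (hN : bimodule N).

(* Over an algebra with trivial coaction both coactions of M ⊗ N descend
   separately. *)
Definition bleg1 : bcomp M N -> bcomp M N ⊗ H := blift (fun m n =>
  \sw_(m0, h <- coact m) (btens m0 n : bcomp M N) ⊗ h).
Definition bleg2 : bcomp M N -> bcomp M N ⊗ H := blift (fun m n =>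
  \sw_(n0, h <- coact n) (btens m n0 : bcomp M N) ⊗ h).

Lemma bleg1_balanced : balanced (fun m n =>
  \sw_(m0, h <- coact m) (btens m0 n : bcomp M N) ⊗ h).
Proof.
apply: balancedA => // [|m a n]; first by lin.
rewrite coact_ractA //; last by lin.
by apply: eq_sw => *; rewrite btens_ractA.
Qed.

Lemma bleg2_balanced : balanced (fun m n =>
  \sw_(n0, h <- coact n) (btens m n0 : bcomp M N) ⊗ h).
Proof.
apply: balancedA => // [|m a n]; first by lin.
rewrite coact_lactA //; last by lin.
by apply: eq_sw => *; rewrite btens_ractA.
Qed.

Lemma bleg1_btens m n : bleg1 (btens m n) =
  \sw_(m0, h <- coact m) (btens m0 n : bcomp M N) ⊗ h.
Proof. exact: blift_btens bleg1_balanced. Qed.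

Lemma bleg2_btens m n : bleg2 (btens m n) =
  \sw_(n0, h <- coact n) (btens m n0 : bcomp M N) ⊗ h.
Proof. exact: blift_btens bleg2_balanced. Qed.

Lemma bleg1_linear : linear bleg1.
Proof. exact: blift_linear bleg1_balanced. Qed.

Lemma bleg2_linear : linear bleg2.
Proof. exact: blift_linear bleg2_balanced. Qed.

Lemma sw_bleg1 P (F : bcomp M N -> H -> P) m n : bilin F ->
  sweedler (bleg1 (btens m n)) F = \sw_(m0, h <- coact m) F (btens m0 n) h.
Proof.
by move=> bF; rewrite bleg1_btens sw_sw //; apply: eq_sw => *; rewrite sw_pure.
Qed.

Lemma sw_bleg2 P (F : bcomp M N -> H -> P) m n : bilin F ->
  sweedler (bleg2 (btens m n)) F = \sw_(n0, h <- coact n) F (btens m n0) h.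
Proof.
by move=> bF; rewrite bleg2_btens sw_sw //; apply: eq_sw => *; rewrite sw_pure.
Qed.

Let π (t : M ⊗ N) : bcomp M N := qpi _ t.
Let lπ : linear π. Proof. exact: qpi_linear. Qed.

Let i1 : intertwines π (legl (@coact k H M)) bleg1.
Proof.
have l1 := bleg1_linear.
split=> //; apply: tens_ext => [||m n]; [lin|lin|].
by rewrite [LHS]bleg1_btens sw_legl //; lin.
Qed.

Let i2 : intertwines π (legr (@coact k H N)) bleg2.
Proof.
have l2 := bleg2_linear.
split=> //; apply: tens_ext => [||m n]; [lin|lin|].
by rewrite [LHS]bleg2_btens sw_legr //; lin.
Qed.

Lemma bleg1_coaction : coaction bleg1.
Proof. by apply: (coaction_surj i1 bleg1_linear) => //; [exact: qpi_surj|coact]. Qed.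

Lemma bleg2_coaction : coaction bleg2.
Proof. by apply: (coaction_surj i2 bleg2_linear) => //; [exact: qpi_surj|coact]. Qed.

Lemma bleg12_commuting : commuting bleg1 bleg2.
Proof.
have l1 := bleg1_linear; have l2 := bleg2_linear.
by apply: (commuting_surj i1 l1 _ l2 i2); [exact: qpi_surj|lin|lin|coact].
Qed.

Lemma cprod_bleg : cprod bleg1 bleg2 = @coact k H (bcomp M N).
Proof.
have l1 := bleg1_linear; have l2 := bleg2_linear.
have lC := bcomp_coact_linear hM hN (triv_comodule H A).
apply: funext; apply: bcomp_ext => [||m n]; [lin|lin|].
rewrite (bcomp_coact_btens hM hN (triv_comodule H A)) cprod_sw sw_bleg2; last by lin.
by rewrite exch_sw; apply: eq_sw => *; rewrite sw_bleg1 //; lin.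
Qed.

End SeparateLegs.

End TrivialBimodules.

#[global] Hint Extern 1 (commuting _ _) => apply: commuting_sym; assumption : coact.
#[global] Hint Extern 4 (lin_goal (GRing.linear_for _ (reop _ _ _ _))) =>
  apply: LinGoal; apply: reop_linear;
  [first [exact: reassP | exact: reassVP | assumption] | lin..] : lin.

(** * Operator identities behind the two formulas, the balance and coassociativity *)

Section Operators.
Variables (k : comPzRingType) (H : dual_quasi_bialgebra k).
Implicit Types V W Q : lmodType k.

Local Notation Φ := (reop (@reass k H)).
Local Notation ΦV := (reop (@reassV k H)).

Lemma reassV_natural V W (g : V -> W) (ρ σ τ : V -> V ⊗ H) (ρ' σ' τ' : W -> W ⊗ H) v :
  linear ρ' -> linear σ' ->
  intertwines g ρ ρ' -> intertwines g σ σ' -> intertwines g τ τ' ->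
  g (ΦV ρ σ τ v) = ΦV ρ' σ' τ' (g v).
Proof. exact: reop_natural. Qed.

Lemma reass_natural V W (g : V -> W) (ρ σ τ : V -> V ⊗ H) (ρ' σ' τ' : W -> W ⊗ H) v :
  linear ρ' -> linear σ' ->
  intertwines g ρ ρ' -> intertwines g σ σ' -> intertwines g τ τ' ->
  g (Φ ρ σ τ v) = Φ ρ' σ' τ' (g v).
Proof. exact: reop_natural. Qed.

(* With e ⊗_A f inserted between y and x, this is the formula for the
   comultiplication, read as an operator. *)
Definition split_op V (y e f x : V -> V ⊗ H) (v : V) : V :=
  Φ (cprod y e) f x (ΦV y e f v).

Lemma split_op_natural V W (g : V -> W) (y e f x : V -> V ⊗ H)
    (y' e' f' x' : W -> W ⊗ H) v :
  linear y' -> linear e' -> linear f' ->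
  intertwines g y y' -> intertwines g e e' -> intertwines g f f' ->
  intertwines g x x' ->
  g (split_op y e f x v) = split_op y' e' f' x' (g v).
Proof.
move=> ly le lf hy he hf hx; rewrite /split_op.
rewrite (reop_natural (ρ' := cprod y' e') (σ' := f') (τ' := x')) //.
- by rewrite (reop_natural (ρ' := y') (σ' := e') (τ' := f')).
- by lin.
- exact: intertwines_cprod.
Qed.

Lemma split_op_linear V (y e f x : V -> V ⊗ H) :
  linear y -> linear e -> linear f -> linear x -> linear (split_op y e f x).
Proof.
move=> ly le lf lx; apply: lin_comp; apply: reop_linear => //; lin.
Qed.

Section Insertion.
Variables (U V : lmodType k) (g : U -> V).
Variables (yU xU : U -> U ⊗ H) (y e f x : V -> V ⊗ H).
Hypotheses (hyU : coaction yU) (hxU : coaction xU) (hyxU : commuting yU xU).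
Hypotheses (hy : coaction y) (he : coaction e) (hf : coaction f) (hx : coaction x).
Hypotheses (hye : commuting y e) (hyf : commuting y f) (hyx : commuting y x).
Hypotheses (hef : commuting e f) (hex : commuting e x) (hfx : commuting f x).
Hypotheses (gy : intertwines g yU y) (gx : intertwines g xU x).
Hypothesis gef : intertwines g (@triv k H U) (cprod e f).

(** This is the equality of the two formulas. In the pentagon for (y, e, f, x) at Φ⁻¹[y,e,f](g u),
    the factor Φ[y,ef,x] fixes g u because ef is trivial there; Φ[y,e,fx] is then inverted. *)
Lemma split_opE u : split_op y e f x (g u) = ΦV y e (cprod f x) (Φ e f x (g u)).
Proof.
rewrite /split_op; have := pentagon (ΦV y e f (g u)) hy he hf hx hye hyf hyx hef hex hfx.
rewrite reopVK // -(reass_natural (g := g) (ρ := yU) (τ := xU) u _ _ gy gef gx); [|lin|coact].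
rewrite reop_mid1 // => ->.
by rewrite reopK //; coact.
Qed.

End Insertion.

Section Balance.
Variables (U0 U V W Q : lmodType k).
Variables (y0 b0 x0 : U0 -> U0 ⊗ H) (y b e f x : V -> V ⊗ H) (y' e' f' x' : W -> W ⊗ H).
Hypotheses (hy0 : coaction y0) (hb0 : coaction b0) (hx0 : coaction x0).
Hypotheses (hyb0 : commuting y0 b0) (hyx0 : commuting y0 x0) (hbx0 : commuting b0 x0).
Hypotheses (hy : coaction y) (hb : coaction b) (he : coaction e) (hf : coaction f).
Hypotheses (hx : coaction x) (hyb : commuting y b) (hye : commuting y e).
Hypotheses (hyf : commuting y f) (hyx : commuting y x) (hbe : commuting b e).
Hypotheses (hbf : commuting b f) (hbx : commuting b x) (hef : commuting e f).
Hypotheses (hex : commuting e x) (hfx : commuting f x).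
Hypotheses (ly' : linear y') (le' : linear e') (lf' : linear f').
Variables (g : U0 -> V) (m1 m2 m3 m4 : V -> W) (F : W -> Q).
Variables (j : U -> W) (n1 n2 : U0 -> U).
Hypotheses (gy : intertwines g y0 y) (gb : intertwines g b0 b).
Hypotheses (gx : intertwines g x0 x) (gef : intertwines g (@triv k H U0) (cprod e f)).
Hypotheses (m1y : intertwines m1 (cprod y b) y') (m1e : intertwines m1 e e').
Hypotheses (m1f : intertwines m1 f f') (m1x : intertwines m1 x x').
Hypotheses (m2y : intertwines m2 y y') (m2e : intertwines m2 (cprod b e) e').
Hypotheses (m2f : intertwines m2 f f') (m2x : intertwines m2 x x').
Hypotheses (m3y : intertwines m3 y y') (m3e : intertwines m3 e e').
Hypotheses (m3f : intertwines m3 (cprod f b) f') (m3x : intertwines m3 x x').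
Hypotheses (m4y : intertwines m4 y y') (m4e : intertwines m4 e e').
Hypotheses (m4f : intertwines m4 f f') (m4x : intertwines m4 (cprod b x) x').
Hypothesis F12 : forall v, F (m1 v) = F (m2 (Φ y b e v)).
Hypothesis F34 : forall v, F (m3 v) = F (m4 (Φ f b x v)).
(* The two actions of b on e ⊗_A f agree, as eta is a bimodule map. *)
Hypothesis m23 : forall u, m2 (ΦV b e f (g u)) = m3 (Φ e f b (g u)).
Hypothesis m1g : forall u, m1 (g u) = j (n1 u).
Hypothesis m4g : forall u, m4 (g u) = j (n2 u).

(** In the application U0 = Σ' ⊗ B ⊗ Σ, V = Σ' ⊗ B ⊗ N ⊗ Σ, W = Σ' ⊗ N ⊗ Σ, and [g] inserts E. The
    element b travels from y to e by a relation over B ([F12]), across E by [m23], and from f to x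
    by another relation over B ([F34]). At each stop it is fused with the leg it has reached, and
    the operators must again form a [split_op] of the new legs. *)
Lemma split_op_balanced u :
  F (split_op y' e' f' x' (j (n1 u))) = F (split_op y' e' f' x' (j (n2 (Φ y0 b0 x0 u)))).
Proof.
have ly := coaction_linear hy; have lb := coaction_linear hb.
have le := coaction_linear he; have lf := coaction_linear hf.
have lx := coaction_linear hx.
(* Here b acts on y, so the first leg is yb; [F12] hands b over to e and creates Φ[y,b,e] on the
   outside. *)
rewrite -m1g -(split_op_natural _ ly' le' lf' m1y m1e m1f m1x) F12 {1}/split_op.
(* Φ[y,b,e] moves inside past the outer reassociator, whose first leg (yb)e becomes y(be). *)
rewrite (@reass_natural _ _ (Φ y b e) _ _ _ (cprod y (cprod b e)) f x); first last.
- by apply: reop_intertwines_commuting => //; coact.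
- by apply: reop_intertwines_commuting => //; coact.
- by apply: reop_assoc => //; coact.
- by [].
- by lin.
(* Pentagon for (y, b, e, f): its right side is Φ[y,b,ef](g u), which is g u because ef is trivial
   on the image of [g] and φ(-, -, 1) is normalized. *)
have -> : Φ y b e (ΦV (cprod y b) e f (g u)) = ΦV y (cprod b e) f (ΦV b e f (g u)).
  have := pentagon (ΦV (cprod y b) e f (g u)) hy hb he hf hyb hye hyf hbe hbf hef.
  rewrite reopVK //; try coact.
  rewrite -(reass_natural u ly lb gy gb gef) reop_right1 // => h.
  by rewrite -[X in _ = ΦV _ _ _ (ΦV _ _ _ X)]h !reopK //; coact.
(* This is a [split_op] with b fused to e. The remaining Φ⁻¹[b,e,f] is the one in the left action of
   B on N, so [m23] can pass b to the other side of E. *)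
rewrite -/(split_op y (cprod b e) f x _).
rewrite (split_op_natural _ ly' le' lf' m2y m2e m2f m2x) m23.
rewrite -(split_op_natural _ ly' le' lf' m3y m3e m3f m3x) {1}/split_op F34.
(* Pentagon for (y, e, f, b), in which Φ[y,ef,b] fixes g u. *)
have -> : ΦV y e (cprod f b) (Φ e f b (g u)) = Φ (cprod y e) f b (ΦV y e f (g u)).
  have := pentagon (ΦV y e f (g u)) hy he hf hb hye hyf hyb hef _ _.
  rewrite reopVK // -(reass_natural u ly _ gy gef gb); last by lin.
  rewrite reop_mid1 // => -> //; try coact.
  by rewrite reopK //; coact.
(* Pentagon for (ye, f, b, x): the three factors that b has accumulated collapse to two, and the
   outer one has b fused to x. *)
rewrite pentagon //; try coact.
(* Passing Φ⁻¹[y,e,f] turns the first leg into y(ef), which is y on the image of [g]. What comes out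
   is the Φ of the relation that is to be respected. *)
have -> : Φ (cprod (cprod y e) f) b x (ΦV y e f (g u)) = ΦV y e f (g (Φ y0 b0 x0 u)).
  rewrite -(@reass_natural _ _ (ΦV y e f) (cprod y (cprod e f)) b x); first last.
  - by apply: reop_intertwines_commuting => //; coact.
  - by apply: reop_intertwines_commuting => //; coact.
  - by apply: reopV_assoc => //; coact.
  - by [].
  - by lin.
  congr ΦV; rewrite (reass_natural (ρ' := cprod y (cprod e f)) (σ' := b) (τ' := x)) //.
    by lin.
  by apply: intertwines_cprod_triv => //; coact.
by rewrite -/(split_op y e f (cprod b x) _) (split_op_natural _ ly' le' lf' m4y m4e m4f m4x) m4g.
Qed.
End Balance.

Section Coassociativity.
Variables (U W V : lmodType k).
Variables (yU xU : U -> U ⊗ H) (yW eW fW xW : W -> W ⊗ H) (y p q e f x : V -> V ⊗ H).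
Hypotheses (hyW : coaction yW) (heW : coaction eW) (hfW : coaction fW) (hxW : coaction xW).
Hypotheses (hyeW : commuting yW eW) (hyfW : commuting yW fW) (hyxW : commuting yW xW).
Hypotheses (hefW : commuting eW fW) (hexW : commuting eW xW) (hfxW : commuting fW xW).
Hypotheses (hy : coaction y) (hp : coaction p) (hq : coaction q) (he : coaction e).
Hypotheses (hf : coaction f) (hx : coaction x).
Hypotheses (hyp : commuting y p) (hyq : commuting y q) (hye : commuting y e).
Hypotheses (hyf : commuting y f) (hyx : commuting y x) (hpq : commuting p q).
Hypotheses (hpe : commuting p e) (hpf : commuting p f) (hpx : commuting p x).
Hypotheses (hqe : commuting q e) (hqf : commuting q f) (hqx : commuting q x).
Hypotheses (hef : commuting e f) (hex : commuting e x) (hfx : commuting f x).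
Variables (i1 i2 : W -> V) (j : U -> W).
Hypotheses (i1y : intertwines i1 yW y) (i1e : intertwines i1 eW e).
Hypotheses (i1f : intertwines i1 fW f) (i1x : intertwines i1 xW x).
Hypothesis i1pq : intertwines i1 (@triv k H W) (cprod p q).
Hypotheses (i2y : intertwines i2 yW y) (i2e : intertwines i2 eW p).
Hypotheses (i2f : intertwines i2 fW q) (i2x : intertwines i2 xW x).
Hypothesis i2ef : intertwines i2 (@triv k H W) (cprod e f).
Hypothesis i12 : forall u, i1 (j u) = i2 (j u).

(** In the application V = Σ' ⊗ N ⊗ N ⊗ Σ with legs y, p, q, e, f, x; [i1] inserts E in the place
    with legs p, q and [i2] in the place with legs e, f, while [j] is the first insertion. The outer
    Φ on the left is the associativity constraint of C, C, C. *)
Lemma split_op_coassoc u :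
  Φ (cprod y p) (cprod q e) (cprod f x)
    (split_op y p q e (i1 (split_op yW eW fW xW (j u)))) =
  split_op q e f x (i2 (split_op yW eW fW xW (j u))).
Proof.
have ly := coaction_linear hy; have lp := coaction_linear hp.
have lq := coaction_linear hq; have le := coaction_linear he.
have lf := coaction_linear hf; have lx := coaction_linear hx.
have lyW := coaction_linear hyW; have leW := coaction_linear heW.
have lfW := coaction_linear hfW; have lxW := coaction_linear hxW.
(* The inner splitting is pulled out of [i1] with y replaced by y(pq), since pq is trivial on its
   image. This bracketing is the one that Φ⁻¹[y,p,q] carries to (yp)q. *)
rewrite (split_op_natural (y' := cprod y (cprod p q)) (e' := e) (f' := f) (x' := x) (g := i1)) //; first last.
- exact: intertwines_cprod_triv.
- by lin.
rewrite i12 {1}/split_op.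
rewrite (split_op_natural (y' := cprod (cprod y p) q) (e' := e) (f' := f) (x' := x)
   (g := ΦV y p q)) //; first last.
- by apply: reop_intertwines_commuting => //; coact.
- by apply: reop_intertwines_commuting => //; coact.
- by apply: reop_intertwines_commuting => //; coact.
- by apply: reopV_assoc.
- by lin.
have hu : coaction (cprod y p) by coact.
have huq : commuting (cprod y p) q by coact.
have hue : commuting (cprod y p) e by coact.
have huf : commuting (cprod y p) f by coact.
have hux : commuting (cprod y p) x by coact.
set K := ΦV yW eW fW (j u).
(* Seen through [i2], the legs p, q are the first copy of E, so Φ⁻¹[y,p,q] is the Φ⁻¹ of the other
   side's inner splitting. *)
have -> : ΦV y p q (i2 (j u)) = i2 K.
  by rewrite (reassV_natural (g := i2) (ρ' := y) (σ' := p) (τ' := q)).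
have i2u : intertwines i2 (cprod yW eW) (cprod y p) by apply: intertwines_cprod.
have lu := coaction_linear hu.
rewrite {1}/split_op.
(* Write u for the product yp. Moving Φ[u,q,e] inside turns (uq)e into u(qe), which prepares the
   pentagon for (u, qe, f, x). *)
rewrite (@reass_natural _ _ (Φ (cprod y p) q e) _ _ _ (cprod (cprod y p) (cprod q e)) f x); first last.
- by apply: reop_intertwines_commuting.
- by apply: reop_intertwines_commuting.
- by apply: reop_assoc.
- by [].
- by lin.
rewrite -pentagon //; try coact.
(* Pentagon for (yp, q, e, f): its right side is Φ[yp,q,ef](i2 K), which is i2 K because ef is
   trivial on the image of [i2]. *)
have -> : Φ (cprod y p) (cprod q e) f (Φ (cprod y p) q e
    (ΦV (cprod (cprod y p) q) e f (i2 K))) = ΦV q e f (i2 K).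
  have := pentagon (ΦV (cprod (cprod y p) q) e f (i2 K)) hu hq he hf huq hue huf hqe hqf hef.
  rewrite reopVK //; try coact.
  rewrite -(reass_natural (g := i2) K lu lq i2u i2f i2ef) reop_right1 //; try coact.
  move=> h; by rewrite -[X in _ = ΦV _ _ _ X]h reopK //; coact.
(* Past Φ⁻¹[q,e,f] the middle leg (qe)f becomes q(ef), which is q on the image of [i2]; the operator
   then completes the splitting inside [i2]. *)
rewrite -(@reass_natural _ _ (ΦV q e f) (cprod y p) (cprod q (cprod e f)) x); first last.
- by apply: reop_intertwines_commuting => //; coact.
- by apply: reopV_assoc.
- by apply: reop_intertwines_commuting => //; coact.
- by lin.
- by [].
rewrite -(reass_natural (g := i2) (ρ := cprod yW eW) (σ := fW) (τ := xW)) //; first last.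
- exact: intertwines_cprod_triv.
- by lin.
Qed.

End Coassociativity.

End Operators.

(** * The comatrix coring *)

Section TensorMaps.
Variables (k : comPzRingType) (H : dual_quasi_bialgebra k).
Implicit Types (M S P Q : lmodType k).

Definition tmapr M P Q (g : P -> Q) (t : M ⊗ P) : M ⊗ Q :=
  \sw_(m, p <- t) m ⊗ g p.

Lemma tmapr_linear M P Q (g : P -> Q) : linear g -> linear (@tmapr M P Q g).
Proof. by move=> lg; rewrite /tmapr; lin. Qed.
#[local] Hint Extern 3 (lin_goal (GRing.linear_for _ (tmapr _))) =>
  apply: LinGoal; apply: tmapr_linear; lin : lin.

Lemma tmapr_pure M P Q (g : P -> Q) (m : M) p : linear g -> tmapr g (m ⊗ p) = m ⊗ g p.
Proof. by move=> lg; rewrite /tmapr sw_pure //; lin. Qed.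

Lemma tmapr_intertwines_r M P Q (g : P -> Q) (σ : P -> P ⊗ H) (σ' : Q -> Q ⊗ H) :
  linear σ -> linear σ' ->
  intertwines g σ σ' -> intertwines (@tmapr M P Q g) (legr σ) (legr σ').
Proof.
move=> lσ lσ' hg; split; first by lin.
apply: tens_ext => [||m p]; [lin|lin|].
rewrite tmapr_pure; last by lin.
rewrite legr_pure // (sw_intertwines hg); last by lin.
rewrite sw_legr //; last by lin.
by apply: eq_sw => *; rewrite tmapr_pure //; lin.
Qed.

Lemma tmapr_intertwines_l M P Q (g : P -> Q) (ρ : M -> M ⊗ H) :
  linear ρ -> linear g -> intertwines (@tmapr M P Q g) (legl ρ) (legl ρ).
Proof.
move=> lρ lg; split; first by lin.
apply: tens_ext => [||m p]; [lin|lin|].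
rewrite tmapr_pure // legl_pure // sw_legl //; last by lin.
by apply: eq_sw => *; rewrite tmapr_pure //; lin.
Qed.

Lemma legr_triv M P : legr (@triv k H P) = @triv k H (M ⊗ P)%type.
Proof.
have l := @triv_linear k H.
apply: funext; apply: tens_ext => [||m p]; [lin|lin|].
by rewrite legr_pure // sw_triv //; lin.
Qed.

Lemma cprod_legr M P (σ τ : P -> P ⊗ H) : linear σ -> linear τ ->
  cprod (legr σ) (legr τ) = legr (cprod σ τ) :> (M ⊗ P -> _).
Proof.
move=> lσ lτ; apply: funext; apply: tens_ext => [||m p]; [lin|lin|].
rewrite cprod_sw sw_legr //; last by lin.
rewrite legr_pure; last by lin.
rewrite sw_cprod; last by lin.
by apply: eq_sw => *; rewrite sw_legr //; lin.
Qed.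

Lemma cprod_legl M P (ρ τ : M -> M ⊗ H) : linear ρ -> linear τ ->
  cprod (legl ρ) (legl τ) = legl (cprod ρ τ) :> (M ⊗ P -> _).
Proof.
move=> lσ lτ; apply: funext; apply: tens_ext => [||m p]; [lin|lin|].
rewrite cprod_sw sw_legl //; last by lin.
rewrite legl_pure; last by lin.
rewrite sw_cprod; last by lin.
by apply: eq_sw => *; rewrite sw_legl //; lin.
Qed.

Lemma tmapr_intertwines_triv M P Q (g : P -> Q) (σ τ : Q -> Q ⊗ H) :
  linear σ -> linear τ -> intertwines g (@triv k H P) (cprod σ τ) ->
  intertwines (@tmapr M P Q g) (@triv k H _) (cprod (legr σ) (legr τ)).
Proof.
move=> lσ lτ hg; rewrite cprod_legr // -legr_triv.
by apply: tmapr_intertwines_r => //; [exact: triv_linear|lin].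
Qed.

Definition tmapl M P Q (g : M -> Q) (t : M ⊗ P) : Q ⊗ P :=
  \sw_(m, p <- t) g m ⊗ p.

Lemma tmapl_linear M P Q (g : M -> Q) : linear g -> linear (@tmapl M P Q g).
Proof. by move=> lg; rewrite /tmapl; lin. Qed.
#[local] Hint Extern 3 (lin_goal (GRing.linear_for _ (tmapl _))) =>
  apply: LinGoal; apply: tmapl_linear; lin : lin.

Lemma tmapl_pure M P Q (g : M -> Q) m (p : P) : linear g -> tmapl g (m ⊗ p) = g m ⊗ p.
Proof. by move=> lg; rewrite /tmapl sw_pure //; lin. Qed.

Lemma tmapl_intertwines_l M P Q (g : M -> Q) (ρ : M -> M ⊗ H) (ρ' : Q -> Q ⊗ H) :
  linear ρ -> linear ρ' ->
  intertwines g ρ ρ' -> intertwines (@tmapl M P Q g) (legl ρ) (legl ρ').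
Proof.
move=> lρ lρ' hg; split; first by lin.
apply: tens_ext => [||m p]; [lin|lin|].
rewrite tmapl_pure; last by lin.
rewrite legl_pure // (sw_intertwines hg); last by lin.
rewrite sw_legl //; last by lin.
by apply: eq_sw => *; rewrite tmapl_pure //; lin.
Qed.

Lemma tmapl_intertwines_r M P Q (g : M -> Q) (σ : P -> P ⊗ H) :
  linear σ -> linear g -> intertwines (@tmapl M P Q g) (legr σ) (legr σ).
Proof.
move=> lσ lg; split; first by lin.
apply: tens_ext => [||m p]; [lin|lin|].
rewrite tmapl_pure // legr_pure // sw_legr //; last by lin.
by apply: eq_sw => *; rewrite tmapl_pure //; lin.
Qed.

Section Fuse.
Variables (M S M' P : lmodType k) (f : M -> S -> M').
Hypothesis bf : bilin f.
Variables (ρ : M -> M ⊗ H) (σ : S -> S ⊗ H) (τ : P -> P ⊗ H) (ρ' : M' -> M' ⊗ H).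
Hypotheses (lρ : linear ρ) (lσ : linear σ) (lτ : linear τ) (lρ' : linear ρ').

Definition fuse (t : M ⊗ S ⊗ P) : M' ⊗ P :=
  \sw_(m, r <- t) \sw_(s, p <- r) f m s ⊗ p.

Lemma fuse_linear : linear fuse.
Proof. by rewrite /fuse; lin. Qed.

Lemma fuse_pure m s p : fuse (m ⊗ s ⊗ p) = f m s ⊗ p.
Proof. by rewrite /fuse sw_pure ?sw_pure //; lin. Qed.

Let lf := fuse_linear.

Lemma fuse_intertwines_prod :
  (forall m s, ρ' (f m s) = \sw_(m0, a <- ρ m) \sw_(s0, b <- σ s) f m0 s0 ⊗ (a ∙ b)) ->
  intertwines fuse (cprod (legl ρ) (legr (legl σ))) (legl ρ').
Proof.
move=> h; split=> //; apply: tens3_ext => [||m s p]; [lin|lin|].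
rewrite fuse_pure legl_pure // h sw_sw; last by lin.
rewrite sw_cprod; last by lin.
rewrite sw_legr; [|lin..].
rewrite sw_legl; [|lin..].
transitivity (\sw_(m0, a <- ρ m) \sw_(s0, b <- σ s) (f m0 s0 ⊗ p) ⊗ (a ∙ b)).
  apply: eq_sw => m0 a; rewrite sw_sw; last by lin.
  by apply: eq_sw => s0 b; rewrite sw_pure //; lin.
rewrite exch_sw; apply: eq_sw => s0 b; rewrite sw_legl; [|lin..].
by apply: eq_sw => *; rewrite fuse_pure.
Qed.

(** For the right action of B on N: the factor B stands before N in the tensor product, but its leg
    comes last in the product. *)
Lemma fuse_intertwines_prod_op :
  (forall m s, ρ' (f m s) = \sw_(s0, b <- σ s) \sw_(m0, a <- ρ m) f m0 s0 ⊗ (b ∙ a)) ->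
  intertwines fuse (cprod (legr (legl σ)) (legl ρ)) (legl ρ').
Proof.
move=> h; split=> //; apply: tens3_ext => [||m s p]; [lin|lin|].
rewrite fuse_pure legl_pure // h sw_sw; last by lin.
rewrite sw_cprod; last by lin.
rewrite sw_legl; [|lin..].
transitivity (\sw_(s0, b <- σ s) \sw_(m0, a <- ρ m) (f m0 s0 ⊗ p) ⊗ (b ∙ a)).
  apply: eq_sw => m0 a; rewrite sw_sw; last by lin.
  by apply: eq_sw => s0 b; rewrite sw_pure //; lin.
rewrite exch_sw; apply: eq_sw => s0 b; rewrite sw_legr; [|lin..].
rewrite sw_legl; [|lin..].
by apply: eq_sw => *; rewrite fuse_pure.
Qed.

Lemma fuse_intertwines_mid :
  (forall m s, ρ' (f m s) = \sw_(s0, b <- σ s) f m s0 ⊗ b) ->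
  intertwines fuse (legr (legl σ)) (legl ρ').
Proof.
move=> h; split=> //; apply: tens3_ext => [||m s p]; [lin|lin|].
rewrite fuse_pure legl_pure // h sw_sw; last by lin.
rewrite sw_legr; [|lin..].
rewrite sw_legl; [|lin..].
by apply: eq_sw => s0 b; rewrite sw_pure ?fuse_pure //; lin.
Qed.

Lemma fuse_intertwines_r : intertwines fuse (legr (legr τ)) (legr τ).
Proof.
split=> //; apply: tens3_ext => [||m s p]; [lin|lin|].
rewrite fuse_pure legr_pure // sw_legr; [|lin..].
rewrite sw_legr; [|lin..].
by apply: eq_sw => s0 b; rewrite fuse_pure //; lin.
Qed.

End Fuse.

Section FuseOuter.
Variables (M S P P' : lmodType k) (f : M -> P -> P').
Hypothesis bf : bilin f.
Variables (ρ : M -> M ⊗ H) (σ : S -> S ⊗ H) (τ : P -> P ⊗ H) (τ' : P' -> P' ⊗ H).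
Hypotheses (lρ : linear ρ) (lσ : linear σ) (lτ : linear τ) (lτ' : linear τ').

(** The first factor acts on the third across the second, as b acts on x across e ⊗_A f. *)
Definition fuse_outer (t : M ⊗ S ⊗ P) : S ⊗ P' :=
  \sw_(m, r <- t) \sw_(s, p <- r) s ⊗ f m p.

Lemma fuse_outer_linear : linear fuse_outer.
Proof. by rewrite /fuse_outer; lin. Qed.

Lemma fuse_outer_pure m s p : fuse_outer (m ⊗ s ⊗ p) = s ⊗ f m p.
Proof. by rewrite /fuse_outer sw_pure ?sw_pure //; lin. Qed.

Let lf := fuse_outer_linear.

Lemma fuse_outer_intertwines_prod :
  (forall m p, τ' (f m p) = \sw_(m0, a <- ρ m) \sw_(p0, b <- τ p) f m0 p0 ⊗ (a ∙ b)) ->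
  intertwines fuse_outer (cprod (legl ρ) (legr (legr τ))) (legr τ').
Proof.
move=> h; split=> //; apply: tens3_ext => [||m s p]; [lin|lin|].
rewrite fuse_outer_pure legr_pure // h sw_sw; last by lin.
rewrite sw_cprod; last by lin.
rewrite sw_legr; [|lin..].
rewrite sw_legr; [|lin..].
transitivity (\sw_(m0, a <- ρ m) \sw_(p0, b <- τ p) (s ⊗ f m0 p0) ⊗ (a ∙ b)).
  apply: eq_sw => m0 a; rewrite sw_sw; last by lin.
  by apply: eq_sw => s0 b; rewrite sw_pure //; lin.
rewrite exch_sw; apply: eq_sw => s0 b; rewrite sw_legl; [|lin..].
by apply: eq_sw => *; rewrite fuse_outer_pure.
Qed.

Lemma fuse_outer_intertwines_mid :
  intertwines fuse_outer (legr (legl σ)) (legl σ).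
Proof.
split=> //; apply: tens3_ext => [||m s p]; [lin|lin|].
rewrite fuse_outer_pure legl_pure // sw_legr; [|lin..].
rewrite sw_legl; [|lin..].
by apply: eq_sw => s0 b; rewrite fuse_outer_pure //; lin.
Qed.

End FuseOuter.

End TensorMaps.

#[global] Hint Extern 3 (lin_goal (GRing.linear_for _ (tmapr _))) =>
  apply: LinGoal; apply: tmapr_linear; lin : lin.
#[global] Hint Extern 3 (lin_goal (GRing.linear_for _ (fuse _))) =>
  apply: LinGoal; apply: fuse_linear; lin : lin.
#[global] Hint Extern 3 (lin_goal (GRing.linear_for _ (fuse_outer _))) =>
  apply: LinGoal; apply: fuse_outer_linear; lin : lin.
#[global] Hint Extern 3 (lin_goal (GRing.linear_for _ (tmapl _))) =>
  apply: LinGoal; apply: tmapl_linear; lin : lin.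

Section MiddleComposite.
Variables (k : comPzRingType) (H : dual_quasi_bialgebra k).
Variables (R S T : alg_data H) (M : bimod_data R S) (N : bimod_data S T).
Implicit Types (P U V : lmodType k).

Lemma blift_param P U (f : U -> M -> N -> P) q :
  (forall m n, linear (fun u => f u m n)) -> linear (fun u => blift (f u) q).
Proof. by move=> lf; rewrite /blift; lin. Qed.

Lemma bcomp_middle_ext P U V (f g : U ⊗ (bcomp M N) ⊗ V -> P) : linear f -> linear g ->
  (forall u m n v, f (u ⊗ (btens m n : bcomp M N) ⊗ v) =
                   g (u ⊗ (btens m n : bcomp M N) ⊗ v)) -> forall t, f t = g t.
Proof.
move=> lf lg fg; apply: tens3_ext => // u q v; move: q.
by apply: bcomp_ext => [||m n]; [lin|lin|].
Qed.

End MiddleComposite.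

#[global] Hint Extern 3 (lin_goal (GRing.linear_for _ (fun u => blift _ _))) =>
  apply: LinGoal; apply: blift_param => ? ?; lin : lin.

(** * The comultiplication on representatives and its balance over B *)

Section Comatrix.
Variables (k : comPzRingType) (H : dual_quasi_bialgebra k).
Variables (A : kalgebra k) (B : alg_data H).
Local Notation A' := (triv_alg H A).
Variables (Sg : bimod_data B A') (Sg' : bimod_data A' B).
Hypotheses (hB : comodule B) (hS : bimodule Sg) (hS' : bimodule Sg').
Local Notation N := (bcomp Sg Sg').
Local Notation C := (bcomp Sg' Sg).
Local Notation W := (tens Sg' (tens N Sg)).
Local Notation coactS := (@coact k H Sg).
Local Notation coactS' := (@coact k H Sg').
Local Notation coactB := (@coact k H B).
Local Notation n1 := (@bleg1 k H A B B Sg Sg').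
Local Notation n2 := (@bleg2 k H A B B Sg Sg').

Let lB : linear coactB. Proof. exact: (coaction_linear (hB : coaction coactB)). Qed.
Let hB' : coaction coactB. Proof. exact: hB. Qed.
Let hn1 : coaction n1. Proof. exact: bleg1_coaction. Qed.
Let hn2 : coaction n2. Proof. exact: bleg2_coaction. Qed.
Let hn12 : commuting n1 n2. Proof. exact: bleg12_commuting. Qed.
Let lN : linear (@coact k H N).
Proof. exact: bcomp_coact_linear hS hS' (triv_comodule H A). Qed.
Let hC : bimodule C. Proof. exact: bimodule_bcompA. Qed.

(* The four coactions of y ⊗ (e ⊗_A f) ⊗ x in Σ' ⊗ (Σ ⊗_A Σ') ⊗ Σ. *)
Definition wy : W -> W ⊗ H := legl coactS'.
Definition we : W -> W ⊗ H := legr (legl n1).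
Definition wf : W -> W ⊗ H := legr (legl n2).
Definition wx : W -> W ⊗ H := legr (legr coactS).

(** The regrouping of factors in the comultiplication; the relations over B are imposed only by this
    map. *)
Definition merge (t : W) : bcomp C C :=
  \sw_(y, r <- t) \sw_(n, x <- r)
    blift (fun (e : Sg) (f : Sg') =>
      btens (btens y e : C) (btens f x : C) : bcomp C C) n.

(** The relation over A between e and f becomes the one between the two factors of C ⊗_A C. *)
Lemma merge_balanced (y : Sg') (x : Sg) : balanced (fun (e : Sg) (f : Sg') =>
  btens (btens y e : C) (btens f x : C) : bcomp C C).
Proof.
apply: balancedA => // [|e a f]; first by lin.
by rewrite -(ractA_btens hS' hS hB) btens_ractA // (lactA_btens hS' hS hB).
Qed.

Let bmerge : bilin (fun (y : Sg') (r : N ⊗ Sg) => \sw_(n, x <- r)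
    blift (fun (e : Sg) (f : Sg') =>
      btens (btens y e : C) (btens f x : C) : bcomp C C) n).
Proof.
have l y x := blift_linear (merge_balanced y x).
apply: bilinP => [r|y]; first by lin.
by apply: lin_swl; [lin|apply: bilinP => [x|n]; lin].
Qed.

Lemma merge_linear : linear merge.
Proof. by rewrite /merge; apply: lin_swl; [lin|exact: bmerge]. Qed.

Lemma merge_pure y e f x : merge (y ⊗ (btens e f : N) ⊗ x) =
  btens (btens y e : C) (btens f x : C).
Proof.
have l y x := blift_linear (merge_balanced y x).
rewrite /merge sw_pure // sw_pure; last by apply: bilinP => [x0|n]; lin.
exact: (blift_btens _ _ (merge_balanced y x)).
Qed.

Section Insert.
Variable E : N.
Hypothesis hE : coact E = E ⊗ dqb_one H.
Variable P : lmodType k.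

Definition insE (p : P) : N ⊗ P := E ⊗ p.

Lemma insE_linear : linear insE.
Proof. by rewrite /insE; lin. Qed.

Lemma insE_intertwines (σ : P -> P ⊗ H) : linear σ -> intertwines insE σ (legr σ).
Proof.
by move=> lσ; split=> [|p]; [exact: insE_linear | rewrite /insE legr_pure].
Qed.

(** By [cprod_bleg] the product of the two legs of N is its coaction, for which E is coinvariant. *)
Lemma insE_triv : intertwines insE (@triv k H P) (cprod (legl n1) (legl n2)).
Proof.
have l1 := coaction_linear hn1; have l2 := coaction_linear hn2.
split=> [|p]; first exact: insE_linear.
rewrite cprod_legl // cprod_bleg // /insE legl_pure //.
rewrite hE sw_pure; last by lin.
by rewrite sw_triv //; lin.
Qed.

End Insert.

Lemma lactN_balanced (b : B) : balanced (fun (e : Sg) (f : Sg') => btens (lact b e) f : N).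
Proof.
apply: balancedA => // [|e a f]; first by lin.
by rewrite -lact_ractA // btens_ractA.
Qed.

Lemma ractN_balanced (b : B) : balanced (fun (e : Sg) (f : Sg') => btens e (ract f b) : N).
Proof.
apply: balancedA => // [|e a f]; first by lin.
by rewrite ract_lactA // btens_ractA.
Qed.

(** [lactN] and [ractN] act on one factor, without φ. The bimodule structure of N is obtained by
    composing them with Φ⁻¹[b,e,f] and Φ[e,f,b] respectively, as [m2_act] and [m3_act] show. *)
Definition lactN (b : B) : N -> N := blift (fun (e : Sg) (f : Sg') => btens (lact b e) f : N).
Definition ractN (b : B) : N -> N := blift (fun (e : Sg) (f : Sg') => btens e (ract f b) : N).

Lemma lactN_btens b e f : lactN b (btens e f) = btens (lact b e) f.
Proof. exact: (blift_btens _ _ (lactN_balanced b)). Qed.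

Lemma ractN_btens b e f : ractN b (btens e f) = btens e (ract f b).
Proof. exact: (blift_btens _ _ (ractN_balanced b)). Qed.

Lemma lactN_bilin : bilin lactN.
Proof.
apply: bilinP => [q|b]; last exact: blift_linear (lactN_balanced b).
by rewrite /lactN; lin.
Qed.

Lemma ractN_bilin : bilin ractN.
Proof.
apply: bilinP => [q|b]; last exact: blift_linear (ractN_balanced b).
by rewrite /ractN; lin.
Qed.

Let bL := lactN_bilin.
Let bR := ractN_bilin.
Let ln1 := coaction_linear hn1.
Let ln2 := coaction_linear hn2.

Lemma sw_lact (P : lmodType k) (F : Sg -> H -> P) (b : B) (e : Sg) : bilin F ->
  sweedler (coact (lact b e)) F =
  \sw_(b0, b1 <- coact b) \sw_(e0, e1 <- coact e) F (lact b0 e0) (b1 ∙ e1).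
Proof.
move=> bF; have [_ [cl _] _ _] := hS.
by rewrite (sw_colinear2 _ _ _ _ cl) //; lin.
Qed.

Lemma sw_ract (P : lmodType k) (F : Sg' -> H -> P) (f : Sg') (b : B) : bilin F ->
  sweedler (coact (ract f b)) F =
  \sw_(f0, f1 <- coact f) \sw_(b0, b1 <- coact b) F (ract f0 b0) (f1 ∙ b1).
Proof.
move=> bF; have [_ [_ cr] _ _] := hS'.
by rewrite (sw_colinear2 _ _ _ _ cr) //; lin.
Qed.

Lemma bleg1_lactN b n : n1 (lactN b n) =
  \sw_(b0, b1 <- coact b) \sw_(n0, h <- n1 n) lactN b0 n0 ⊗ (b1 ∙ h).
Proof.
move: n; apply: bcomp_ext => [||e f]; [lin|lin|].
rewrite lactN_btens bleg1_btens // sw_lact; last by lin.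
apply: eq_sw => b0 b1; rewrite sw_bleg1 //; last by lin.
by apply: eq_sw => *; rewrite lactN_btens.
Qed.

Lemma bleg2_lactN b n : n2 (lactN b n) = \sw_(n0, h <- n2 n) lactN b n0 ⊗ h.
Proof.
move: n; apply: bcomp_ext => [||e f]; [lin|lin|].
rewrite lactN_btens bleg2_btens // sw_bleg2 //; last by lin.
by apply: eq_sw => *; rewrite lactN_btens.
Qed.

Lemma bleg2_ractN b n : n2 (ractN b n) =
  \sw_(n0, h <- n2 n) \sw_(b0, b1 <- coact b) ractN b0 n0 ⊗ (h ∙ b1).
Proof.
move: n; apply: bcomp_ext => [||e f]; [lin|lin|].
rewrite ractN_btens bleg2_btens // sw_ract; last by lin.
rewrite sw_bleg2 //; last by lin.
by apply: eq_sw => *; apply: eq_sw => *; rewrite ractN_btens.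
Qed.

Lemma bleg1_ractN b n : n1 (ractN b n) = \sw_(n0, h <- n1 n) ractN b n0 ⊗ h.
Proof.
move: n; apply: bcomp_ext => [||e f]; [lin|lin|].
rewrite ractN_btens bleg1_btens // sw_bleg1 //; last by lin.
by apply: eq_sw => *; rewrite ractN_btens.
Qed.

Lemma lact_bcomp_balanced (b : B) : balanced (fun (e : Sg) (f : Sg') =>
  \sw_(b0, b1 <- coact b) \sw_(e0, e1 <- coact e) \sw_(f0, f1 <- coact f)
    @reassV k H b1 e1 f1 *: (btens (lact b0 e0) f0 : N)).
Proof.
apply: balancedA => // [|e a f]; first by lin.
apply: eq_sw => b0 b1; rewrite coact_ractA //; last by lin.
apply: eq_sw => e0 e1; rewrite coact_lactA //; last by lin.
by apply: eq_sw => f0 f1; rewrite -lact_ractA // btens_ractA.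
Qed.

Lemma ract_bcomp_balanced (b : B) : balanced (fun (e : Sg) (f : Sg') =>
  \sw_(e0, e1 <- coact e) \sw_(f0, f1 <- coact f) \sw_(b0, b1 <- coact b)
    @reass k H e1 f1 b1 *: (btens e0 (ract f0 b0) : N)).
Proof.
apply: balancedA => // [|e a f]; first by lin.
rewrite coact_ractA //; last by lin.
apply: eq_sw => e0 e1; rewrite coact_lactA //; last by lin.
apply: eq_sw => f0 f1; apply: eq_sw => b0 b1.
by rewrite ract_lactA // btens_ractA.
Qed.

Lemma lact_bcomp_linear (b : B) : linear (@lact k H B B N b).
Proof. exact: blift_linear (lact_bcomp_balanced b). Qed.

Lemma ract_bcomp_linear (b : B) : linear (fun n => @ract k H B B N n b).
Proof. exact: blift_linear (ract_bcomp_balanced b). Qed.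

Lemma lact_bcomp_btens (b : B) e f : lact b (btens e f : N) =
  \sw_(b0, b1 <- coact b) \sw_(e0, e1 <- coact e) \sw_(f0, f1 <- coact f)
    @reassV k H b1 e1 f1 *: (btens (lact b0 e0) f0 : N).
Proof. exact: (blift_btens _ _ (lact_bcomp_balanced b)). Qed.

Lemma ract_bcomp_btens (b : B) e f : ract (btens e f : N) b =
  \sw_(e0, e1 <- coact e) \sw_(f0, f1 <- coact f) \sw_(b0, b1 <- coact b)
    @reass k H e1 f1 b1 *: (btens e0 (ract f0 b0) : N).
Proof. exact: (blift_btens _ _ (ract_bcomp_balanced b)). Qed.

Section Comultiplication.
Variable E : N.
Hypothesis hE : coact E = E ⊗ dqb_one H.
Hypothesis hE' : forall b : B, lact b E = ract E b.

Definition insert : Sg' ⊗ Sg -> W := tmapr (@insE E Sg).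

Definition split_coact (t : Sg' ⊗ Sg) : bcomp C C :=
  merge (split_op wy we wf wx (insert t)).

#[local] Hint Extern 2 (lin_goal (GRing.linear_for _ (insE _))) =>
  apply: LinGoal; exact: insE_linear : lin.
#[local] Hint Extern 2 (lin_goal (GRing.linear_for _ (@insE _ _))) =>
  apply: LinGoal; exact: insE_linear : lin.

Lemma insert_y : intertwines insert (legl coactS') wy.
Proof. by apply: tmapr_intertwines_l; lin. Qed.

Lemma insert_x : intertwines insert (legr coactS) wx.
Proof. by apply: tmapr_intertwines_r; [lin|lin|apply: insE_intertwines; lin]. Qed.

Lemma insert_ef : intertwines insert (@triv k H _) (cprod we wf).
Proof. by apply: tmapr_intertwines_triv; [lin|lin|exact: insE_triv]. Qed.

Lemma insert_pure y x : insert (y ⊗ x) = y ⊗ E ⊗ x.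
Proof. by rewrite /insert tmapr_pure //; lin. Qed.

Lemma insert_linear : linear insert.
Proof. by rewrite /insert; lin. Qed.

Lemma split_coact_linear : linear split_coact.
Proof.
have l1 := insert_linear; have l2 := merge_linear.
have l3 : linear (split_op wy we wf wx) by apply: split_op_linear; rewrite /wy /we /wf /wx; lin.
by rewrite /split_coact; lin.
Qed.

Local Notation V := (tens Sg' (tens B (tens N Sg))).

Let vy : V -> V ⊗ H := legl coactS'.
Let vb : V -> V ⊗ H := legr (legl coactB).
Let ve : V -> V ⊗ H := legr (legr (legl n1)).
Let vf : V -> V ⊗ H := legr (legr (legl n2)).
Let vx : V -> V ⊗ H := legr (legr (legr coactS)).
(* [m1], ..., [m4] make b act on y, e, f, x respectively. *)
Let m1 : V -> W := fuse (@ract k H A' B Sg').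
Let m2 : V -> W := tmapr (fuse lactN).
Let m3 : V -> W := tmapr (fuse ractN).
Let m4 : V -> W := tmapr (fuse_outer (@lact k H B A' Sg)).
Let g : Sg' ⊗ B ⊗ Sg -> V := tmapr (tmapr (@insE E Sg)).

Let lm1 : linear m1. Proof. by rewrite /m1; lin. Qed.
Let lm2 : linear m2. Proof. by rewrite /m2; lin. Qed.
Let lm3 : linear m3. Proof. by rewrite /m3; lin. Qed.
Let lm4 : linear m4. Proof. by rewrite /m4; lin. Qed.
Let lg : linear g. Proof. by rewrite /g; lin. Qed.
Let lmerge := merge_linear.

Let lvy : linear vy. Proof. by rewrite /vy; lin. Qed.
Let lvb : linear vb. Proof. by rewrite /vb; lin. Qed.
Let lve : linear ve. Proof. by rewrite /ve; lin. Qed.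
Let lvf : linear vf. Proof. by rewrite /vf; lin. Qed.
Let lvx : linear vx. Proof. by rewrite /vx; lin. Qed.

Let V_ext (P : lmodType k) (p q : V -> P) : linear p -> linear q ->
  (forall y b e f x, p (y ⊗ b ⊗ (btens e f : N) ⊗ x) = q (y ⊗ b ⊗ (btens e f : N) ⊗ x)) ->
  forall v, p v = q v.
Proof.
move=> lp lq pq; apply: tens_ext => // y.
by apply: bcomp_middle_ext => [||b e f x]; [lin|lin|].
Qed.

Let m1_pure y b n x : m1 (y ⊗ b ⊗ n ⊗ x) = ract y b ⊗ n ⊗ x.
Proof. by rewrite /m1 fuse_pure //; lin. Qed.
Let m2_pure y b e f x : m2 (y ⊗ b ⊗ (btens e f : N) ⊗ x) = y ⊗ (btens (lact b e) f : N) ⊗ x.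
Proof. by rewrite /m2 tmapr_pure ?fuse_pure ?lactN_btens //; lin. Qed.
Let m3_pure y b e f x : m3 (y ⊗ b ⊗ (btens e f : N) ⊗ x) = y ⊗ (btens e (ract f b) : N) ⊗ x.
Proof. by rewrite /m3 tmapr_pure ?fuse_pure ?ractN_btens //; lin. Qed.
Let m4_pure y b n x : m4 (y ⊗ b ⊗ n ⊗ x) = y ⊗ n ⊗ lact b x.
Proof. by rewrite /m4 tmapr_pure ?fuse_outer_pure //; lin. Qed.

Let sw_vy (P : lmodType k) (F : V -> H -> P) y b n x : bilin F ->
  sweedler (vy (y ⊗ b ⊗ n ⊗ x)) F = \sw_(y0, h <- coact y) F (y0 ⊗ b ⊗ n ⊗ x) h.
Proof. by move=> bF; rewrite /vy sw_legl //; lin. Qed.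

Let sw_vb (P : lmodType k) (F : V -> H -> P) y b n x : bilin F ->
  sweedler (vb (y ⊗ b ⊗ n ⊗ x)) F = \sw_(b0, h <- coact b) F (y ⊗ b0 ⊗ n ⊗ x) h.
Proof. by move=> bF; rewrite /vb sw_legr ?sw_legl //; lin. Qed.

Let sw_ve (P : lmodType k) (F : V -> H -> P) y b e f x : bilin F ->
  sweedler (ve (y ⊗ b ⊗ (btens e f : N) ⊗ x)) F =
  \sw_(e0, h <- coact e) F (y ⊗ b ⊗ (btens e0 f : N) ⊗ x) h.
Proof. by move=> bF; rewrite /ve sw_legr ?sw_legr ?sw_legl ?sw_bleg1 //; lin. Qed.

Let sw_vf (P : lmodType k) (F : V -> H -> P) y b e f x : bilin F ->
  sweedler (vf (y ⊗ b ⊗ (btens e f : N) ⊗ x)) F =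
  \sw_(f0, h <- coact f) F (y ⊗ b ⊗ (btens e f0 : N) ⊗ x) h.
Proof. by move=> bF; rewrite /vf sw_legr ?sw_legr ?sw_legl ?sw_bleg2 //; lin. Qed.

Let sw_vx (P : lmodType k) (F : V -> H -> P) y b n x : bilin F ->
  sweedler (vx (y ⊗ b ⊗ n ⊗ x)) F = \sw_(x0, h <- coact x) F (y ⊗ b ⊗ n ⊗ x0) h.
Proof. by move=> bF; rewrite /vx sw_legr ?sw_legr ?sw_legr //; lin. Qed.

(** The relation of Σ' ⊗_B Σ in the first factor of C ⊗_A C; [merge34] is the one in the second
    factor. *)
Let merge12 v : merge (m1 v) = merge (m2 (reop (@reass k H) vy vb ve v)).
Proof.
move: v; apply: V_ext => [||y b e f x]; [lin|lin|].
rewrite m1_pure merge_pure.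
pose G (c : C) : bcomp C C := btens c (btens f x : C).
have lG : linear G by rewrite /G; lin.
have [_ h] := btens_balanced lG.
rewrite -/(G (btens (ract y b) e)) h (lin_reop (L := fun v => merge (m2 v))) //; [|lin..].
rewrite sw_ve; last by lin.
transitivity (\sw_(e0, e1 <- coact e) \sw_(b0, b1 <- coact b) \sw_(y0, y1 <- coact y)
  @reass k H y1 b1 e1 *: G (btens y0 (lact b0 e0))).
  rewrite exch_sw [RHS]exch_sw; apply: eq_sw => b0 b1; exact: exch_sw.
apply: eq_sw => e0 e1; rewrite sw_vb; last by lin.
apply: eq_sw => b0 b1; rewrite sw_vy; last by lin.
by apply: eq_sw => y0 y1; rewrite m2_pure merge_pure.
Qed.

Let merge34 v : merge (m3 v) = merge (m4 (reop (@reass k H) vf vb vx v)).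
Proof.
move: v; apply: V_ext => [||y b e f x]; [lin|lin|].
rewrite m3_pure merge_pure.
pose G (c : C) : bcomp C C := btens (btens y e : C) c.
have lG : linear G by rewrite /G; lin.
have [_ h] := btens_balanced lG.
rewrite -/(G (btens (ract f b) x)) h (lin_reop (L := fun v => merge (m4 v))) //; [|lin..].
rewrite sw_vx; last by lin.
transitivity (\sw_(x0, x1 <- coact x) \sw_(b0, b1 <- coact b) \sw_(f0, f1 <- coact f)
  @reass k H f1 b1 x1 *: G (btens f0 (lact b0 x0))).
  rewrite exch_sw [RHS]exch_sw; apply: eq_sw => b0 b1; exact: exch_sw.
apply: eq_sw => x0 x1; rewrite sw_vb; last by lin.
apply: eq_sw => b0 b1; rewrite sw_vf; last by lin.
by apply: eq_sw => f0 f1; rewrite m4_pure merge_pure.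
Qed.

Let m1g u : m1 (g u) = insert (mid_ract u).
Proof.
have l1 := insert_linear; have l2 : linear (@mid_ract _ _ _ _ _ Sg' Sg) by exact: mid_ract_linear.
move: u; apply: tens3_ext => [||y b x]; [lin|lin|].
by rewrite mid_ract_pure // insert_pure /g tmapr_pure ?tmapr_pure ?m1_pure //; lin.
Qed.

Let m4g u : m4 (g u) = insert (mid_lact u).
Proof.
have l1 := insert_linear; have l2 : linear (@mid_lact _ _ _ _ _ Sg' Sg) by exact: mid_lact_linear.
move: u; apply: tens3_ext => [||y b x]; [lin|lin|].
by rewrite mid_lact_pure // insert_pure /g tmapr_pure ?tmapr_pure ?m4_pure //; lin.
Qed.

Let m2_act y b (n : N) x :
  m2 (reop (@reassV k H) vb ve vf (y ⊗ b ⊗ n ⊗ x)) = y ⊗ (lact b n : N) ⊗ x.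
Proof.
have lb := lact_bcomp_linear b.
move: n; apply: bcomp_ext => [||e f].
- have lr : linear (reop (@reassV k H) vb ve vf) by lin.
  by lin.
- by lin.
rewrite lact_bcomp_btens (lin_reop (L := m2)) //; [|lin..].
pose G (n : N) : W := y ⊗ n ⊗ x.
have lG : linear G by rewrite /G; lin.
rewrite sw_vf; last by lin.
rewrite -[RHS]/(G _) (lin_sw _ _ lG).
transitivity (\sw_(f0, f1 <- coact f) \sw_(e0, e1 <- coact e) \sw_(b0, b1 <- coact b)
  @reassV k H b1 e1 f1 *: G (btens (lact b0 e0) f0)).
  apply: eq_sw => f0 f1; rewrite sw_ve; last by lin.
  apply: eq_sw => e0 e1; rewrite sw_vb; last by lin.
  by apply: eq_sw => b0 b1; rewrite m2_pure.
rewrite exch_sw.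
transitivity (\sw_(b0, b1 <- coact b) \sw_(e0, e1 <- coact e) \sw_(f0, f1 <- coact f)
  @reassV k H b1 e1 f1 *: G (btens (lact b0 e0) f0)).
  rewrite [RHS]exch_sw; apply: eq_sw => e0 e1; exact: exch_sw.
apply: eq_sw => b0 b1; rewrite (lin_sw _ _ lG); apply: eq_sw => e0 e1.
by rewrite (lin_sw _ _ lG); apply: eq_sw => f0 f1; rewrite (linZ _ _ lG).
Qed.

Let m3_act y b (n : N) x :
  m3 (reop (@reass k H) ve vf vb (y ⊗ b ⊗ n ⊗ x)) = y ⊗ (ract n b : N) ⊗ x.
Proof.
have lb := ract_bcomp_linear b.
move: n; apply: bcomp_ext => [||e f].
- have lr : linear (reop (@reass k H) ve vf vb) by lin.
  by lin.
- by lin.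
rewrite ract_bcomp_btens (lin_reop (L := m3)) //; [|lin..].
pose G (n : N) : W := y ⊗ n ⊗ x.
have lG : linear G by rewrite /G; lin.
rewrite sw_vb; last by lin.
rewrite -[RHS]/(G _) (lin_sw _ _ lG).
transitivity (\sw_(b0, b1 <- coact b) \sw_(f0, f1 <- coact f) \sw_(e0, e1 <- coact e)
  @reass k H e1 f1 b1 *: G (btens e0 (ract f0 b0))).
  apply: eq_sw => f0 f1; rewrite sw_vf; last by lin.
  apply: eq_sw => e0 e1; rewrite sw_ve; last by lin.
  by apply: eq_sw => b0 b1; rewrite m3_pure.
rewrite exch_sw.
transitivity (\sw_(e0, e1 <- coact e) \sw_(f0, f1 <- coact f) \sw_(b0, b1 <- coact b)
  @reass k H e1 f1 b1 *: G (btens e0 (ract f0 b0))).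
  rewrite [RHS]exch_sw; apply: eq_sw => e0 e1; exact: exch_sw.
apply: eq_sw => b0 b1; rewrite (lin_sw _ _ lG); apply: eq_sw => e0 e1.
by rewrite (lin_sw _ _ lG); apply: eq_sw => f0 f1; rewrite (linZ _ _ lG).
Qed.

(** Both sides insert an action of b on E, from the left and from the right, and these agree by
    [hE']. *)
Let m23 u :
  m2 (reop (@reassV k H) vb ve vf (g u)) = m3 (reop (@reass k H) ve vf vb (g u)).
Proof.
have lr2 : linear (reop (@reassV k H) vb ve vf) by lin.
have lr3 : linear (reop (@reass k H) ve vf vb) by lin.
move: u; apply: tens3_ext => [||y b x]; [lin|lin|].
have -> : g (y ⊗ b ⊗ x) = y ⊗ b ⊗ E ⊗ x by rewrite /g tmapr_pure ?tmapr_pure //; lin.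
by rewrite m2_act m3_act hE'.
Qed.

Let m2_e : intertwines m2 (cprod vb ve) we.
Proof.
rewrite /vb /ve cprod_legr; [|lin..].
apply: tmapr_intertwines_r; [lin|lin|].
by apply: fuse_intertwines_prod => //; exact: bleg1_lactN.
Qed.

Let m2_f : intertwines m2 vf wf.
Proof.
apply: tmapr_intertwines_r; [lin|lin|].
by apply: fuse_intertwines_mid => //; exact: bleg2_lactN.
Qed.

Let m3_e : intertwines m3 ve we.
Proof.
apply: tmapr_intertwines_r; [lin|lin|].
by apply: fuse_intertwines_mid => //; exact: bleg1_ractN.
Qed.

Let m3_f : intertwines m3 (cprod vf vb) wf.
Proof.
rewrite /vb /vf cprod_legr; [|lin..].
apply: tmapr_intertwines_r; [lin|lin|].
by apply: fuse_intertwines_prod_op => //; exact: bleg2_ractN.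
Qed.

Let m4_x : intertwines m4 (cprod vb vx) wx.
Proof.
rewrite /vb /vx cprod_legr; [|lin..].
apply: tmapr_intertwines_r; [lin|lin|].
apply: fuse_outer_intertwines_prod; [lin|lin|lin|lin|].
by move=> b x; rewrite -[LHS]sw_id sw_lact //; lin.
Qed.

Let m1_y : intertwines m1 (cprod vy vb) wy.
Proof.
apply: fuse_intertwines_prod; [lin|lin|lin|lin|].
by move=> y b; rewrite -[LHS]sw_id sw_ract //; lin.
Qed.

Lemma split_coact_balanced : balanced (fun y x => split_coact (y ⊗ x)).
Proof.
have l1 := split_coact_linear.
have lwy : linear wy by rewrite /wy; lin.
have lwe : linear we by rewrite /we; lin.
have lwf : linear wf by rewrite /wf; lin.
(* In operator form the balance is the abstract statement proved by [split_op_balanced]; the goals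
   left over are its hypotheses on legs. *)
apply/(balancedP hS' hS lB l1) => t; rewrite /split_coact.
apply: (@split_op_balanced k H _ _ _ _ _ (legl coactS') (legr (legl coactB))
  (legr (legr coactS)) vy vb ve vf vx wy we wf wx _ _ _ _ _ _ _ _ _ _ _ _ _ _ _ _ _ _ _ _ _ g m1 m2 m3 m4) => //; try solve [rewrite /vy /vb /ve /vf /vx; coact].
- by do 2!(apply: legrr_commuting; [lin|lin|]); apply: leglr_commuting; lin.
- by do 2!(apply: legrr_commuting; [lin|lin|]); apply: leglr_commuting; lin.
- by apply: tmapr_intertwines_l; lin.
- apply: tmapr_intertwines_r; [lin|lin|apply: tmapr_intertwines_l; lin].
- do 2!(apply: tmapr_intertwines_r; [lin|lin|]).
  by apply: insE_intertwines; lin.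
- do 2!(apply: tmapr_intertwines_triv; [lin|lin|]); exact: insE_triv.
- by apply: fuse_intertwines_r; lin.
- by apply: fuse_intertwines_r; lin.
- by apply: fuse_intertwines_r; lin.
- by apply: tmapr_intertwines_l; lin.
- by apply: tmapr_intertwines_r; [lin|lin|apply: fuse_intertwines_r; lin].
- by apply: tmapr_intertwines_l; lin.
- by apply: tmapr_intertwines_r; [lin|lin|apply: fuse_intertwines_r; lin].
- by apply: tmapr_intertwines_l; lin.
- by apply: tmapr_intertwines_r; [lin|lin|apply: fuse_outer_intertwines_mid; lin].
- by apply: tmapr_intertwines_r; [lin|lin|apply: fuse_outer_intertwines_mid; lin].
Qed.

End Comultiplication.

End Comatrix.

#[global] Hint Extern 2 (lin_goal (GRing.linear_for _ (@merge _ _ _ _ _ _))) =>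
  apply: LinGoal; apply: merge_linear; assumption : lin.
#[global] Hint Extern 2 (lin_goal (GRing.linear_for _ (@insE _ _ _ _ _ _ _ _))) =>
  apply: LinGoal; exact: insE_linear : lin.

Lemma sw_bcomp_coact (k : comPzRingType) (H : dual_quasi_bialgebra k) (R S T : alg_data H)
    (M : bimod_data R S) (N : bimod_data S T) (P : lmodType k)
    (F : bcomp M N -> H -> P) m n :
  bimodule M -> bimodule N -> comodule S -> bilin F ->
  sweedler (coact (btens m n : bcomp M N)) F =
  \sw_(m0, m1 <- coact m) \sw_(n0, n1 <- coact n) F (btens m0 n0) (m1 ∙ n1).
Proof.
move=> hM hN hS bF; rewrite bcomp_coact_btens // sw_sw //.
apply: eq_sw => *; rewrite sw_sw //.
by apply: eq_sw => *; rewrite sw_pure.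
Qed.

(** * The comultiplication is a map of comodules and of A-bimodules *)

Section ComatrixComultiplication.
Variables (k : comPzRingType) (H : dual_quasi_bialgebra k).
Variables (A : kalgebra k) (B : alg_data H).
Local Notation A' := (triv_alg H A).
Variables (Sg : bimod_data B A') (Sg' : bimod_data A' B).
Hypotheses (hB : comodule B) (hS : bimodule Sg) (hS' : bimodule Sg').
Local Notation N := (bcomp Sg Sg').
Local Notation C := (bcomp Sg' Sg).
Local Notation W := (tens Sg' (tens N Sg)).
Local Notation coactS := (@coact k H Sg).
Local Notation coactS' := (@coact k H Sg').
Local Notation merge := (@merge k H A B Sg Sg').
Local Notation n1 := (@bleg1 k H A B B Sg Sg').
Local Notation n2 := (@bleg2 k H A B B Sg Sg').
Local Notation wy := (@wy k H A B Sg Sg').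
Local Notation we := (@we k H A B Sg Sg').
Local Notation wf := (@wf k H A B Sg Sg').
Local Notation wx := (@wx k H A B Sg Sg').

Let hA : comodule A' := triv_comodule H A.
Let hn1 : coaction n1. Proof. exact: bleg1_coaction. Qed.
Let hn2 : coaction n2. Proof. exact: bleg2_coaction. Qed.
Let hn12 : commuting n1 n2. Proof. exact: bleg12_commuting. Qed.
Let hC : bimodule C. Proof. exact: bimodule_bcompA. Qed.
Let hCC : bimodule (bcomp C C). Proof. exact: bimodule_bcompA. Qed.
Let lwy : linear wy. Proof. by apply: legl_linear; lin. Qed.
Let lwe : linear we. Proof. by apply: legr_linear; lin. Qed.
Let lwf : linear wf. Proof. by apply: legr_linear; lin. Qed.
Let lwx : linear wx. Proof. by apply: legr_linear; lin. Qed.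
Let hwy : coaction wy. Proof. by rewrite /wy; coact. Qed.
Let hwe : coaction we. Proof. by rewrite /we; coact. Qed.
Let hwf : coaction wf. Proof. by rewrite /wf; coact. Qed.
Let hwx : coaction wx. Proof. by rewrite /wx; coact. Qed.
Let wye : commuting wy we. Proof. by apply: leglr_commuting; lin. Qed.
Let wyf : commuting wy wf. Proof. by apply: leglr_commuting; lin. Qed.
Let wyx : commuting wy wx. Proof. by apply: leglr_commuting; lin. Qed.
Let wef : commuting we wf. Proof. by rewrite /we /wf; coact. Qed.
Let wex : commuting we wx. Proof. by rewrite /we /wx; coact. Qed.
Let wfx : commuting wf wx. Proof. by rewrite /wf /wx; coact. Qed.

Lemma sw_wy (P : lmodType k) (F : W -> H -> P) y n x : bilin F ->
  sweedler (wy (y ⊗ n ⊗ x)) F = \sw_(y0, h <- coact y) F (y0 ⊗ n ⊗ x) h.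
Proof. by move=> bF; rewrite /wy sw_legl //; lin. Qed.

Lemma sw_we (P : lmodType k) (F : W -> H -> P) y e f x : bilin F ->
  sweedler (we (y ⊗ (btens e f : N) ⊗ x)) F =
  \sw_(e0, h <- coact e) F (y ⊗ (btens e0 f : N) ⊗ x) h.
Proof. by move=> bF; rewrite /we sw_legr ?sw_legl ?sw_bleg1 //; lin. Qed.

Lemma sw_wf (P : lmodType k) (F : W -> H -> P) y e f x : bilin F ->
  sweedler (wf (y ⊗ (btens e f : N) ⊗ x)) F =
  \sw_(f0, h <- coact f) F (y ⊗ (btens e f0 : N) ⊗ x) h.
Proof. by move=> bF; rewrite /wf sw_legr ?sw_legl ?sw_bleg2 //; lin. Qed.

Lemma sw_wx (P : lmodType k) (F : W -> H -> P) y n x : bilin F ->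
  sweedler (wx (y ⊗ n ⊗ x)) F = \sw_(x0, h <- coact x) F (y ⊗ n ⊗ x0) h.
Proof. by move=> bF; rewrite /wx sw_legr ?sw_legr //; lin. Qed.

Lemma merge_intertwines :
  intertwines merge (cprod (cprod wy we) (cprod wf wx)) (@coact k H (bcomp C C)).
Proof.
split; first by lin.
apply: bcomp_middle_ext => [||y e f x]; [lin|lin|].
rewrite merge_pure // (bcomp_coact_btens hC hC hA).
rewrite sw_cprod; last by lin.
rewrite sw_cprod; last by lin.
rewrite sw_wx; last by lin.
rewrite (sw_bcomp_coact _ _ hS' hS hB); last by lin.
transitivity (\sw_(y0, y1 <- coact y) \sw_(e0, e1 <- coact e)
  \sw_(f0, f1 <- coact f) \sw_(x0, x1 <- coact x)
  (btens (btens y0 e0 : C) (btens f0 x0 : C) : bcomp C C) ⊗ ((y1 ∙ e1) ∙ (f1 ∙ x1))).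
  apply: eq_sw => y0 y1; apply: eq_sw => e0 e1.
  by rewrite (sw_bcomp_coact _ _ hS' hS hB) //; lin.
rewrite rev_sw4; apply: eq_sw => x0 x1; rewrite sw_wf; last by lin.
apply: eq_sw => f0 f1; rewrite sw_cprod; last by lin.
rewrite sw_we; last by lin.
apply: eq_sw => e0 e1; rewrite sw_wy; last by lin.
by apply: eq_sw => y0 y1; rewrite merge_pure.
Qed.

Lemma merge_lact (a : A) w :
  merge (tmapl (fun y => lact (a : A') y) w) = lact (a : A') (merge w).
Proof.
have bA := lactA_bilin hC hC hA.
move: w; apply: bcomp_middle_ext => [||y e f x]; [lin|lin|].
rewrite tmapl_pure ?merge_pure //; last by lin.
by rewrite (lactA_btens hC hC hA) (lactA_btens hS' hS hB).
Qed.

Lemma merge_ract (a : A) w :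
  merge (tmapr (tmapr (fun x => ract x (a : A'))) w) = ract (merge w) (a : A').
Proof.
have bA := ractA_bilin hC hC hA.
move: w; apply: bcomp_middle_ext => [||y e f x]; [lin|lin|].
rewrite tmapr_pure ?tmapr_pure ?merge_pure //; [|lin..].
by rewrite (ractA_btens hC hC hA) (ractA_btens hS' hS hB).
Qed.

(** Φ⁻¹[y,e,f] carries (y(ef))x to ((ye)f)x, and Φ[ye,f,x] carries this to (ye)(fx). *)
Lemma split_op_intertwines :
  intertwines (split_op wy we wf wx) (cprod (cprod wy (cprod we wf)) wx)
    (cprod (cprod wy we) (cprod wf wx)).
Proof.
have i1 : intertwines (reop (@reassV k H) wy we wf) (cprod (cprod wy (cprod we wf)) wx)
    (cprod (cprod (cprod wy we) wf) wx).
  apply: intertwines_cprod; [lin|exact: reopV_assoc|].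
  by apply: reop_intertwines_commuting.
have i2 : intertwines (reop (@reass k H) (cprod wy we) wf wx)
    (cprod (cprod (cprod wy we) wf) wx) (cprod (cprod wy we) (cprod wf wx)).
  by apply: reop_assoc => //; coact.
exact: intertwines_comp i1 i2.
Qed.

Section Coring.
Variable E : N.
Hypothesis hE : coact E = E ⊗ dqb_one H.
Hypothesis hE' : forall b : B, lact b E = ract E b.
Local Notation insert := (@insert k H A B Sg Sg' E).
Local Notation split_coact := (@split_coact k H A B Sg Sg' E).

Definition comatrix_comul : C -> bcomp C C := blift (fun y x => split_coact (y ⊗ x)).

Lemma comatrix_comul_qpi t : comatrix_comul (qpi _ t) = split_coact t.
Proof.
have lc := split_coact_linear hB hS hS' E.
rewrite /comatrix_comul blift_qpi; last exact: split_coact_balanced.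
move: t; apply: tens_ext => [||y x] //; first by apply: tlift_linear; lin.
by rewrite tlift_pure //; lin.
Qed.

Lemma comatrix_comul_btens y x : comatrix_comul (btens y x) = split_coact (y ⊗ x).
Proof. exact: comatrix_comul_qpi. Qed.

Lemma comatrix_comul_linear : linear comatrix_comul.
Proof. by apply: blift_linear; apply: split_coact_balanced. Qed.

Let lD := comatrix_comul_linear.

(** Inserting E turns the diagonal coaction yx into (y(ef))x, as ef is trivial on the image; [merge]
    recognizes (ye)(fx) as the coaction of C ⊗_A C. *)
Lemma split_coact_intertwines :
  intertwines split_coact (cprod (legl coactS') (legr coactS)) (@coact k H (bcomp C C)).
Proof.
have i1 : intertwines insert (cprod (legl coactS') (legr coactS))
    (cprod (cprod wy (cprod we wf)) wx).
  apply: intertwines_cprod; [lin| |exact: insert_x].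
  by apply: intertwines_cprod_triv; [lin|lin|exact: insert_y|exact: insert_ef].
exact: intertwines_comp (intertwines_comp i1 split_op_intertwines) merge_intertwines.
Qed.

Lemma comatrix_comul_bimod_map : bimod_map comatrix_comul.
Proof.
have lcC := coact_linear hC; have lcCC := coact_linear hCC.
have bA := lactA_bilin hC hC hA; have bA' := ractA_bilin hC hC hA.
have bAC := lactA_bilin hS' hS hB; have bAC' := ractA_bilin hS' hS hB.
split.
- split=> //; apply: (@quo_ind _ _ _) => t.
  rewrite comatrix_comul_qpi (proj2 split_coact_intertwines).
  rewrite (sw_intertwines (qpi_intertwines hS' hS hB)); last by lin.
  by apply: eq_sw => *; rewrite comatrix_comul_qpi.
- move=> a; apply: bcomp_ext => [||y x]; [lin|lin|].
  rewrite (lactA_btens hS' hS hB) !comatrix_comul_btens /split_coact -merge_lact.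
  congr merge.
  (* Since A coacts trivially, acting by [a] on y respects all four legs, hence commutes with the
     splitting. *)
  rewrite (split_op_natural (g := tmapl (fun y => lact a y)) (y' := wy) (e' := we)
    (f' := wf) (x' := wx)) //; first last.
  + by apply: tmapl_intertwines_r; lin.
  + by apply: tmapl_intertwines_r; lin.
  + by apply: tmapl_intertwines_r; lin.
  + apply: tmapl_intertwines_l; [lin|lin|split; first by lin].
    by move=> y0; rewrite -[LHS]sw_id coact_lactA //; lin.
  by rewrite !insert_pure ?tmapl_pure //; lin.
- move=> c a; move: c; apply: bcomp_ext => [||y x]; [lin|lin|].
  rewrite (ractA_btens hS' hS hB) !comatrix_comul_btens /split_coact -merge_ract.
  congr merge.
  rewrite (split_op_natural (g := tmapr (tmapr (fun x => ract x a))) (y' := wy) (e' := we)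
    (f' := wf) (x' := wx)) //; first last.
  + do 2!(apply: tmapr_intertwines_r; [lin|lin|]); split; first by lin.
    by move=> x0; rewrite -[LHS]sw_id coact_ractA //; lin.
  + by apply: tmapr_intertwines_r; [lin|lin|apply: tmapr_intertwines_l; lin].
  + by apply: tmapr_intertwines_r; [lin|lin|apply: tmapr_intertwines_l; lin].
  + by apply: tmapr_intertwines_l; lin.
  by rewrite !insert_pure ?tmapr_pure ?tmapr_pure //; lin.
Qed.

End Coring.
End ComatrixComultiplication.

(** * Horizontal composition, associator and unit constraints over A *)

Section ConstraintsOverTrivialAlgebra.
Variables (k : comPzRingType) (H : dual_quasi_bialgebra k) (A : kalgebra k).
Local Notation A' := (triv_alg H A).

Section Bhcomp.
Variables (R T : alg_data H) (M M' : bimod_data R A') (N N' : bimod_data A' T).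
Hypotheses (hM : bimodule M) (hM' : bimodule M') (hN : bimodule N) (hN' : bimodule N').
Variables (f : M -> M') (g : N -> N').
Hypotheses (hf : bimod_map f) (hg : bimod_map g).

Lemma bhcomp_balanced : balanced (fun m n => btens (f m) (g n) : bcomp M' N').
Proof.
have [[lf _] _ fr] := hf; have [[lg _] gl _] := hg.
apply: balancedA => // [|m a n]; first by lin.
by rewrite fr gl btens_ractA.
Qed.

Lemma bhcomp_btens m n : bhcomp f g (btens m n) = btens (f m) (g n).
Proof. exact: (blift_btens _ _ bhcomp_balanced). Qed.

Lemma bhcomp_linear : linear (bhcomp f g : bcomp M N -> bcomp M' N').
Proof. exact: blift_linear bhcomp_balanced. Qed.

End Bhcomp.

Lemma bimod_map_id (R S : alg_data H) (M : bimod_data R S) : bimod_map (@id M).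
Proof. by split=> //; split=> // m; rewrite sw_id. Qed.

Section Bassoc.
Variables (M N P : bimod_data A' A').
Hypotheses (hM : bimodule M) (hN : bimodule N) (hP : bimodule P).
Let hA : comodule A' := triv_comodule H A.
Let hMN : bimodule (bcomp M N). Proof. exact: bimodule_bcompA. Qed.
Let hNP : bimodule (bcomp N P). Proof. exact: bimodule_bcompA. Qed.

Let assoc (p : P) (m : M) (n : N) : bcomp M (bcomp N P) :=
  \sw_(m0, m1 <- coact m) \sw_(n0, n1 <- coact n) \sw_(p0, p1 <- coact p)
    @reass k H m1 n1 p1 *: (btens m0 (btens n0 p0 : bcomp N P) : bcomp M (bcomp N P)).

Let assoc_balanced p : balanced (assoc p).
Proof.
apply: balancedA => // [|m a n]; first by rewrite /assoc; lin.
rewrite /assoc coact_ractA //; last by lin.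
apply: eq_sw => m0 m1; rewrite coact_lactA //; last by lin.
apply: eq_sw => n0 n1; apply: eq_sw => p0 p1.
by rewrite btens_ractA // (lactA_btens hN hP hA).
Qed.

Let bassoc_balanced : balanced (fun (q : bcomp M N) (p : P) => blift (assoc p) q).
Proof.
apply: balancedA => // [|q a p].
  apply: bilinP => [p|q]; first exact: blift_linear (assoc_balanced p).
  by apply: blift_param; rewrite /assoc; lin.
have br := ractA_bilin hM hN hA.
have l1 := blift_linear (assoc_balanced p).
have l2 := blift_linear (assoc_balanced (lact a p)).
move: q; apply: bcomp_ext => [||m n]; [lin|lin|].
rewrite (ractA_btens hM hN hA) !(blift_btens _ _ (assoc_balanced _)) /assoc.
apply: eq_sw => m0 m1; rewrite coact_ractA //; last by lin.
apply: eq_sw => n0 n1; rewrite coact_lactA //; last by lin.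
by apply: eq_sw => p0 p1; rewrite btens_ractA.
Qed.

Lemma bassoc_btens (m : M) (n : N) (p : P) :
  bassoc (btens (btens m n : bcomp M N) p : bcomp (bcomp M N) P) =
  \sw_(m0, m1 <- coact m) \sw_(n0, n1 <- coact n) \sw_(p0, p1 <- coact p)
    @reass k H m1 n1 p1 *: (btens m0 (btens n0 p0 : bcomp N P) : bcomp M (bcomp N P)).
Proof.
rewrite /bassoc (blift_btens _ _ bassoc_balanced).
exact: (blift_btens _ _ (assoc_balanced p)).
Qed.

Lemma bassoc_linear : linear (@bassoc k H A' A' A' A' M N P).
Proof. exact: blift_linear bassoc_balanced. Qed.

End Bassoc.

Section Units.
Variable M : bimod_data A' A'.
Hypothesis hM : bimodule M.

Lemma blunit_balanced : balanced (fun (r : bim1 A') (m : M) => lact (r : A') m).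
Proof.
apply: balancedA => // [||r a m]; [exact: bimodule_bim1A|lin|exact: lactMA].
Qed.

Lemma blunit_btens (a : A') (m : M) : blunit (btens (a : bim1 A') m) = lact a m.
Proof. exact: (blift_btens _ _ blunit_balanced). Qed.

Lemma blunit_linear : linear (@blunit k H A' A' M).
Proof. exact: blift_linear blunit_balanced. Qed.

Lemma brunit_balanced : balanced (fun (m : M) (r : bim1 A') => ract m (r : A')).
Proof.
apply: balancedA => // [||m a r]; [exact: bimodule_bim1A|lin|exact: ractMA].
Qed.

Lemma brunit_btens (a : A') (m : M) : brunit (btens m (a : bim1 A')) = ract m a.
Proof. exact: (blift_btens _ _ brunit_balanced). Qed.

Lemma brunit_linear : linear (@brunit k H A' A' M).
Proof. exact: blift_linear brunit_balanced. Qed.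

End Units.

End ConstraintsOverTrivialAlgebra.

(** * Coassociativity *)

Section ComatrixCoassociativity.
Variables (k : comPzRingType) (H : dual_quasi_bialgebra k).
Variables (A : kalgebra k) (B : alg_data H).
Local Notation A' := (triv_alg H A).
Variables (Sg : bimod_data B A') (Sg' : bimod_data A' B).
Hypotheses (hB : comodule B) (hS : bimodule Sg) (hS' : bimodule Sg').
Local Notation N := (bcomp Sg Sg').
Local Notation C := (bcomp Sg' Sg).
Local Notation W := (tens Sg' (tens N Sg)).
Local Notation X := (tens Sg' (tens N (tens N Sg))).
Local Notation coactS := (@coact k H Sg).
Local Notation coactS' := (@coact k H Sg').
Local Notation merge := (@merge k H A B Sg Sg').
Local Notation n1 := (@bleg1 k H A B B Sg Sg').
Local Notation n2 := (@bleg2 k H A B B Sg Sg').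
Local Notation wy := (@wy k H A B Sg Sg').
Local Notation we := (@we k H A B Sg Sg').
Local Notation wf := (@wf k H A B Sg Sg').
Local Notation wx := (@wx k H A B Sg Sg').

Let hA : comodule A' := triv_comodule H A.
Let hn1 : coaction n1. Proof. exact: bleg1_coaction. Qed.
Let hn2 : coaction n2. Proof. exact: bleg2_coaction. Qed.
Let hn12 : commuting n1 n2. Proof. exact: bleg12_commuting. Qed.
Let hC : bimodule C. Proof. exact: bimodule_bcompA. Qed.
Let hCC : bimodule (bcomp C C). Proof. exact: bimodule_bcompA. Qed.

Let xy : X -> X ⊗ H := legl coactS'.
Let xp : X -> X ⊗ H := legr (legl n1).
Let xq : X -> X ⊗ H := legr (legl n2).
Let xe : X -> X ⊗ H := legr (legr (legl n1)).
Let xf : X -> X ⊗ H := legr (legr (legl n2)).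
Let xx : X -> X ⊗ H := legr (legr (legr coactS)).

Let lxy : linear xy. Proof. by rewrite /xy; lin. Qed.
Let lxp : linear xp. Proof. by rewrite /xp; lin. Qed.
Let lxq : linear xq. Proof. by rewrite /xq; lin. Qed.
Let lxe : linear xe. Proof. by rewrite /xe; lin. Qed.
Let lxf : linear xf. Proof. by rewrite /xf; lin. Qed.
Let lxx : linear xx. Proof. by rewrite /xx; lin. Qed.
Let lwy : linear wy. Proof. by apply: legl_linear; lin. Qed.
Let lwe : linear we. Proof. by apply: legr_linear; lin. Qed.
Let lwf : linear wf. Proof. by apply: legr_linear; lin. Qed.

Let sw_xy (P : lmodType k) (F : X -> H -> P) y r : bilin F ->
  sweedler (xy (y ⊗ r)) F = \sw_(y0, h <- coact y) F (y0 ⊗ r) h.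
Proof. by move=> bF; rewrite /xy sw_legl //; lin. Qed.

Let sw_xp (P : lmodType k) (F : X -> H -> P) y e f s : bilin F ->
  sweedler (xp (y ⊗ (btens e f : N) ⊗ s)) F =
  \sw_(e0, h <- coact e) F (y ⊗ (btens e0 f : N) ⊗ s) h.
Proof. by move=> bF; rewrite /xp sw_legr ?sw_legl ?sw_bleg1 //; lin. Qed.

Let sw_xq (P : lmodType k) (F : X -> H -> P) y e f s : bilin F ->
  sweedler (xq (y ⊗ (btens e f : N) ⊗ s)) F =
  \sw_(f0, h <- coact f) F (y ⊗ (btens e f0 : N) ⊗ s) h.
Proof. by move=> bF; rewrite /xq sw_legr ?sw_legl ?sw_bleg2 //; lin. Qed.

Let sw_xe (P : lmodType k) (F : X -> H -> P) y n e f x : bilin F ->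
  sweedler (xe (y ⊗ n ⊗ (btens e f : N) ⊗ x)) F =
  \sw_(e0, h <- coact e) F (y ⊗ n ⊗ (btens e0 f : N) ⊗ x) h.
Proof. by move=> bF; rewrite /xe sw_legr ?sw_legr ?sw_legl ?sw_bleg1 //; lin. Qed.

Let sw_xf (P : lmodType k) (F : X -> H -> P) y n e f x : bilin F ->
  sweedler (xf (y ⊗ n ⊗ (btens e f : N) ⊗ x)) F =
  \sw_(f0, h <- coact f) F (y ⊗ n ⊗ (btens e f0 : N) ⊗ x) h.
Proof. by move=> bF; rewrite /xf sw_legr ?sw_legr ?sw_legl ?sw_bleg2 //; lin. Qed.

Let sw_xx (P : lmodType k) (F : X -> H -> P) y n n' x : bilin F ->
  sweedler (xx (y ⊗ n ⊗ n' ⊗ x)) F = \sw_(x0, h <- coact x) F (y ⊗ n ⊗ n' ⊗ x0) h.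
Proof. by move=> bF; rewrite /xx sw_legr ?sw_legr ?sw_legr //; lin. Qed.

(** The regrouping for two inserted copies of E; both sides of coassociativity are written as its
    values. *)
Definition merge3 (t : X) : bcomp C (bcomp C C) :=
  \sw_(y, r <- t) \sw_(n, s <- r)
    blift (fun (e : Sg) (f : Sg') =>
      btens (btens y e : C) (merge (f ⊗ s)) : bcomp C (bcomp C C)) n.

Lemma merge3_balanced (y : Sg') (s : N ⊗ Sg) : balanced (fun (e : Sg) (f : Sg') =>
  btens (btens y e : C) (merge (f ⊗ s)) : bcomp C (bcomp C C)).
Proof.
apply: balancedA => // [|e a f]; first by lin.
rewrite -(ractA_btens hS' hS hB) btens_ractA // -merge_lact //.
by rewrite tmapl_pure //; lin.
Qed.

Let bmerge3 : bilin (fun (y : Sg') (r : N ⊗ (N ⊗ Sg)) => \sw_(n, s <- r)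
    blift (fun (e : Sg) (f : Sg') =>
      btens (btens y e : C) (merge (f ⊗ s)) : bcomp C (bcomp C C)) n).
Proof.
have l y s := blift_linear (merge3_balanced y s).
apply: bilinP => [r|y]; first by lin.
by apply: lin_swl; [lin|apply: bilinP => [s|n]; [exact: l|lin]].
Qed.

Lemma merge3_linear : linear merge3.
Proof. by rewrite /merge3; apply: lin_swl; [lin|exact: bmerge3]. Qed.
Let lm3 := merge3_linear.

Lemma merge3_pure y e f s : merge3 (y ⊗ (btens e f : N) ⊗ s) =
  btens (btens y e : C) (merge (f ⊗ s)).
Proof.
have l y s := blift_linear (merge3_balanced y s).
rewrite /merge3 sw_pure // sw_pure; last by apply: bilinP => [s0|n]; [exact: l|lin].
exact: (blift_btens _ _ (merge3_balanced y s)).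
Qed.

Let appr (f : Sg') (x : Sg) (e : Sg) : N ⊗ Sg := (btens e f : N) ⊗ x.

Let appr_linear f x : linear (appr f x).
Proof. by rewrite /appr; lin. Qed.

(** The coaction on each factor C is the product of two legs, so the associator of C, C, C lifts to
    Φ[yp,qe,fx]. *)
Lemma bassoc_merge z f x :
  bassoc (btens (merge z) (btens f x : C) : bcomp (bcomp C C) C) =
  merge3 (reop (@reass k H) (cprod xy xp) (cprod xq xe) (cprod xf xx)
    (tmapr (tmapr (appr f x)) z)).
Proof.
have lb := bassoc_linear hC hC hC.
have la := appr_linear f x.
move: z; apply: bcomp_middle_ext => [||y e' f' e]; [lin|lin|].
rewrite tmapr_pure ?tmapr_pure //; [|lin..].
rewrite merge_pure // (bassoc_btens hC hC hC) rev_sw3.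
rewrite (lin_reop (L := merge3)) //; [|lin..].
rewrite (sw_bcomp_coact _ _ hS' hS hB); last by lin.
rewrite sw_cprod; last by lin.
rewrite exch_sw /appr sw_xx; last by lin.
apply: eq_sw => x0 x1; rewrite sw_xf; last by lin.
apply: eq_sw => f0 f1; rewrite (sw_bcomp_coact _ _ hS' hS hB); last by lin.
rewrite sw_cprod; last by lin.
rewrite exch_sw sw_xe; last by lin.
apply: eq_sw => e0 e1; rewrite sw_xq; last by lin.
apply: eq_sw => f'0 f'1; rewrite (sw_bcomp_coact _ _ hS' hS hB); last by lin.
rewrite sw_cprod; last by lin.
rewrite exch_sw sw_xp; last by lin.
apply: eq_sw => e'0 e'1; rewrite sw_xy; last by lin.
by apply: eq_sw => y0 y1; rewrite merge3_pure merge_pure.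
Qed.

Let appl (y : Sg') (e : Sg) (w : W) : X := y ⊗ tmapl (fun f => btens e f : N) w.

Let appl_linear y e : linear (appl y e).
Proof. by rewrite /appl; lin. Qed.

Lemma merge_merge3 y e w :
  btens (btens y e : C) (merge w) = merge3 (appl y e w) :> bcomp C (bcomp C C).
Proof.
have la := appl_linear y e.
move: w; apply: tens_ext => [||f s]; [lin|lin|].
by rewrite /appl tmapl_pure ?merge3_pure //; lin.
Qed.

Let appl_intertwines y e (ρ : W -> W ⊗ H) (σ : N ⊗ N ⊗ Sg -> (N ⊗ N ⊗ Sg) ⊗ H) :
  linear σ -> intertwines (tmapl (fun f => btens e f : N)) ρ σ ->
  intertwines (appl y e) ρ (legr σ).
Proof.
move=> lσ h; apply: (intertwines_comp h); split=> [|s]; first by lin.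
by rewrite legr_pure.
Qed.

Section Coassoc.
Variable E : N.
Hypothesis hE : coact E = E ⊗ dqb_one H.
Hypothesis hE' : forall b : B, lact b E = ract E b.
Local Notation insert := (@insert k H A B Sg Sg' E).
Local Notation Δ := (@comatrix_comul k H A B Sg Sg' E).
Local Notation split := (split_op wy we wf wx).

Let i1 : W -> X := tmapr (@insE k H A B Sg Sg' E (N ⊗ Sg)%type).
Let i2 : W -> X := tmapr (tmapr (@insE k H A B Sg Sg' E Sg)).

Let li1 : linear i1. Proof. by rewrite /i1; lin. Qed.
Let li2 : linear i2. Proof. by rewrite /i2; lin. Qed.
Let lsx1 : linear (split_op xy xp xq xe). Proof. by apply: split_op_linear; lin. Qed.
Let lsx2 : linear (split_op xq xe xf xx). Proof. by apply: split_op_linear; lin. Qed.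

Let hD : bimod_map Δ. Proof. exact: comatrix_comul_bimod_map. Qed.

(** Comultiplying y ⊗_B e inserts a new E between them: the new copy takes the legs p, q, and the
    old e keeps the leg e in second place. *)
Let comul_left w : bassoc (bhcomp Δ id (merge w)) =
  merge3 (reop (@reass k H) (cprod xy xp) (cprod xq xe) (cprod xf xx)
    (split_op xy xp xq xe (i1 w))).
Proof.
have lb := bassoc_linear hC hC hC.
have lh := bhcomp_linear hC hCC hC hC hD (bimod_map_id C).
move: w; apply: bcomp_middle_ext => [||y e f x]; [lin|lin|].
rewrite merge_pure // (bhcomp_btens hC hCC hC hC hD (bimod_map_id C)).
rewrite comatrix_comul_btens // bassoc_merge insert_pure //.
have la := appr_linear f x.
congr merge3; congr reop.
rewrite (split_op_natural (g := tmapr (tmapr (appr f x))) (y' := xy) (e' := xp)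
  (f' := xq) (x' := xe) _ lxy lxp lxq); first last.
- do 2!(apply: tmapr_intertwines_r; [lin|lin|]); split=> // e0.
  rewrite /appr legl_pure; last by lin.
  rewrite bleg1_btens // sw_sw; last by lin.
  by apply: eq_sw => *; rewrite sw_pure //; lin.
- by apply: tmapr_intertwines_r; [lin|lin|apply: tmapr_intertwines_l; lin].
- by apply: tmapr_intertwines_r; [lin|lin|apply: tmapr_intertwines_l; lin].
- by apply: tmapr_intertwines_l; lin.
by rewrite /i1 !tmapr_pure //; lin.
Qed.

(** Comultiplying f ⊗_B x inserts the new E after f. The old f is now the leg q of the first copy,
    hence the legs q, e, f, x. *)
Let comul_right w : bhcomp id Δ (merge w) = merge3 (split_op xq xe xf xx (i2 w)).
Proof.
have lh := bhcomp_linear hC hC hC hCC (bimod_map_id C) hD.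
move: w; apply: bcomp_middle_ext => [||y e f x]; [lin|lin|].
rewrite merge_pure // (bhcomp_btens hC hC hC hCC (bimod_map_id C) hD).
rewrite comatrix_comul_btens // merge_merge3 insert_pure //.
congr merge3.
rewrite (split_op_natural (g := appl y e) (y' := xq) (e' := xe)
  (f' := xf) (x' := xx) _ lxq lxe lxf); first last.
- by apply: appl_intertwines; [lin|apply: tmapl_intertwines_r; lin].
- by apply: appl_intertwines; [lin|apply: tmapl_intertwines_r; lin].
- by apply: appl_intertwines; [lin|apply: tmapl_intertwines_r; lin].
- apply: appl_intertwines; [lin|apply: tmapl_intertwines_l; [lin|lin|]].
  by split=> [|f0]; [lin|rewrite bleg2_btens].
by rewrite /i2 /appl tmapl_pure ?tmapr_pure ?tmapr_pure //; lin.
Qed.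

Lemma comatrix_coassoc c :
  bassoc (bhcomp Δ id (Δ c)) = bhcomp id Δ (Δ c).
Proof.
move: c; apply: (@quo_ind _ _ _) => t.
rewrite comatrix_comul_qpi // comul_left comul_right.
congr merge3.
have hwy : coaction wy by apply: legl_coaction; coact.
have hwe : coaction we by apply: legr_coaction; coact.
have hwf : coaction wf by apply: legr_coaction; coact.
have hwx : coaction wx by apply: legr_coaction; coact.
have hxy : coaction xy by apply: legl_coaction; coact.
have hxp : coaction xp by apply: legr_coaction; coact.
have hxq : coaction xq by apply: legr_coaction; coact.
have hxe : coaction xe by do 2!apply: legr_coaction; coact.
have hxf : coaction xf by do 2!apply: legr_coaction; coact.
have hxx : coaction xx by do 2!apply: legr_coaction; coact.
apply: (split_op_coassoc hwy hwe hwf hwx _ _ _ hxy hxp hxq hxe hxf hxx);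
  try solve [repeat first [apply: legll_commuting | apply: legrr_commuting
     | apply: leglr_commuting]; first [exact: hn12 | lin]].
- by apply: tmapr_intertwines_l; lin.
- by apply: tmapr_intertwines_r; [lin|lin|apply: insE_intertwines; lin].
- by apply: tmapr_intertwines_r; [lin|lin|apply: insE_intertwines; lin].
- by apply: tmapr_intertwines_r; [lin|lin|apply: insE_intertwines; lin].
- by apply: tmapr_intertwines_triv; [lin|lin|exact: insE_triv].
- by apply: tmapr_intertwines_l; lin.
- by apply: tmapr_intertwines_r; [lin|lin|apply: tmapr_intertwines_l; lin].
- by apply: tmapr_intertwines_r; [lin|lin|apply: tmapr_intertwines_l; lin].
- do 2!(apply: tmapr_intertwines_r; [lin|lin|]).
  by apply: insE_intertwines; lin.
- by do 2!(apply: tmapr_intertwines_triv; [lin|lin|]); exact: insE_triv.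
have li := insert_linear E.
(* The last hypothesis: both orders of insertion give y ⊗ E ⊗ E ⊗ x. *)
apply: tens_ext => [||y x]; [lin|lin|].
by rewrite insert_pure /i1 /i2 tmapr_pure ?tmapr_pure ?tmapr_pure //; lin.
Qed.

End Coassoc.

End ComatrixCoassociativity.

Lemma sw_coact2 (k : comPzRingType) (H : dual_quasi_bialgebra k) (M : comod_data H)
    (P : lmodType k) (F : M -> H -> H -> P) (m : M) :
  coaction (@coact k H M) -> trilin F ->
  \sw_(m0, m1, m2 <- coact2 m) F m0 m1 m2 =
  \sw_(m', m2 <- coact m) \sw_(m0, m1 <- coact m') F m0 m1 m2.
Proof.
move=> hM tF; rewrite (coact_sw hM) // /coact2 sw_sw; last by lin.
by apply: eq_sw => *; rewrite sw_pure //; lin.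
Qed.

(** * The two explicit formulas and the counit laws *)

Section ComatrixCounit.
Variables (k : comPzRingType) (H : dual_quasi_bialgebra k).
Variables (A : kalgebra k) (B : alg_data H).
Local Notation A' := (triv_alg H A).
Variables (Sg : bimod_data B A') (Sg' : bimod_data A' B).
Hypotheses (hB : comodule B) (hS : bimodule Sg) (hS' : bimodule Sg').
Local Notation N := (bcomp Sg Sg').
Local Notation C := (bcomp Sg' Sg).
Local Notation W := (tens Sg' (tens N Sg)).
Local Notation coactS := (@coact k H Sg).
Local Notation coactS' := (@coact k H Sg').
Local Notation merge := (@merge k H A B Sg Sg').
Local Notation n1 := (@bleg1 k H A B B Sg Sg').
Local Notation n2 := (@bleg2 k H A B B Sg Sg').
Local Notation wy := (@wy k H A B Sg Sg').
Local Notation we := (@we k H A B Sg Sg').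
Local Notation wf := (@wf k H A B Sg Sg').
Local Notation wx := (@wx k H A B Sg Sg').
Local Notation split := (split_op wy we wf wx).

Let hA : comodule A' := triv_comodule H A.
Let hn1 : coaction n1. Proof. exact: bleg1_coaction. Qed.
Let hn2 : coaction n2. Proof. exact: bleg2_coaction. Qed.
Let hn12 : commuting n1 n2. Proof. exact: bleg12_commuting. Qed.
Let hC : bimodule C. Proof. exact: bimodule_bcompA. Qed.
Let hCC : bimodule (bcomp C C). Proof. exact: bimodule_bcompA. Qed.
Let cS : coaction coactS. Proof. exact: bimodule_coaction. Qed.
Let cS' : coaction coactS'. Proof. exact: bimodule_coaction. Qed.
Let lwy : linear wy. Proof. by apply: legl_linear; lin. Qed.
Let lwe : linear we. Proof. by apply: legr_linear; lin. Qed.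
Let lwf : linear wf. Proof. by apply: legr_linear; lin. Qed.
Let lwx : linear wx. Proof. by apply: legr_linear; lin. Qed.

(** Φ⁻¹ is applied first and so reads the outer legs, index 2; Φ reads index 1. The rest reorders
    sums from operator order to the order of the formula. *)
Lemma merge_split_op (y : Sg') (e : Sg) (f : Sg') (x : Sg) :
  merge (split (y ⊗ (btens e f : N) ⊗ x)) =
  \sw_(y0, y1, y2 <- coact2 y) \sw_(e0, e1, e2 <- coact2 e)
  \sw_(f0, f1, f2 <- coact2 f) \sw_(x0, x1 <- coact x)
    (@reass k H (y1 ∙ e1) f1 x1 * @reassV k H y2 e2 f2) *:
    (btens (btens y0 e0 : C) (btens f0 x0 : C) : bcomp C C).
Proof.
pose T y0 y1 y2 e0 e1 e2 f0 f1 f2 x0 x1 : bcomp C C :=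
  (@reass k H (y1 ∙ e1) f1 x1 * @reassV k H y2 e2 f2) *:
    (btens (btens y0 e0 : C) (btens f0 x0 : C) : bcomp C C).
transitivity (\sw_(f', f2 <- coact f) \sw_(e', e2 <- coact e) \sw_(y', y2 <- coact y)
  \sw_(x0, x1 <- coact x) \sw_(f0, f1 <- coact f') \sw_(e0, e1 <- coact e')
  \sw_(y0, y1 <- coact y') T y0 y1 y2 e0 e1 e2 f0 f1 f2 x0 x1).
  rewrite /split_op.
  have lr := reop_linear (reassP H) (cprod_linear lwy lwe) lwf lwx.
  rewrite (lin_reop (L := fun v => merge (reop (@reass k H) (cprod wy we) wf wx v))) //; last by lin.
  rewrite sw_wf; [|done|done|lin]; apply: eq_sw => f' f2.
  rewrite sw_we; [|done|done|lin]; apply: eq_sw => e' e2.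
  rewrite sw_wy; [|done|lin]; apply: eq_sw => y' y2.
  rewrite (lin_reop (L := merge)) //; [|lin..].
  rewrite -sw_scale sw_wx; [|done|lin]; apply: eq_sw => x0 x1.
  rewrite -sw_scale sw_wf; [|done|done|lin]; apply: eq_sw => f0 f1.
  rewrite -sw_scale sw_cprod; last by lin.
  rewrite sw_we; [|done|done|lin]; apply: eq_sw => e0 e1.
  rewrite sw_wy; [|done|lin]; apply: eq_sw => y0 y1.
  by rewrite merge_pure // scalerA mulrC.
rewrite sw_coact2 //; last by lin.
rewrite rev_sw3; apply: eq_sw => y' y2.
transitivity (\sw_(e', e2 <- coact e) \sw_(f', f2 <- coact f)
  \sw_(y0, y1 <- coact y') \sw_(e0, e1 <- coact e') \sw_(f0, f1 <- coact f')
  \sw_(x0, x1 <- coact x) T y0 y1 y2 e0 e1 e2 f0 f1 f2 x0 x1).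
  by do 2!apply: eq_sw => ? ?; exact: rev_sw4.
transitivity (\sw_(e', e2 <- coact e) \sw_(y0, y1 <- coact y')
  \sw_(f', f2 <- coact f) \sw_(e0, e1 <- coact e') \sw_(f0, f1 <- coact f')
  \sw_(x0, x1 <- coact x) T y0 y1 y2 e0 e1 e2 f0 f1 f2 x0 x1).
  by apply: eq_sw => ? ?; exact: exch_sw.
rewrite exch_sw; apply: eq_sw => y0 y1; rewrite sw_coact2 //; last by lin.
apply: eq_sw => e' e2; rewrite exch_sw; apply: eq_sw => e0 e1.
by rewrite sw_coact2 //; lin.
Qed.

Lemma merge_split_op_alt (y : Sg') (e : Sg) (f : Sg') (x : Sg) :
  merge (reop (@reassV k H) wy we (cprod wf wx) (reop (@reass k H) we wf wx
    (y ⊗ (btens e f : N) ⊗ x))) =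
  \sw_(y0, y1 <- coact y) \sw_(e0, e1, e2 <- coact2 e)
  \sw_(f0, f1, f2 <- coact2 f) \sw_(x0, x1, x2 <- coact2 x)
    (@reassV k H y1 e1 (f1 ∙ x1) * @reass k H e2 f2 x2) *:
    (btens (btens y0 e0 : C) (btens f0 x0 : C) : bcomp C C).
Proof.
pose T y0 y1 e0 e1 e2 f0 f1 f2 x0 x1 x2 : bcomp C C :=
  (@reassV k H y1 e1 (f1 ∙ x1) * @reass k H e2 f2 x2) *:
    (btens (btens y0 e0 : C) (btens f0 x0 : C) : bcomp C C).
transitivity (\sw_(x', x2 <- coact x) \sw_(f', f2 <- coact f) \sw_(e', e2 <- coact e)
  \sw_(x0, x1 <- coact x') \sw_(f0, f1 <- coact f') \sw_(e0, e1 <- coact e')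
  \sw_(y0, y1 <- coact y) T y0 y1 e0 e1 e2 f0 f1 f2 x0 x1 x2).
  have lr := reop_linear (reassVP H) lwy lwe (cprod_linear lwf lwx).
  rewrite (lin_reop (L := fun v => merge (reop (@reassV k H) wy we (cprod wf wx) v))) //; last by lin.
  rewrite sw_wx; [|done|lin]; apply: eq_sw => x' x2.
  rewrite sw_wf; [|done|done|lin]; apply: eq_sw => f' f2.
  rewrite sw_we; [|done|done|lin]; apply: eq_sw => e' e2.
  rewrite (lin_reop (L := merge)) //; [|lin..].
  rewrite sw_cprod; last by lin.
  rewrite -sw_scale sw_wx; [|done|lin]; apply: eq_sw => x0 x1.
  rewrite -sw_scale sw_wf; [|done|done|lin]; apply: eq_sw => f0 f1.
  rewrite -sw_scale sw_we; [|done|done|lin]; apply: eq_sw => e0 e1.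
  rewrite -sw_scale sw_wy; [|done|lin]; apply: eq_sw => y0 y1.
  by rewrite merge_pure // scalerA mulrC.
rewrite rev_sw3.
transitivity (\sw_(e', e2 <- coact e) \sw_(f', f2 <- coact f) \sw_(x', x2 <- coact x)
  \sw_(y0, y1 <- coact y) \sw_(e0, e1 <- coact e') \sw_(f0, f1 <- coact f')
  \sw_(x0, x1 <- coact x') T y0 y1 e0 e1 e2 f0 f1 f2 x0 x1 x2).
  by do 3!apply: eq_sw => ? ?; exact: rev_sw4.
transitivity (\sw_(e', e2 <- coact e) \sw_(f', f2 <- coact f) \sw_(y0, y1 <- coact y)
  \sw_(e0, e1 <- coact e') \sw_(f0, f1 <- coact f') \sw_(x', x2 <- coact x)
  \sw_(x0, x1 <- coact x') T y0 y1 e0 e1 e2 f0 f1 f2 x0 x1 x2).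
  do 2!apply: eq_sw => ? ?; rewrite exch_sw; apply: eq_sw => ? ?.
  by rewrite exch_sw; apply: eq_sw => ? ?; exact: exch_sw.
transitivity (\sw_(e', e2 <- coact e) \sw_(y0, y1 <- coact y) \sw_(e0, e1 <- coact e')
  \sw_(f', f2 <- coact f) \sw_(f0, f1 <- coact f') \sw_(x', x2 <- coact x)
  \sw_(x0, x1 <- coact x') T y0 y1 e0 e1 e2 f0 f1 f2 x0 x1 x2).
  by apply: eq_sw => ? ?; rewrite exch_sw; apply: eq_sw => ? ?; exact: exch_sw.
rewrite exch_sw; apply: eq_sw => y0 y1; rewrite sw_coact2 //; last by lin.
apply: eq_sw => e' e2; apply: eq_sw => e0 e1; rewrite sw_coact2 //; last by lin.
by apply: eq_sw => f' f2; apply: eq_sw => f0 f1; rewrite sw_coact2 //; lin.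
Qed.

Variables (mu : C -> bim1 A').
Hypothesis hmu : bimod_map mu.

Definition counit_left (w : W) : C := blunit (bhcomp mu id (merge w)).
Definition counit_right (w : W) : C := brunit (bhcomp id mu (merge w)).

Let h1 : bimodule (bim1 A') := bimodule_bim1A H A.
Let lmu : linear mu. Proof. by case: hmu => [[]]. Qed.

Lemma counit_left_pure y e f x : counit_left (y ⊗ (btens e f : N) ⊗ x) =
  btens (lact (mu (btens y e) : A') f) x.
Proof.
rewrite /counit_left merge_pure // (bhcomp_btens hC h1 hC hC hmu (bimod_map_id C)).
by rewrite (blunit_btens hC) (lactA_btens hS' hS hB).
Qed.

Lemma counit_right_pure y e f x : counit_right (y ⊗ (btens e f : N) ⊗ x) =
  btens y (ract e (mu (btens f x) : A')).
Proof.
rewrite /counit_right merge_pure // (bhcomp_btens hC hC hC h1 (bimod_map_id C) hmu).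
by rewrite (brunit_btens hC) (ractA_btens hS' hS hB).
Qed.

Lemma counit_left_linear : linear counit_left.
Proof.
have l1 := bhcomp_linear hC h1 hC hC hmu (bimod_map_id C).
have l2 := blunit_linear hC.
by rewrite /counit_left; lin.
Qed.

Lemma counit_right_linear : linear counit_right.
Proof.
have l1 := bhcomp_linear hC hC hC h1 (bimod_map_id C) hmu.
have l2 := brunit_linear hC.
by rewrite /counit_right; lin.
Qed.

(* mu is colinear and A coacts trivially, so φ is evaluated at 1. *)
Lemma sw_mu (P : lmodType k) (F : A -> H -> P) (y : Sg') (e : Sg) : bilin F ->
  \sw_(y0, y1 <- coact y) \sw_(e0, e1 <- coact e) F (mu (btens y0 e0)) (y1 ∙ e1) =
  F (mu (btens y e)) (dqb_one H).
Proof.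
move=> bF; have [hc _ _] := hmu.
rewrite -(sw_coactA (mu (btens y e) : A') bF) (sw_intertwines (hc : intertwines mu _ _)) //.
by rewrite (sw_bcomp_coact _ _ hS' hS hB) //; lin.
Qed.

(** After μ has been applied to y ⊗_B e the leg ye is trivial, so Φ[ye,f,x] disappears. Of the first
    formula only Φ⁻¹[y,e,f] is left, the operator in the dual basis identity for y. *)
Lemma counit_left_reass w :
  counit_left (reop (@reass k H) (cprod wy we) wf wx w) = counit_left w.
Proof.
have ll := counit_left_linear.
have lr := reop_linear (reassP H) (cprod_linear lwy lwe) lwf lwx.
move: w; apply: bcomp_middle_ext => [||y e f x]; [lin|lin|].
rewrite counit_left_pure (lin_reop (L := counit_left)) //; last by lin.
rewrite -[RHS](coact_counit_sw cS (f := fun x => btens (lact (mu (btens y e) : A') f) x)); last by lin.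
rewrite sw_wx; [|done|lin]; apply: eq_sw => x0 x1.
rewrite -[in RHS](coact_counit_sw cS' (f := fun f => btens (lact (mu (btens y e) : A') f) x0)); last by lin.
rewrite -sw_scale sw_wf; [|done|done|lin]; apply: eq_sw => f0 f1.
pose F (a : A) (h : H) : C := @reass k H h f1 x1 *: (btens (lact (a : A') f0) x0 : C).
transitivity (F (mu (btens y e)) (dqb_one H)); last first.
  by rewrite /F reass_left1 scalerA mulrC.
rewrite -sw_mu; last by rewrite /F; lin.
rewrite sw_cprod; last by lin.
rewrite [RHS]exch_sw sw_we; [|done|done|lin]; apply: eq_sw => e0 e1.
rewrite sw_wy; [|done|lin]; apply: eq_sw => y0 y1.
by rewrite counit_left_pure.
Qed.

(** Mirror case: μ trivializes fx, so of the second formula only Φ[e,f,x] is left, as in the dual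
    basis identity for x. *)
Lemma counit_right_reassV w :
  counit_right (reop (@reassV k H) wy we (cprod wf wx) w) = counit_right w.
Proof.
have ll := counit_right_linear.
have lr := reop_linear (reassVP H) lwy lwe (cprod_linear lwf lwx).
move: w; apply: bcomp_middle_ext => [||y e f x]; [lin|lin|].
rewrite counit_right_pure (lin_reop (L := counit_right)) //; last by lin.
pose F (a : A) (h : H) : C := \sw_(e0, e1 <- coact e) \sw_(y0, y1 <- coact y)
  @reassV k H y1 e1 h *: (btens y0 (ract e0 (a : A')) : C).
transitivity (F (mu (btens f x)) (dqb_one H)); last first.
  rewrite /F -[RHS](coact_counit_sw cS (f := fun e => btens y (ract e (mu (btens f x) : A')))); last by lin.
  apply: eq_sw => e0 e1.
  rewrite -[in RHS](coact_counit_sw cS' (f := fun y => btens y (ract e0 (mu (btens f x) : A')))); last by lin.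
  by rewrite -sw_scale; apply: eq_sw => y0 y1; rewrite reassV_right1 scalerA mulrC.
rewrite -sw_mu; last by rewrite /F; lin.
rewrite sw_cprod; last by lin.
rewrite [RHS]exch_sw sw_wx; [|done|lin]; apply: eq_sw => x0 x1.
rewrite sw_wf; [|done|done|lin]; apply: eq_sw => f0 f1.
rewrite sw_we; [|done|done|lin]; apply: eq_sw => e0 e1.
rewrite sw_wy; [|done|lin]; apply: eq_sw => y0 y1.
by rewrite counit_right_pure.
Qed.

Section DualBasis.
Variables (n : nat) (e : 'I_n -> Sg) (f : 'I_n -> Sg').
Let E : N := \sum_(i < n) btens (e i) (f i).
Hypothesis hE : coact E = E ⊗ dqb_one H.
Hypothesis hE' : forall b : B, lact b E = ract E b.
Hypothesis dual_left : forall y : Sg', y = \sum_(i < n)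
  \sw_(y0, y1 <- coact y) \sw_(e0, e1 <- coact (e i))
  \sw_(f0, f1 <- coact (f i)) @reassV k H y1 e1 f1 *: lact (mu (btens y0 e0) : A') f0.
Hypothesis dual_right : forall x : Sg, x = \sum_(i < n)
  \sw_(e0, e1 <- coact (e i)) \sw_(f0, f1 <- coact (f i))
  \sw_(x0, x1 <- coact x) @reass k H e1 f1 x1 *: ract e0 (mu (btens f0 x0) : A').
Local Notation Δ := (@comatrix_comul k H A B Sg Sg' E).

Let insert_sum y x : insert E (y ⊗ x) = \sum_(i < n) y ⊗ (btens (e i) (f i) : N) ⊗ x.
Proof. by rewrite insert_pure -(lin_sum (f := fun n : N => y ⊗ n ⊗ x)) //; lin. Qed.

Let split_insert y x : split (insert E (y ⊗ x)) =
  reop (@reassV k H) wy we (cprod wf wx) (reop (@reass k H) we wf wx (insert E (y ⊗ x))).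
Proof.
have hwy : coaction wy by apply: legl_coaction; coact.
have hwe : coaction we by apply: legr_coaction; coact.
have hwf : coaction wf by apply: legr_coaction; coact.
have hwx : coaction wx by apply: legr_coaction; coact.
have [lcS lcS'] := (coact_linear hS, coact_linear hS').
have hy := @legl_coaction k H Sg' Sg _ cS'; have hx := @legr_coaction k H Sg' Sg _ cS.
apply: (@split_opE _ _ _ _ (insert E) _ _ _ _ _ _ hy hx hwy hwe hwf hwx);
  try solve [repeat first [apply: legll_commuting | apply: legrr_commuting
    | apply: leglr_commuting]; first [exact: hn12 | lin]].
- by apply: insert_y.
- by apply: insert_x.
- by apply: insert_ef.
Qed.

Lemma comatrix_comul_sum y x : Δ (btens y x) = \sum_(i < n)
  \sw_(y0, y1, y2 <- coact2 y) \sw_(e0, e1, e2 <- coact2 (e i))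
  \sw_(f0, f1, f2 <- coact2 (f i)) \sw_(x0, x1 <- coact x)
    (@reass k H (y1 ∙ e1) f1 x1 * @reassV k H y2 e2 f2) *:
    (btens (btens y0 e0 : C) (btens f0 x0 : C) : bcomp C C).
Proof.
have ls : linear split by apply: split_op_linear; lin.
rewrite comatrix_comul_btens // /split_coact insert_sum.
rewrite (lin_sum (f := fun w => merge (split w))); last by lin.
by apply: eq_bigr => i _; rewrite merge_split_op.
Qed.

Lemma comatrix_comul_sum_alt y x : Δ (btens y x) = \sum_(i < n)
  \sw_(y0, y1 <- coact y) \sw_(e0, e1, e2 <- coact2 (e i))
  \sw_(f0, f1, f2 <- coact2 (f i)) \sw_(x0, x1, x2 <- coact2 x)
    (@reassV k H y1 e1 (f1 ∙ x1) * @reass k H e2 f2 x2) *: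
    (btens (btens y0 e0 : C) (btens f0 x0 : C) : bcomp C C).
Proof.
have l1 := reop_linear (reassVP H) lwy lwe (cprod_linear lwf lwx).
have l2 := reop_linear (reassP H) lwe lwf lwx.
rewrite comatrix_comul_btens // /split_coact split_insert insert_sum.
rewrite (lin_sum (f := fun w => merge (reop (@reassV k H) wy we (cprod wf wx)
  (reop (@reass k H) we wf wx w)))); last by lin.
by apply: eq_bigr => i _; rewrite merge_split_op_alt.
Qed.

Lemma comatrix_counit_left c : blunit (bhcomp mu id (Δ c)) = c.
Proof.
have ll := counit_left_linear.
have lb := bhcomp_linear hC h1 hC hC hmu (bimod_map_id C).
have lu := blunit_linear hC.
have lD := comatrix_comul_linear hB hS hS' hE hE'.
move: c; apply: bcomp_ext => [||y x]; [lin|lin|].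
rewrite comatrix_comul_btens // /split_coact -/(counit_left _) /split_op counit_left_reass.
rewrite insert_sum.
have l1 := reop_linear (reassVP H) lwy lwe lwf.
rewrite (lin_sum (f := fun w => counit_left (reop (@reassV k H) wy we wf w))); last by lin.
rewrite [in RHS](dual_left y).
rewrite (lin_sum (f := fun y => btens y x : C)); last by lin.
apply: eq_bigr => i _.
rewrite (lin_reop (L := counit_left)) //.
pose G (y : Sg') : C := btens y x.
have lG : linear G by rewrite /G; lin.
rewrite -[RHS]/(G _) (lin_sw _ _ lG).
transitivity (\sw_(y0, y1 <- coact y) \sw_(e0, e1 <- coact (e i))
  \sw_(f0, f1 <- coact (f i)) @reassV k H y1 e1 f1 *: G (lact (mu (btens y0 e0) : A') f0)).
  rewrite sw_wf; [|done|done|lin]; rewrite [RHS]rev_sw3; apply: eq_sw => f0 f1.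
  rewrite sw_we; [|done|done|lin]; apply: eq_sw => e0 e1.
  rewrite sw_wy; [|done|lin]; apply: eq_sw => y0 y1.
  by rewrite counit_left_pure.
apply: eq_sw => y0 y1; rewrite (lin_sw _ _ lG); apply: eq_sw => e0 e1.
by rewrite (lin_sw _ _ lG); apply: eq_sw => f0 f1; rewrite (linZ _ _ lG).
Qed.

Lemma comatrix_counit_right c : brunit (bhcomp id mu (Δ c)) = c.
Proof.
have ll := counit_right_linear.
have lb := bhcomp_linear hC hC hC h1 (bimod_map_id C) hmu.
have lu := brunit_linear hC.
have lD := comatrix_comul_linear hB hS hS' hE hE'.
move: c; apply: bcomp_ext => [||y x]; [lin|lin|].
rewrite comatrix_comul_btens // /split_coact -/(counit_right _) split_insert.
rewrite counit_right_reassV insert_sum.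
have l1 := reop_linear (reassP H) lwe lwf lwx.
rewrite (lin_sum (f := fun w => counit_right (reop (@reass k H) we wf wx w))); last by lin.
rewrite [in RHS](dual_right x).
rewrite (lin_sum (f := fun x => btens y x : C)); last by lin.
apply: eq_bigr => i _.
rewrite (lin_reop (L := counit_right)) //.
pose G (x : Sg) : C := btens y x.
have lG : linear G by rewrite /G; lin.
rewrite -[RHS]/(G _) (lin_sw _ _ lG).
transitivity (\sw_(e0, e1 <- coact (e i)) \sw_(f0, f1 <- coact (f i))
  \sw_(x0, x1 <- coact x) @reass k H e1 f1 x1 *: G (ract e0 (mu (btens f0 x0) : A'))).
  rewrite sw_wx; [|done|lin]; rewrite [RHS]rev_sw3; apply: eq_sw => x0 x1.
  rewrite sw_wf; [|done|done|lin]; apply: eq_sw => f0 f1.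
  rewrite sw_we; [|done|done|lin]; apply: eq_sw => e0 e1.
  by rewrite counit_right_pure.
apply: eq_sw => e0 e1; rewrite (lin_sw _ _ lG); apply: eq_sw => f0 f1.
by rewrite (lin_sw _ _ lG); apply: eq_sw => x0 x1; rewrite (linZ _ _ lG).
Qed.

End DualBasis.

End ComatrixCounit.

Theorem theorem4p6 (k : comPzRingType) (H : dual_quasi_bialgebra k)
    (A : kalgebra k) (B : alg_data H)
    (Sigma : bimod_data B (triv_alg H A)) (Sigma' : bimod_data (triv_alg H A) B)
    (mu : bcomp Sigma' Sigma -> bim1 (triv_alg H A))
    (eta : bim1 B -> bcomp Sigma Sigma')
    (n : nat) (e : 'I_n -> Sigma) (f : 'I_n -> Sigma') :
  comodule_algebra B ->
  adjoint_pair mu eta e f ->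
  exists Delta : bcomp Sigma' Sigma ->
                 bcomp (bcomp Sigma' Sigma) (bcomp Sigma' Sigma),
    [/\ comonad Delta mu,
        forall (y : Sigma') (x : Sigma), Delta (btens y x) =
          \sum_(i < n) \sw_(y0, y1, y2 <- coact2 y)
          \sw_(e0, e1, e2 <- coact2 (e i)) \sw_(f0, f1, f2 <- coact2 (f i))
          \sw_(x0, x1 <- coact x)
            (φ (y1 ∙ e1) f1 x1 * φV y2 e2 f2) *:
            btens (btens y0 e0 : bcomp Sigma' Sigma)
                  (btens f0 x0 : bcomp Sigma' Sigma)
      & forall (y : Sigma') (x : Sigma), Delta (btens y x) =
          \sum_(i < n) \sw_(y0, y1 <- coact y)
          \sw_(e0, e1, e2 <- coact2 (e i)) \sw_(f0, f1, f2 <- coact2 (f i))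
          \sw_(x0, x1, x2 <- coact2 x)
            (φV y1 e1 (f1 ∙ x1) * φ e2 f2 x2) *:
            btens (btens y0 e0 : bcomp Sigma' Sigma)
                  (btens f0 x0 : bcomp Sigma' Sigma)].
Proof.
move=> [hB _ oneB [one_l one_r] _] [[hS hS'] [hEta hmu] eta1 dual_r dual_l].
have [[leta ceta] eta_l eta_r] := hEta.
have hE : coact (eta (aone B)) = eta (aone B) ⊗ dqb_one H.
  by rewrite ceta /= oneB sw_pure //; lin.
(* Both sides are η(b), by bilinearity of η. *)
have hE' (b : B) : lact b (eta (aone B)) = ract (eta (aone B)) b.
  by rewrite -eta_l -eta_r /= one_l one_r.
rewrite eta1 in hE hE'.
exists (comatrix_comul (\sum_(i < n) btens (e i) (f i))); split.
- split.
  + exact: bimodule_bcompA.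
  + exact: comatrix_comul_bimod_map.
  + exact: hmu.
  + exact: comatrix_coassoc.
  + by split; [exact: comatrix_counit_left|exact: comatrix_counit_right].
- exact: comatrix_comul_sum.
- exact: comatrix_comul_sum_alt.
Qed.
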